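(* Let $n\ge 1$ be an integer, $0<\alpha<1$, and let $f$ be an analytic function on $[0,+\infty)$ such that $f(0)\neq 0$ and $f(x)=\mathrm{O}(x^{n-\alpha-\varepsilon})$ as $x\to+\infty$ for some $0<\varepsilon<1$. Suppose that $f(z)$ is analytic in a domain $D\subset\mathbb{C}$ containing the positive real axis $[0,+\infty)$ in its interior. Then $$ \mathrm{f.p.}\int_0^{\infty}x^{\alpha-1-n}f(x)\,\mathrm{d}x =\frac{(-1)^{n+1}}{2\mathrm{i}\sin\pi\alpha}\oint_C(-z)^{\alpha-1-n}f(z)\,\mathrm{d}z, $$ where $C$ is a complex integral path such that it encircles the positive real axis in the positive sense and it is contained in $D$, and $z^{\alpha-1-n}$ is the principal value, that is, the branch which takes a real value on the positive real axis.
   Context: Hadamard finite-part integral: for an integer $n\ge1$, $0<\alpha<1$ and $f$ analytic on $[0,+\infty)$ with $f(0)\ne0$ and $f(x)=\mathrm{O}(x^{n-\alpha-\varepsilon})$ as $x\to+\infty$ ($0<\varepsilon<1$), $$ \mathrm{f.p.}\int_0^{\infty}x^{\alpha-1-n}f(x)\,\mathrm{d}x =\lim_{\epsilon\downarrow0}\left\{\int_{\epsilon}^{\infty}x^{\alpha-1-n}f(x)\,\mathrm{d}x-\sum_{k=0}^{n-1}\frac{\epsilon^{\alpha-n+k}}{k!\,(n-\alpha-k)}f^{(k)}(0)\right\}. $$ With the principal branch, $(-z)^{\alpha-1-n}$ is analytic in $\mathbb{C}\setminus[0,+\infty)$ and real for $z<0$. A path encircling the positive real axis in the positive sense comes in from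 infinity above the positive real axis, passes around the origin across the negative real axis, and returns to infinity below the positive real axis.
   Formalization: C is additionally required to be piecewise C¹, in the open first/fourth quadrants near infinity, deformable within D onto [0,∞) (displacement at infinity comparable to |z|), and f(z)=O(|z|^{n-α-ε}) must hold in the region swept between C and the axis; without such conditions the claim is false. *)

(* Defs.v *)
From Stdlib Require Export Reals Factorial.
From Coquelicot Require Export Coquelicot.

Open Scope R_scope.

(** * Domains and analytic functions *)

Definition connected_set (D : C -> Prop) : Prop :=
  forall U V : C -> Prop,
    open U -> open V ->
    (forall z, D z -> U z \/ V z) ->
    (exists z, D z /\ U z) -> (exists z, D z /\ V z) ->
    exists z, D z /\ U z /\ V z.

Definition domain (D : C -> Prop) : Prop := open D /\ connected_set D.

Definition nonneg_axis (z : C) : Prop := 0 <= Re z /\ Im z = 0.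

Definition analytic_at (f : C -> C) (z0 : C) : Prop :=
  exists a : nat -> C,
    locally z0 (fun z : C =>
      is_pseries (K := C_AbsRing) (V := C_NormedModule) a (z - z0)%C (f z)).

Definition analytic_on (D : C -> Prop) (f : C -> C) : Prop :=
  forall z, D z -> analytic_at f z.

Fixpoint C_derive_n (f : C -> C) (k : nat) : C -> C :=
  match k with
  | O => f
  | S k' => C_derive (C_derive_n f k')
  end.

(** * Principal powers *)

(** Argument with values in (-PI, PI]; its value at 0 is irrelevant. *)
Definition Carg (w : C) : R :=
  if Rle_dec 0 (Im w) then acos (Re w / Cmod w) else - acos (Re w / Cmod w).

(** [w ^ b = exp (b Log w)] for [w <> 0] and a real exponent [b]. *)
Definition Cpower (w : C) (b : R) : C :=
  (RtoC (Rpower (Cmod w) b) * (cos (b * Carg w), sin (b * Carg w)))%C.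

(** * The finite-part integral *)

(** [l] is the Hadamard finite part of the integral of
    [x ^ (alpha - 1 - n) f x] over the positive half-line.  [J eps] is the
    convergent improper integral over [eps, +oo); its existence for every
    [eps > 0] is part of the definition. *)
Definition is_finite_part (n : nat) (alpha : R) (f : C -> C) (l : C) : Prop :=
  exists J : R -> C,
    (forall eps, 0 < eps ->
       is_RInt_gen (V := C_R_NormedModule)
         (fun x => (RtoC (Rpower x (alpha - 1 - INR n)) * f (RtoC x))%C)
         (at_point eps) (Rbar_locally p_infty) (J eps)) /\
    filterlim
      (fun eps =>
         (J eps -
          sum_n (fun k =>
            RtoC (Rpower eps (alpha - INR n + INR k)
                  / (INR (fact k) * (INR n - alpha - INR k)))
            * C_derive_n f k (RtoC 0)) (n - 1))%C)
      (at_right 0) (locally l).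

(** * Contours *)

(** Every parameter has a one-sided neighbourhood on each side on which [g]
    is C^1 up to the endpoints.  By compactness this says that every [a, b]
    splits into finitely many closed intervals on each of which [g] is C^1. *)
Definition C1_between (g : R -> C) (a b : R) : Prop :=
  exists h dh : R -> C,
    (forall t, is_derive (V := C_R_NormedModule) h t (dh t)) /\
    (forall t, continuous dh t) /\
    (forall t, a <= t <= b -> g t = h t).

Definition piecewise_C1 (g : R -> C) : Prop :=
  forall t, exists d, 0 < d /\ C1_between g (t - d) t /\ C1_between g t (t + d).

(** [Derive] is total, so the velocity has junk values at the corners of the
    path; those are locally finite and do not affect the integral. *)
Definition velocity (g : R -> C) (t : R) : C :=
  (Derive (fun u => Re (g u)) t, Derive (fun u => Im (g u)) t).

Definition is_contour_integral (F : C -> C) (g : R -> C) (l : C) : Prop :=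
  is_RInt_gen (V := C_R_NormedModule)
    (fun t => (F (g t) * velocity g t)%C)
    (Rbar_locally m_infty) (Rbar_locally p_infty) l.

(** A path coming in from infinity above the positive real axis and going back
    to infinity below it, inside [D] and off [[0, +oo)].  Since it avoids
    [[0, +oo)], it has to cross the negative real axis in between. *)
Definition contour_in (D : C -> Prop) (g : R -> C) : Prop :=
  piecewise_C1 g /\
  (forall t, D (g t) /\ ~ nonneg_axis (g t)) /\
  is_lim (fun t => Cmod (g t)) m_infty p_infty /\
  is_lim (fun t => Cmod (g t)) p_infty p_infty /\
  Rbar_locally m_infty (fun t => 0 < Re (g t) /\ 0 < Im (g t)) /\
  Rbar_locally p_infty (fun t => 0 < Re (g t) /\ Im (g t) < 0).

(** [H] deforms the contour [g = H 1] inside [D] onto [[0, +oo)], which it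
    reaches only at the final stage [s = 0]; so whatever lies between [g] and
    the axis belongs to [D].  Near infinity the deformation is uniform in [s]
    and displaces a point by a distance comparable to its modulus. *)
Definition deforms_onto_axis (D : C -> Prop) (g : R -> C) (H : R -> R -> C)
  : Prop :=
  (forall s t, 0 <= s <= 1 ->
     filterlim (fun p : R * R => H (fst p) (snd p))
       (within (fun p : R * R => 0 <= fst p <= 1) (locally (s, t)))
       (locally (H s t))) /\
  (forall t, H 1 t = g t) /\
  (forall t, nonneg_axis (H 0 t)) /\
  (forall s t, 0 < s <= 1 -> D (H s t) /\ ~ nonneg_axis (H s t)) /\
  (forall A, exists T, forall s t,
     0 <= s <= 1 -> T <= Rabs t -> A <= Cmod (H s t)) /\
  (exists T, forall s t, 0 < s <= 1 ->
     (t <= - T -> 0 < Re (H s t) /\ 0 < Im (H s t)) /\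
     (T <= t -> 0 < Re (H s t) /\ Im (H s t) < 0)) /\
  (exists K T, forall s s' t,
     0 <= s <= 1 -> 0 <= s' <= 1 -> T <= Rabs t ->
     Cmod (H s t - H s' t)%C <= K * Rabs (s - s') * Cmod (H s t)).

(** [f z = O(|z| ^ p)] as [z] tends to infinity in the region swept by [H]. *)
Definition growth_in_swept_region (f : C -> C) (H : R -> R -> C) (p : R)
  : Prop :=
  exists M A, forall s t,
    0 <= s <= 1 -> A <= Cmod (H s t) ->
    Cmod (f (H s t)) <= M * Rpower (Cmod (H s t)) p.

(* Main.v *)
(** Write [b = alpha - 1 - n], [F z = (-z)^b f z] and [F0 z = z^b f z], all powers
    principal.  A domain that is starlike about a point of the negative axis and
    cut along [[0, +oo)] carries a primitive [Phi] of [F]; next to the cut it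
    equals [e^{-+ i pi b} Phi0 + k+-] above and below, where [Phi0] is a primitive
    of [F0] near the positive axis.  Local primitives glue to a potential along
    the deformation [H] (a simply connected parameter rectangle), so the integral
    of [F] over [g] between two far parameters is the increment of [Phi] along
    [H sigma], [sigma] small, up to the two side arcs; these are [O(A^-eps)] at
    modulus [A] because [H] is Lipschitz in [s] relative to the modulus.  Hence
    the contour integral converges to
    [(e^{i pi b} - e^{-i pi b}) Phi0(oo) + k- - k+].  On the other hand the jump of
    [Phi] across the cut at [e] differs by [O(e)] from the jump of the explicit
    primitives of [a_k z^k (-z)^b], [k <= n], since what remains of [F] is bounded
    near [0]; these jumps are the terms subtracted in the finite part. *)

Require Import Defs.
From Stdlib Require Import Lra Lia Classical ClassicalEpsilon.

(** * Complex derivatives and increments *)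

(** The obstacle is that the deformation ends on the cut itself, where F has two boundary values and
    is singular at the origin, so nothing can be integrated along [H 0]. Everything is therefore
    done with primitives for s in [sigma, 1], and only values of Phi are passed to the limit; sigma
    is chosen after the parameter window [t1, t2]. Since [H] is merely continuous, no integral along
    the curves [H s] or along the side arcs is formed: increments of potentials take the place of
    Cauchy's theorem. The constants k+ and k- are never computed. The contour value and the jump of
    Phi at e contain the same difference k- - k+, so subtracting the jump from the contour value
    leaves (e^{i pi b} - e^{-i pi b}) (Phi0(oo) - Phi0(e)). The factor equals 2 i (-1)^{n+1} sin (pi
    alpha), whose reciprocal is the coefficient in the theorem, and Phi0(oo) - Phi0(e) is the
    truncated integral. *)

Lemma norm_C_R (x : C) : @norm _ C_R_NormedModule x = Cmod x.
Proof.
  unfold norm; simpl. unfold prod_norm, Cmod, norm; simpl. unfold abs; simpl.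
  f_equal. rewrite !Rmult_1_r.
  f_equal; rewrite <- Rabs_mult; apply Rabs_pos_eq, Rle_0_sqr.
Qed.

Lemma locally_C_eps (z : C) (P : C -> Prop) :
  locally (T := C_UniformSpace) z P <->
  exists d, 0 < d /\ forall w, Cmod (w - z) < d -> P w.
Proof.
  split.
  - intros HP.
    destruct (locally_norm_le_locally (V := C_NormedModule) z P HP) as [d Hd].
    exists d; split; [apply cond_pos|]. intros w Hw; apply Hd; exact Hw.
  - intros [d [Hd HP]].
    apply (locally_le_locally_norm (V := C_NormedModule)).
    exists (mkposreal d Hd). intros w Hw; apply HP; exact Hw.
Qed.

Lemma locally_R_eps (x : R) (P : R -> Prop) :
  locally x P <-> exists d, 0 < d /\ forall y, Rabs (y - x) < d -> P y.
Proof.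
  split.
  - intros [d Hd]. exists d; split; [apply cond_pos|exact Hd].
  - intros [d [Hd HP]]. exists (mkposreal d Hd). exact HP.
Qed.

Lemma Cmod_minus_sym (a b : C) : Cmod (a - b) = Cmod (b - a).
Proof. rewrite <- Cmod_opp. f_equal. ring. Qed.

Lemma Cmod_triangle3 (a b c : C) : Cmod (a - c) <= Cmod (a - b) + Cmod (b - c).
Proof. replace (a - c)%C with ((a - b) + (b - c))%C by ring. apply Cmod_triangle. Qed.

Lemma Cmod_refl (a : C) : Cmod (a - a) = 0.
Proof. replace (a - a)%C with (RtoC 0) by ring. apply Cmod_0. Qed.

Lemma Cmod_eq_small (a b : C) :
  (forall e, 0 < e -> Cmod (a - b) <= e) -> a = b.
Proof.
  intros H. apply Ceq_minus, Cmod_eq_0.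
  destruct (Rle_lt_or_eq_dec 0 (Cmod (a - b)) (Cmod_ge_0 _)) as [h|h]; [|easy].
  specialize (H (Cmod (a - b) / 2)). lra.
Qed.

(** Plain epsilon-delta forms in terms of [Cmod]: C carries both a product and an absolute-ring
    uniform structure, and the estimates below should not have to switch between them. *)
Definition ccont (F : C -> C) (z : C) : Prop :=
  forall e, 0 < e -> exists d, 0 < d /\
    forall w, Cmod (w - z) < d -> Cmod (F w - F z) <= e.

Definition cderiv (F : C -> C) (z A : C) : Prop :=
  forall e, 0 < e -> exists d, 0 < d /\
    forall w, Cmod (w - z) < d ->
      Cmod (F w - F z - A * (w - z)) <= e * Cmod (w - z).

Lemma ccont_continuous (F : C -> C) (z : C) :
  ccont F z <-> continuous (T := C_UniformSpace) (U := C_UniformSpace) F z.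
Proof.
  split.
  - intros HF P HP. apply locally_C_eps in HP. destruct HP as [e [He HP]].
    apply locally_C_eps. destruct (HF (e / 2)) as [d [Hd Hw]]; [lra|].
    exists d; split; [easy|]. intros w Hwz. apply HP. specialize (Hw w Hwz). lra.
  - intros HF e He.
    assert (HP : locally (T := C_UniformSpace) z (fun w => Cmod (F w - F z) < e)).
    { apply (HF (fun y => Cmod (y - F z) < e)). apply locally_C_eps. now exists e. }
    apply locally_C_eps in HP. destruct HP as [d [Hd Hw]].
    exists d; split; [easy|]. intros w Hwz. left. now apply Hw.
Qed.

Lemma cderiv_is_derive (F : C -> C) (z A : C) :
  cderiv F z A <-> is_derive (K := C_AbsRing) (V := C_NormedModule) F z A.
Proof.
  split.
  - intros HF. split. { apply is_linear_scal_l. }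
    intros x Hx.
    rewrite <- (is_filter_lim_locally_unique (V := AbsRing_NormedModule C_AbsRing) z x Hx).
    intros e. destruct (HF e (cond_pos e)) as [d [Hd Hw]].
    apply locally_C, locally_C_eps. exists d; split; [easy|].
    intros w Hwz. specialize (Hw w Hwz).
    change (Cmod ((F w - F z) - (w - z) * A) <= e * Cmod (w - z)).
    now replace ((F w - F z) - (w - z) * A)%C with (F w - F z - A * (w - z))%C by ring.
  - intros [_ HF] e He.
    specialize (HF z (fun P HP => HP) (mkposreal e He)).
    apply locally_C, locally_C_eps in HF. destruct HF as [d [Hd Hw]].
    exists d; split; [easy|]. intros w Hwz. specialize (Hw w Hwz).
    change (Cmod ((F w - F z) - (w - z) * A) <= e * Cmod (w - z)) in Hw.
    now replace (F w - F z - A * (w - z))%C with ((F w - F z) - (w - z) * A)%C by ring.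
Qed.

(** The product and chain rules are stated for the ring as a module over itself, so this second form
    of the derivative is the one they apply to. *)
Lemma cderiv_is_derive_ring (F : C -> C) (z A : C) :
  cderiv F z A <->
  is_derive (K := C_AbsRing) (V := AbsRing_NormedModule C_AbsRing) F z A.
Proof.
  rewrite cderiv_is_derive. split; intros [Hl HF]; split.
  - apply is_linear_scal_l.
  - exact HF.
  - apply is_linear_scal_l.
  - exact HF.
Qed.

Lemma cderiv_C_derive (F : C -> C) (z A : C) : cderiv F z A -> C_derive F z = A.
Proof. intros H. now apply is_C_derive_unique, cderiv_is_derive. Qed.

Lemma cderiv_ccont (F : C -> C) (z A : C) : cderiv F z A -> ccont F z.
Proof.
  intros HF e He. destruct (HF 1 Rlt_0_1) as [d [Hd Hw]].
  pose proof (Cmod_ge_0 A) as HA.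
  exists (Rmin d (e / (1 + Cmod A))). split.
  { apply Rmin_pos; [easy|]. apply Rdiv_lt_0_compat; lra. }
  intros w Hwz.
  pose proof (Rlt_le_trans _ _ _ Hwz (Rmin_l _ _)) as H1.
  pose proof (Rlt_le_trans _ _ _ Hwz (Rmin_r _ _)) as H2.
  specialize (Hw w H1).
  replace (F w - F z)%C with ((F w - F z - A * (w - z)) + A * (w - z))%C by ring.
  eapply Rle_trans; [apply Cmod_triangle|]. rewrite Cmod_mult.
  apply (Rmult_lt_compat_r (1 + Cmod A)) in H2; [|lra].
  replace (e / (1 + Cmod A) * (1 + Cmod A)) with e in H2 by (field; lra). lra.
Qed.

Lemma cderiv_ext_loc (F G : C -> C) (z A : C) (r : R) :
  0 < r -> (forall w, Cmod (w - z) < r -> F w = G w) -> cderiv F z A -> cderiv G z A.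
Proof.
  intros Hr Heq HF e He. destruct (HF e He) as [d [Hd Hw]].
  exists (Rmin d r). split; [now apply Rmin_pos|]. intros w Hwz.
  rewrite <- (Heq w), <- (Heq z).
  - apply Hw. eapply Rlt_le_trans; [exact Hwz|apply Rmin_l].
  - now rewrite Cmod_refl.
  - eapply Rlt_le_trans; [exact Hwz|apply Rmin_r].
Qed.

Lemma cderiv_const (k z : C) : cderiv (fun _ => k) z 0.
Proof. apply cderiv_is_derive. apply (is_derive_const (K := C_AbsRing) (V := C_NormedModule)). Qed.

Lemma cderiv_id (z : C) : cderiv (fun w => w) z 1.
Proof. apply cderiv_is_derive_ring. apply (is_derive_id (K := C_AbsRing)). Qed.

Lemma cderiv_plus (F G : C -> C) (z A B : C) :
  cderiv F z A -> cderiv G z B -> cderiv (fun w => F w + G w)%C z (A + B)%C.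
Proof. rewrite !cderiv_is_derive. intros. now apply (is_derive_plus (K := C_AbsRing) (V := C_NormedModule)). Qed.

Lemma cderiv_mult (F G : C -> C) (z A B : C) :
  cderiv F z A -> cderiv G z B ->
  cderiv (fun w => F w * G w)%C z (A * G z + F z * B)%C.
Proof.
  rewrite !cderiv_is_derive_ring. intros.
  apply (is_derive_mult (K := C_AbsRing)); trivial. exact Cmult_comm.
Qed.

Lemma cderiv_comp (F G : C -> C) (z A B : C) :
  cderiv F (G z) A -> cderiv G z B -> cderiv (fun w => F (G w)) z (A * B)%C.
Proof.
  rewrite Cmult_comm, !cderiv_is_derive_ring. intros.
  now apply (is_derive_comp (K := C_AbsRing) (V := AbsRing_NormedModule C_AbsRing) F G).
Qed.

Lemma cderiv_scal (F : C -> C) (k z A : C) :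
  cderiv F z A -> cderiv (fun w => k * F w)%C z (k * A)%C.
Proof.
  intros HF. pose proof (cderiv_mult _ _ _ _ _ (cderiv_const k z) HF) as H.
  simpl in H. now replace (k * A)%C with (0 * F z + k * A)%C by ring.
Qed.

Lemma cderiv_opp (z : C) : cderiv (fun w => - w)%C z (- (1))%C.
Proof.
  replace (- (1))%C with (- (1) * 1)%C by ring.
  apply (cderiv_ext_loc (fun w => - (1) * w)%C _ _ _ 1 Rlt_0_1).
  - intros; ring.
  - apply cderiv_scal, cderiv_id.
Qed.

Lemma cderiv_minus (F G : C -> C) (z A B : C) :
  cderiv F z A -> cderiv G z B -> cderiv (fun w => F w - G w)%C z (A - B)%C.
Proof.
  intros HF HG. apply (cderiv_plus F (fun w => - G w)%C); [easy|].
  replace (- B)%C with (- (1) * B)%C by ring.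
  apply (cderiv_comp (fun w => - w)%C); [apply cderiv_opp|easy].
Qed.

Lemma sum_n_C_S (u : nat -> C) (m : nat) :
  sum_n (G := C_AbelianMonoid) u (S m) = (sum_n (G := C_AbelianMonoid) u m + u (S m))%C.
Proof. now rewrite sum_Sn. Qed.

Lemma cderiv_sum_n (F A : nat -> C -> C) (m : nat) (z : C) :
  (forall k, (k <= m)%nat -> cderiv (F k) z (A k z)) ->
  cderiv (fun w => sum_n (G := C_AbelianMonoid) (fun k => F k w) m) z
    (sum_n (G := C_AbelianMonoid) (fun k => A k z) m).
Proof.
  induction m as [|m IH]; intros HF.
  - rewrite sum_O. apply (cderiv_ext_loc (F 0%nat) _ _ _ 1 Rlt_0_1).
    + intros w _. now rewrite sum_O.
    + now apply HF.
  - rewrite sum_n_C_S.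
    apply (cderiv_ext_loc
      (fun w => sum_n (G := C_AbelianMonoid) (fun k => F k w) m + F (S m) w)%C _ _ _ 1 Rlt_0_1).
    + intros w _. now rewrite sum_n_C_S.
    + apply cderiv_plus; [apply IH; intros; apply HF; lia|apply HF; lia].
Qed.

(** The supremum of the points related to [a] is itself reached from its left, and if it were short
    of [b] it could be passed on its right. This replaces finite partitions throughout: it yields
    the mean value inequality, glues integrals over C1 pieces, compares potentials and propagates
    germs. *)
Lemma interval_induction (Q : R -> R -> Prop) (a b : R) :
  a <= b ->
  (forall x y z, a <= x -> x <= y -> y <= z -> z <= b -> Q x y -> Q y z -> Q x z) ->
  (forall t, a <= t <= b -> exists d, 0 < d /\
     (forall u, a <= u -> t - d <= u <= t -> Q u t) /\
     (forall u, u <= b -> t <= u <= t + d -> Q t u)) ->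
  Q a b.
Proof.
  intros Hab Htrans Hloc.
  set (E := fun x => a <= x <= b /\ Q a x).
  assert (Ea : E a).
  { split; [lra|]. destruct (Hloc a) as [d [Hd [H1 _]]]; [lra|]. apply H1; lra. }
  destruct (completeness E) as [s [Hs1 Hs2]].
  { exists b. intros x [Hx _]; lra. }
  { now exists a. }
  assert (Has : a <= s) by now apply Hs1.
  assert (Hsb : s <= b) by (apply Hs2; intros x [Hx _]; lra).
  destruct (Hloc s) as [d [Hd [Hl Hr]]]; [lra|].
  assert (Es : Q a s).
  { destruct (classic (exists x, E x /\ s - d <= x)) as [[x [[Hx HQ] Hxs]]|Hno].
    - assert (x <= s) by (now apply Hs1; split).
      apply (Htrans a x s); try lra; [easy|]. apply Hl; lra.
    - exfalso. assert (s <= s - d); [|lra]. apply Hs2. intros x Hx.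
      destruct (Rle_dec x (s - d)) as [h|h]; [easy|]. exfalso. apply Hno.
      exists x. split; [easy|lra]. }
  destruct (Req_dec s b) as [->|Hne]; [easy|].
  exfalso. set (u := Rmin b (s + d)).
  assert (Hub : u <= b) by apply Rmin_l.
  assert (Hud : u <= s + d) by apply Rmin_r.
  assert (Hsu : s < u) by (apply Rmin_glb_lt; lra).
  assert (u <= s); [|lra].
  apply Hs1. split; [lra|]. apply (Htrans a s u); try lra; [easy|]. apply Hr; lra.
Qed.

(** The error allowed at each point is proportional to length, so errors add up to [e * (b - a)], as
    small as desired. The majorant [m] is linear for Lipschitz bounds and a multiple of a negative
    power for decay at infinity. *)
Lemma increment_le (P : R -> C) (m : R -> R) (a b : R) :
  a <= b ->
  (forall t e, a <= t <= b -> 0 < e -> exists d, 0 < d /\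
     forall u v, a <= u -> v <= b -> t - d <= u -> u <= v -> v <= t + d ->
       u = t \/ v = t ->
       Cmod (P v - P u) <= m v - m u + e * (v - u)) ->
  Cmod (P b - P a) <= m b - m a.
Proof.
  intros Hab Hloc. apply Rle_plus_epsilon. intros e0 He0.
  set (e := e0 / (b - a + 1)).
  assert (He : 0 < e) by (apply Rdiv_lt_0_compat; lra).
  assert (Hmain : Cmod (P b - P a) <= m b - m a + e * (b - a)).
  { apply (interval_induction (fun u v => Cmod (P v - P u) <= m v - m u + e * (v - u)));
      [easy| |].
    - intros x y z _ _ _ _ H1 H2.
      pose proof (Cmod_triangle3 (P z) (P y) (P x)). lra.
    - intros t Ht. destruct (Hloc t e Ht He) as [d [Hd Hw]].
      exists d; split; [easy|]. split; intros u Hu Hut; apply Hw; try lra; auto. }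
  assert (e * (b - a) <= e0); [|lra].
  unfold e. apply (Rmult_le_reg_r (b - a + 1)); [lra|].
  replace (e0 / (b - a + 1) * (b - a) * (b - a + 1)) with (e0 * (b - a)) by (field; lra).
  nra.
Qed.

Lemma increment_le_lipschitz (P : R -> C) (B a b : R) :
  a <= b ->
  (forall t e, a <= t <= b -> 0 < e -> exists d, 0 < d /\
     forall u, a <= u <= b -> Rabs (u - t) <= d ->
       Cmod (P u - P t) <= (B + e) * Rabs (u - t)) ->
  Cmod (P b - P a) <= B * (b - a).
Proof.
  intros Hab Hloc.
  replace (B * (b - a)) with (B * b - B * a) by ring.
  apply (increment_le P (fun u => B * u)); [easy|].
  intros t e Ht He. destruct (Hloc t e Ht He) as [d [Hd Hw]].
  exists d; split; [easy|]. intros u v Hu Hv H1 H2 H3 [->| ->].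
  - specialize (Hw v). rewrite Rabs_pos_eq in Hw by lra.
    assert (Cmod (P v - P t) <= (B + e) * (v - t)) by (apply Hw; lra). lra.
  - specialize (Hw u). rewrite Rabs_left1 in Hw by lra. rewrite Cmod_minus_sym in Hw.
    assert (Cmod (P t - P u) <= (B + e) * - (u - t)) by (apply Hw; lra). lra.
Qed.

Definition seg (a b : C) (t : R) : C := (a + RtoC t * (b - a))%C.

Lemma seg_diff (a b : C) (t u : R) : (seg a b u - seg a b t = RtoC (u - t) * (b - a))%C.
Proof. unfold seg. rewrite RtoC_minus. ring. Qed.

Lemma seg_0 (a b : C) : seg a b 0 = a.
Proof. unfold seg. ring. Qed.

Lemma seg_1 (a b : C) : seg a b 1 = b.
Proof. unfold seg. ring. Qed.

(** The Lipschitz inequality for [F] minus [A] times the identity. Taking [A = 0] gives the mean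
    value inequality; a value of the derivative for [A] gives a first-order remainder. *)
Lemma segment_mvt (F F' : C -> C) (A a b : C) (B : R) :
  (forall t, 0 <= t <= 1 -> cderiv F (seg a b t) (F' (seg a b t))) ->
  (forall t, 0 <= t <= 1 -> Cmod (F' (seg a b t) - A) <= B) ->
  Cmod (F b - F a - A * (b - a)) <= B * Cmod (b - a).
Proof.
  intros HF HB. set (L := Cmod (b - a)).
  assert (HL : 0 <= L) by apply Cmod_ge_0.
  set (P := fun t => (F (seg a b t) - A * seg a b t)%C).
  replace (F b - F a - A * (b - a))%C with (P 1 - P 0)%C
    by (unfold P; rewrite seg_0, seg_1; ring).
  replace (B * L) with (B * L * (1 - 0)) by ring.
  apply increment_le_lipschitz; [lra|]. intros t e Ht He.
  destruct (HF t Ht (e / (L + 1))) as [d [Hd Hw]]; [apply Rdiv_lt_0_compat; lra|].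
  exists (d / (L + 1) / 2).
  assert (Hd2 : 0 < d / (L + 1)) by (apply Rdiv_lt_0_compat; lra).
  split; [lra|]. intros u Hu Hut.
  assert (Hdist : Cmod (seg a b u - seg a b t) = Rabs (u - t) * L)
    by now rewrite seg_diff, Cmod_mult, Cmod_R.
  specialize (Hw (seg a b u)). rewrite Hdist in Hw.
  assert (Hlt : Rabs (u - t) * L < d).
  { assert (Rabs (u - t) * (L + 1) <= d / (L + 1) / 2 * (L + 1))
      by (apply Rmult_le_compat_r; lra).
    replace (d / (L + 1) / 2 * (L + 1)) with (d / 2) in * by (field; lra).
    pose proof (Rabs_pos (u - t)). lra. }
  specialize (Hw Hlt).
  replace (P u - P t)%C with ((F (seg a b u) - F (seg a b t)
      - F' (seg a b t) * (seg a b u - seg a b t))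
    + (F' (seg a b t) - A) * (seg a b u - seg a b t))%C by (unfold P; ring).
  eapply Rle_trans; [apply Cmod_triangle|]. rewrite Cmod_mult, Hdist.
  specialize (HB t Ht). pose proof (Rabs_pos (u - t)).
  assert (e / (L + 1) * (Rabs (u - t) * L) <= e * Rabs (u - t)).
  { replace (e / (L + 1) * (Rabs (u - t) * L)) with (e * Rabs (u - t) * (L / (L + 1)))
      by (field; lra).
    rewrite <- (Rmult_1_r (e * Rabs (u - t))) at 2.
    apply Rmult_le_compat_l; [nra|]. apply (Rmult_le_reg_r (L + 1)); [lra|].
    unfold Rdiv. rewrite Rmult_assoc, Rinv_l by lra. lra. }
  assert (Cmod (F' (seg a b t) - A) * (Rabs (u - t) * L) <= B * (Rabs (u - t) * L)).
  { apply Rmult_le_compat_r; [nra|easy]. }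
  lra.
Qed.

Lemma segment_constant (F : C -> C) (a b : C) :
  (forall t, 0 <= t <= 1 -> cderiv F (seg a b t) 0) -> F b = F a.
Proof.
  intros HF. apply Cmod_eq_small. intros e He.
  pose proof (segment_mvt F (fun _ => 0) 0 a b 0 HF) as H.
  replace (F b - F a - 0 * (b - a))%C with (F b - F a)%C in H by ring.
  rewrite Rmult_0_l in H. enough (Cmod (F b - F a) <= 0) by lra.
  apply H. intros. rewrite Cmod_refl. lra.
Qed.

Lemma cderiv_path (Phi : C -> C) (h : R -> C) (t : R) (A v : C) :
  cderiv Phi (h t) A ->
  is_derive (V := C_R_NormedModule) h t v ->
  is_derive (V := C_R_NormedModule) (fun u => Phi (h u)) t (A * v)%C.
Proof.
  intros HP Hh.
  assert (Hc : continuous (U := C_UniformSpace) h t).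
  { apply (ex_derive_continuous (V := C_R_NormedModule)). now exists v. }
  destruct Hh as [_ Hh]. specialize (Hh t (fun P HP => HP)).
  split. { apply is_linear_scal_l. }
  intros x Hx.
  rewrite <- (is_filter_lim_locally_unique (V := R_NormedModule) t x Hx).
  intros e.
  pose proof (Cmod_ge_0 A) as HA. pose proof (Cmod_ge_0 v) as Hv.
  (* With [e1 <= 1] the path moves by at most [(Cmod v + 1) * x0], so the two error terms below
     total at most [e1 * (Cmod v + 1 + Cmod A) * x0]. *)
  set (K := Cmod A + Cmod v + 1 + 1).
  assert (HK : 0 < e / K).
  { apply Rdiv_lt_0_compat; [apply cond_pos|unfold K; lra]. }
  set (e1 := Rmin 1 (e / K)).
  assert (He1 : 0 < e1) by (apply Rmin_pos; lra).
  destruct (HP e1 He1) as [d [Hd Hw]].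
  assert (Hnear : locally t (fun u => Cmod (h u - h t) < d)).
  { apply (Hc (fun y => Cmod (y - h t) < d)), locally_C_eps. now exists d. }
  generalize (filter_and _ _ Hnear (Hh (mkposreal e1 He1))).
  apply filter_imp. intros u [Hu1 Hu2].
  rewrite norm_C_R in Hu2 |- *.
  change (norm (minus u t)) with (Rabs (u - t)) in *.
  change (minus (minus (h u) (h t)) (scal (minus u t) v))
    with (minus (minus (h u) (h t)) (@scal _ C_R_ModuleSpace (minus u t) v)) in Hu2.
  rewrite scal_R_Cmult in Hu2.
  change (Cmod ((h u - h t) - RtoC (u - t) * v) <= e1 * Rabs (u - t)) in Hu2.
  change (minus (minus (Phi (h u)) (Phi (h t))) (scal (minus u t) (A * v)%C))
    with (minus (minus (Phi (h u)) (Phi (h t)))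
            (@scal _ C_R_ModuleSpace (minus u t) (A * v)%C)).
  rewrite scal_R_Cmult.
  change (Cmod ((Phi (h u) - Phi (h t)) - RtoC (u - t) * (A * v)) <= e * Rabs (u - t)).
  specialize (Hw (h u) Hu1).
  set (x0 := Rabs (u - t)) in *. assert (Hx0 : 0 <= x0) by apply Rabs_pos.
  assert (Hhu : Cmod (h u - h t) <= (Cmod v + 1) * x0).
  { replace (h u - h t)%C with ((h u - h t - RtoC (u - t) * v) + RtoC (u - t) * v)%C by ring.
    eapply Rle_trans; [apply Cmod_triangle|]. rewrite (Cmod_mult _ v), Cmod_R. fold x0.
    assert (e1 <= 1) by apply Rmin_l. nra. }
  replace ((Phi (h u) - Phi (h t)) - RtoC (u - t) * (A * v))%C
    with ((Phi (h u) - Phi (h t) - A * (h u - h t))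
          + A * (h u - h t - RtoC (u - t) * v))%C by ring.
  eapply Rle_trans; [apply Cmod_triangle|]. rewrite (Cmod_mult A).
  assert (H1 : e1 * Cmod (h u - h t) <= e1 * ((Cmod v + 1) * x0))
    by (apply Rmult_le_compat_l; lra).
  assert (H2 : Cmod A * Cmod (h u - h t - RtoC (u - t) * v) <= Cmod A * (e1 * x0))
    by (apply Rmult_le_compat_l; lra).
  assert (H3 : e1 * K <= e).
  { assert (e1 <= e / K) by apply Rmin_r.
    replace (pos e) with (e / K * K) by (field; unfold K; lra).
    apply Rmult_le_compat_r; [unfold K; lra|easy]. }
  assert (H4 : e1 * K * x0 <= e * x0) by (apply Rmult_le_compat_r; lra).
  unfold K in H4. assert (0 <= e1 * x0) by nra. lra.
Qed.

(** * Power series *)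

Lemma pow_n_Cpow (x : C) (k : nat) : @pow_n C_Ring x k = (x ^ k)%C.
Proof. induction k as [|k IH]; [reflexivity|]. rewrite Cpow_S, <- IH. reflexivity. Qed.

Lemma is_pseries_C (a : nat -> C) (x l : C) :
  is_pseries (K := C_AbsRing) (V := C_NormedModule) a x l <->
  is_series (V := C_NormedModule) (fun k => x ^ k * a k)%C l.
Proof.
  unfold is_pseries. split; apply is_series_ext; intros k;
    [|symmetry]; exact (f_equal (fun y => y * a k)%C (pow_n_Cpow x k)).
Qed.

Lemma is_series_C_le (u : nat -> C) (v : nat -> R) (l : C) (m : R) :
  is_series (V := C_NormedModule) u l -> is_series v m ->
  (forall k, Cmod (u k) <= v k) -> Cmod l <= m.
Proof.
  intros Hu Hv Huv.
  apply (filterlim_le (F := eventually)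
    (fun n => norm (V := C_NormedModule) (sum_n u n)) (sum_n v) (norm (V := C_NormedModule) l) m).
  - exists 0%nat. intros n _.
    eapply Rle_trans; [apply (norm_sum_n_m (V := C_NormedModule))|].
    apply sum_n_m_le. exact Huv.
  - apply (filterlim_comp _ _ _ (sum_n u) norm eventually
      (locally (T := C_UniformSpace) l)); [exact Hu|].
    apply (filterlim_norm (V := C_NormedModule)).
  - exact Hv.
Qed.

Lemma term_le_sum_n (u : nat -> R) (k N : nat) :
  (forall n, 0 <= u n) -> (k <= N)%nat -> 0 <= sum_n u N /\ u k <= sum_n u N.
Proof.
  intros Hu. revert k. induction N as [|N IH]; intros k Hk.
  - replace k with 0%nat by lia. rewrite sum_O. split; [apply Hu|lra].
  - rewrite sum_Sn. change (plus (sum_n u N) (u (S N))) with (sum_n u N + u (S N)).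
    pose proof (Hu (S N)). destruct (Nat.eq_dec k (S N)) as [->|Hne].
    + destruct (IH 0%nat ltac:(lia)). lra.
    + destruct (IH k ltac:(lia)). lra.
Qed.

Lemma is_series_C_bounded (u : nat -> C) (l : C) :
  is_series (V := C_NormedModule) u l -> exists M, forall k, Cmod (u k) <= M.
Proof.
  intros Hu.
  assert (HP : locally (T := C_UniformSpace) l (fun w => Cmod (w - l) < 1)).
  { apply locally_C_eps. exists 1. split; [lra|easy]. }
  destruct (Hu _ HP) as [N HN].
  exists (2 + sum_n (fun k => Cmod (u k)) N).
  pose proof (term_le_sum_n (fun k => Cmod (u k))) as Hsum.
  intros k. destruct (Nat.le_gt_cases k N) as [Hk|Hk].
  - destruct (Hsum k N); [intros; apply Cmod_ge_0|easy|]. lra.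
  - destruct (Hsum 0%nat N) as [H0 _]; [intros; apply Cmod_ge_0|lia|].
    destruct k as [|k]; [lia|].
    pose proof (HN k ltac:(lia)) as H1. pose proof (HN (S k) ltac:(lia)) as H2.
    rewrite sum_Sn in H2.
    set (v := sum_n u k : C) in *.
    change (Cmod (v - l) < 1) in H1. change (Cmod (v + u (S k) - l) < 1) in H2.
    replace (u (S k)) with ((v + u (S k) - l) - (v - l))%C by ring.
    eapply Rle_trans; [apply Cmod_triangle|]. rewrite Cmod_opp. lra.
Qed.

Lemma is_series_C_tail (u : nat -> C) (l : C) :
  u 0%nat = 0 -> is_series (V := C_NormedModule) u l ->
  is_series (V := C_NormedModule) (fun k => u (S k)) l.
Proof.
  intros H0 Hu. apply is_series_incr_1. rewrite H0.
  change (is_series (V := C_NormedModule) u (l + 0)%C). now rewrite Cplus_0_r.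
Qed.

(** Induction on [m]: the remainder of exponent m + 3 is w times that of exponent m + 2, plus (m +
    2) z^(m+1) (w - z)^2. The constant is chosen to match the coefficients of a formal second
    derivative, which will majorise the sum of these remainders. *)
Lemma Cpow_taylor2 (r : R) (z w : C) (m : nat) :
  Cmod z <= r -> Cmod w <= r ->
  Cmod (w ^ (m + 2) - z ^ (m + 2) - INR (m + 2) * z ^ (m + 1) * (w - z))%C
  <= INR (m + 1) * INR (m + 2) * r ^ m * Cmod (w - z) ^ 2.
Proof.
  intros Hz Hw. pose proof (Cmod_ge_0 z) as Hz0. pose proof (Cmod_ge_0 (w - z)) as Hd0.
  induction m as [|m IH].
  - replace (w ^ (0 + 2) - z ^ (0 + 2) - INR (0 + 2) * z ^ (0 + 1) * (w - z))%C
      with ((w - z) ^ 2)%C by (simpl; rewrite RtoC_plus; ring).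
    rewrite Cmod_pow. simpl. nra.
  - replace (w ^ (S m + 2) - z ^ (S m + 2) - INR (S m + 2) * z ^ (S m + 1) * (w - z))%C
      with (w * (w ^ (m + 2) - z ^ (m + 2) - INR (m + 2) * z ^ (m + 1) * (w - z))
            + INR (m + 2) * (z ^ (m + 1) * (w - z) ^ 2))%C.
    2:{ replace (S m + 2)%nat with (S (m + 2)) by lia.
        replace (S m + 1)%nat with (S (m + 1)) by lia.
        replace (m + 2)%nat with (S (m + 1)) by lia.
        rewrite !Cpow_S, (S_INR (S (m + 1))), RtoC_plus.
        change ((w - z) ^ 2)%C with ((w - z) * ((w - z) * 1))%C. ring. }
    eapply Rle_trans; [apply Cmod_triangle|].
    rewrite !Cmod_mult, !Cmod_pow, Cmod_R, (Rabs_pos_eq (INR _)) by apply pos_INR.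
    assert (H1 : Cmod z ^ (m + 1) <= r ^ (m + 1)) by (apply pow_incr; lra).
    set (X := Cmod (w - z) ^ 2) in *.
    assert (HX : 0 <= X) by apply pow2_ge_0.
    assert (H2 : Cmod w * Cmod (w ^ (m + 2) - z ^ (m + 2)
              - INR (m + 2) * z ^ (m + 1) * (w - z))%C
            <= r * (INR (m + 1) * INR (m + 2) * r ^ m * X)).
    { apply Rmult_le_compat; try apply Cmod_ge_0; easy. }
    assert (H3 : INR (m + 2) * (Cmod z ^ (m + 1) * X) <= INR (m + 2) * (r ^ (m + 1) * X)).
    { apply Rmult_le_compat_l; [apply pos_INR|]. now apply Rmult_le_compat_r. }
    replace (S m + 1)%nat with (m + 2)%nat by lia.
    replace (S m + 2)%nat with (S (m + 2)) by lia. rewrite S_INR.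
    replace (m + 1)%nat with (S m) in * by lia.
    replace (m + 2)%nat with (S (S m)) in * by lia.
    rewrite !S_INR in *. change (r ^ S m) with (r * r ^ m) in *.
    pose proof (pos_INR m) as Hm.
    assert (0 <= r * r ^ m * X).
    { apply Rmult_le_pos; [|easy]. change (0 <= r ^ S m). apply pow_le. lra. }
    nra.
Qed.

Section PowerSeries.
Variables (f : C -> C) (z0 : C) (a : nat -> C) (d : R).
Hypothesis (Hd : 0 < d).
Hypothesis Hf : forall z, Cmod (z - z0) < d ->
  is_series (V := C_NormedModule) (fun k => (z - z0) ^ k * a k)%C (f z).

(** Convergence at [z0 + d / 2] gives a radius of convergence of at least d / 2, and [r] lies
    strictly inside it. *)
Let r := d / 4.
Let al (k : nat) := Cmod (a k).

Lemma radius_coefficients : Rbar_lt (Rabs r) (CV_radius al).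
Proof.
  destruct (is_series_C_bounded _ _ (Hf (z0 + RtoC (d / 2))%C ltac:(
    replace (z0 + RtoC (d / 2) - z0)%C with (RtoC (d / 2)) by ring;
    rewrite Cmod_R, Rabs_pos_eq; lra))) as [M HM].
  apply Rbar_lt_le_trans with (Finite (d / 2)).
  { simpl. unfold r. rewrite Rabs_pos_eq; lra. }
  apply (proj1 (CV_radius_bounded al)). exists M. intros k.
  specialize (HM k).
  replace (z0 + RtoC (d / 2) - z0)%C with (RtoC (d / 2)) in HM by ring.
  rewrite Cmod_mult, Cmod_pow, Cmod_R, (Rabs_pos_eq (d / 2)) in HM by lra.
  unfold al. rewrite Rabs_pos_eq; [lra|].
  apply Rmult_le_pos; [apply Cmod_ge_0|apply pow_le; lra].
Qed.

(** Each term has a first-order remainder quadratic in [w - z], and the factors sum to [M], the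
    formal second derivative of the series of moduli taken at [r]; hence the whole remainder is
    quadratic too. *)
Lemma pseries_cderiv (z : C) : Cmod (z - z0) < r ->
  is_series (V := C_NormedModule)
    (fun k => (z - z0) ^ k * (INR (S k) * a (S k)))%C (C_derive f z) /\
  cderiv f z (C_derive f z).
Proof.
  intros Hz. pose proof radius_coefficients as Hrad.
  assert (Hr : 0 < r) by (unfold r; lra).
  pose proof (CV_radius_derive al) as E1.
  pose proof (CV_radius_derive (PS_derive al)) as E2.
  assert (Hd1 : ex_series (fun k => Rabs (PS_derive al k * r ^ k))).
  { apply CV_disk_inside. now rewrite E1. }
  assert (Hd2 : ex_series (fun k => Rabs (PS_derive (PS_derive al) k * r ^ k))).
  { apply CV_disk_inside. now rewrite E2, E1. }
  destruct Hd2 as [M HM].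
  assert (Hex : exists s : C, is_series (V := C_NormedModule)
    (fun k => (z - z0) ^ k * (INR (S k) * a (S k)))%C s).
  { refine (ex_series_le (V := C_CompleteNormedModule)
    (fun k => (z - z0) ^ k * (INR (S k) * a (S k)))%C
    (fun k => Rabs (PS_derive al k * r ^ k)) _ Hd1).
    intros k. change (Cmod ((z - z0) ^ k * (INR (S k) * a (S k)))%C
      <= Rabs (PS_derive al k * r ^ k)).
    rewrite !Cmod_mult, Cmod_pow, Cmod_R. unfold PS_derive, al.
    rewrite !Rabs_mult, <- RPow_abs, (Rabs_pos_eq r), (Rabs_pos_eq (Cmod _))
      by (lra || apply Cmod_ge_0).
    rewrite Rmult_comm. apply Rmult_le_compat_l.
    - apply Rmult_le_pos; [apply Rabs_pos|apply Cmod_ge_0].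
    - apply pow_incr. split; [apply Cmod_ge_0|lra]. }
  destruct Hex as [s Hs].
  (* Shifted back so that term k is the derivative of term k of [f]; the value of [pred 0] is masked
     by the factor [INR 0]. *)
  assert (Hs0 : is_series (V := C_NormedModule)
     (fun k => INR k * (z - z0) ^ (pred k) * a k)%C s).
  { apply is_series_decr_1.
    change (is_series (V := C_NormedModule)
      (fun k => INR (S k) * (z - z0) ^ k * a (S k))%C
      (s + - (INR 0 * (z - z0) ^ (pred 0) * a 0%nat))%C).
    replace (s + - (INR 0 * (z - z0) ^ (pred 0) * a 0%nat))%C with s by (simpl; ring).
    revert Hs. apply is_series_ext. intros k.
    change ((z - z0) ^ k * (INR (S k) * a (S k)) = INR (S k) * (z - z0) ^ k * a (S k))%C. ring. }
  assert (Hquad : forall w, Cmod (w - z0) < r ->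
    Cmod (f w - f z - s * (w - z)) <= M * Cmod (w - z) ^ 2).
  { intros w Hw.
    assert (Hu : is_series (V := C_NormedModule)
      (fun k => a k * ((w - z0) ^ k - (z - z0) ^ k
                       - INR k * (z - z0) ^ (pred k) * (w - z)))%C
      (f w - f z - s * (w - z))%C).
    { pose proof (is_series_minus (V := C_NormedModule) _ _ _ _
        (is_series_minus (V := C_NormedModule) _ _ _ _
           (Hf w ltac:(unfold r in *; lra)) (Hf z ltac:(unfold r in *; lra)))
        (is_series_scal (V := C_NormedModule) (w - z)%C _ _ Hs0)) as H.
      replace (f w - f z - s * (w - z))%C with ((f w - f z) - (w - z) * s)%C by ring.
      revert H. apply is_series_ext. intros k.
      change (((w - z0) ^ k * a k - (z - z0) ^ k * a k)
        - (w - z) * (INR k * (z - z0) ^ (pred k) * a k)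
        = a k * ((w - z0) ^ k - (z - z0) ^ k
                       - INR k * (z - z0) ^ (pred k) * (w - z)))%C. ring. }
    (* The remainders of degree 0 and 1 vanish; dropping them aligns the index with that of the
       second derivative. *)
    apply is_series_C_tail in Hu.
    2:{ change (a 0%nat * ((w - z0) ^ 0 - (z - z0) ^ 0
                       - INR 0 * (z - z0) ^ (pred 0) * (w - z)) = 0)%C. simpl. ring. }
    apply is_series_C_tail in Hu.
    2:{ change (a 1%nat * ((w - z0) ^ 1 - (z - z0) ^ 1
                       - INR 1 * (z - z0) ^ (pred 1) * (w - z)) = 0)%C. simpl. ring. }
    refine (is_series_C_le _ _ _ _ Hu (is_series_scal_r (Cmod (w - z) ^ 2) _ _ HM) _).
    intros k. change (pred (S (S k))) with (S k).
    pose proof (Cpow_taylor2 r (z - z0) (w - z0) k ltac:(lra) ltac:(lra)) as H.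
    replace (k + 2)%nat with (S (S k)) in H by lia.
    replace (k + 1)%nat with (S k) in H by lia.
    replace (w - z0 - (z - z0))%C with (w - z)%C in H by ring.
    rewrite Cmod_mult. unfold PS_derive.
    change (scal (Rabs (INR (S k) * (INR (S (S k)) * al (S (S k))) * r ^ k)) (Cmod (w - z) ^ 2))
      with (Rabs (INR (S k) * (INR (S (S k)) * al (S (S k))) * r ^ k) * (Cmod (w - z) ^ 2)).
    rewrite Rabs_pos_eq.
    - fold (al (S (S k))).
      replace (INR (S k) * (INR (S (S k)) * al (S (S k))) * r ^ k * Cmod (w - z) ^ 2)
        with (al (S (S k)) * (INR (S k) * INR (S (S k)) * r ^ k * Cmod (w - z) ^ 2)) by ring.
      apply Rmult_le_compat_l; [apply Cmod_ge_0|exact H].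
    - apply Rmult_le_pos; [|apply pow_le; lra]. apply Rmult_le_pos; [apply pos_INR|].
      apply Rmult_le_pos; [apply pos_INR|apply Cmod_ge_0]. }
  assert (Hder : cderiv f z s).
  { intros e He. pose proof (Rabs_pos M) as HM0. pose proof (Rle_abs M) as HMa.
    assert (He2 : 0 < e / (Rabs M + 1)) by (apply Rdiv_lt_0_compat; lra).
    exists (Rmin (r - Cmod (z - z0)) (e / (Rabs M + 1))). split; [apply Rmin_pos; lra|].
    intros w Hw.
    pose proof (Rlt_le_trans _ _ _ Hw (Rmin_l _ _)) as H1.
    pose proof (Rlt_le_trans _ _ _ Hw (Rmin_r _ _)) as H2.
    eapply Rle_trans.
    { apply Hquad. pose proof (Cmod_triangle3 w z z0). lra. }
    pose proof (Cmod_ge_0 (w - z)).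
    simpl. rewrite Rmult_1_r, <- Rmult_assoc. apply Rmult_le_compat_r; [easy|].
    apply Rmult_lt_compat_r with (r := Rabs M + 1) in H2; [|lra].
    replace (e / (Rabs M + 1) * (Rabs M + 1)) with e in H2 by (field; lra). nra. }
  rewrite (cderiv_C_derive _ _ _ Hder). split; assumption.
Qed.

End PowerSeries.

Lemma analytic_at_derive (f : C -> C) (z0 : C) :
  analytic_at f z0 -> analytic_at (C_derive f) z0 /\ cderiv f z0 (C_derive f z0).
Proof.
  intros [a Ha]. apply locally_C_eps in Ha. destruct Ha as [d [Hd Ha]].
  assert (Hs : forall z, Cmod (z - z0) < d ->
    is_series (V := C_NormedModule) (fun k => (z - z0) ^ k * a k)%C (f z)).
  { intros z Hz. apply is_pseries_C. now apply Ha. }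
  pose proof (pseries_cderiv f z0 a d Hd Hs) as H. split.
  - exists (fun k => INR (S k) * a (S k))%C. apply locally_C_eps.
    exists (d / 4). split; [lra|]. intros z Hz. apply is_pseries_C. now apply H.
  - apply H. rewrite Cmod_refl. lra.
Qed.

(** * Taylor polynomials at the origin *)

Lemma C_derive_n_S (f : C -> C) (k : nat) : C_derive_n f (S k) = C_derive_n (C_derive f) k.
Proof. induction k as [|k IH]; [reflexivity|]. simpl in *. now rewrite IH. Qed.

Definition taylor (f : C -> C) (m : nat) (z : C) : C :=
  sum_n (G := C_AbelianMonoid)
    (fun k => C_derive_n f k (RtoC 0) / INR (fact k) * z ^ k)%C m.

Lemma cderiv_pow (k : nat) (z : C) : cderiv (fun w => w ^ (S k))%C z (INR (S k) * z ^ k)%C.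
Proof.
  induction k as [|k IH].
  - replace (INR 1 * z ^ 0)%C with (1:C) by (simpl; ring).
    apply (cderiv_ext_loc (fun w => w) _ _ _ 1 Rlt_0_1); [intros; now rewrite Cpow_1_r|].
    apply cderiv_id.
  - apply (cderiv_ext_loc (fun w => w * w ^ (S k))%C _ _ _ 1 Rlt_0_1).
    { intros; now rewrite (Cpow_S _ (S k)). }
    replace (INR (S (S k)) * z ^ S k)%C with (1 * z ^ (S k) + z * (INR (S k) * z ^ k))%C.
    + apply (cderiv_mult (fun w => w)); [apply cderiv_id|exact IH].
    + rewrite (S_INR (S k)), RtoC_plus, !Cpow_S. ring.
Qed.

Lemma INR_C_neq_0 (k : nat) : (0 < k)%nat -> RtoC (INR k) <> 0.
Proof. intros Hk He. apply RtoC_inj in He. apply (not_0_INR k); [lia|easy]. Qed.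

Lemma taylor_derive (f : C -> C) (m : nat) (z : C) :
  cderiv (taylor f (S m)) z (taylor (C_derive f) m z).
Proof.
  assert (Hterm : forall k, cderiv
    (fun w => C_derive_n f (S k) (RtoC 0) / INR (fact (S k)) * w ^ (S k))%C z
    (C_derive_n (C_derive f) k (RtoC 0) / INR (fact k) * z ^ k)%C).
  { intros k. rewrite C_derive_n_S.
    replace (C_derive_n (C_derive f) k 0 / INR (fact k) * z ^ k)%C
      with (C_derive_n (C_derive f) k 0 / INR (fact (S k)) * (INR (S k) * z ^ k))%C.
    - apply cderiv_scal, cderiv_pow.
    - change (fact (S k)) with (S k * fact k)%nat. rewrite mult_INR, RtoC_mult.
      field. split; apply INR_C_neq_0; [apply lt_O_fact|lia]. }
  induction m as [|m IH].
  - apply (cderiv_ext_loc (fun w => C_derive_n f 0 (RtoC 0) / INR (fact 0) * w ^ 0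
      + C_derive_n f 1 (RtoC 0) / INR (fact 1) * w ^ 1)%C _ _ _ 1 Rlt_0_1).
    { intros w _. unfold taylor. now rewrite sum_n_C_S, sum_O. }
    unfold taylor. rewrite sum_O.
    replace (C_derive_n (C_derive f) 0 0 / INR (fact 0) * z ^ 0)%C
      with (0 + C_derive_n (C_derive f) 0 0 / INR (fact 0) * z ^ 0)%C by ring.
    apply cderiv_plus; [|apply Hterm].
    apply (cderiv_ext_loc (fun w => C_derive_n f 0 (RtoC 0) / INR (fact 0) * 1)%C
      _ _ _ 1 Rlt_0_1); [easy|]. apply cderiv_const.
  - apply (cderiv_ext_loc (fun w => taylor f (S m) w
      + C_derive_n f (S (S m)) (RtoC 0) / INR (fact (S (S m))) * w ^ (S (S m)))%C
      _ _ _ 1 Rlt_0_1).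
    { intros w _. unfold taylor at 2. now rewrite sum_n_C_S. }
    unfold taylor at 2. rewrite sum_n_C_S. apply cderiv_plus; [exact IH|apply Hterm].
Qed.

Lemma taylor_at_0 (f : C -> C) (m : nat) : taylor f m (RtoC 0) = f (RtoC 0).
Proof.
  induction m as [|m IH].
  - unfold taylor. rewrite sum_O. simpl. field.
  - unfold taylor in *. rewrite sum_n_C_S, IH, Cpow_S. ring.
Qed.

(** Induction on the degree: the remainder of [f] vanishes at 0 and its derivative is the remainder
    of [C_derive f] one degree lower, so the mean value inequality on the segment from 0 gains a
    factor [Cmod z] with the same [K]. *)
Lemma taylor_bound (m : nat) (f : C -> C) (rho : R) :
  0 < rho -> (forall z, Cmod z < rho -> analytic_at f z) ->
  exists K r, 0 <= K /\ 0 < r <= rho /\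
    forall z, Cmod z < r -> Cmod (f z - taylor f m z) <= K * Cmod z ^ (S m).
Proof.
  revert f. induction m as [|m IH]; intros f Hrho Hf.
  - destruct (analytic_at_derive f 0) as [_ Hder].
    { apply Hf. now rewrite Cmod_0. }
    destruct (Hder 1 Rlt_0_1) as [d [Hd Hw]].
    exists (Cmod (C_derive f 0) + 1), (Rmin d rho).
    split. { pose proof (Cmod_ge_0 (C_derive f 0)). lra. }
    split. { split; [now apply Rmin_pos|apply Rmin_r]. }
    intros z Hz. specialize (Hw z).
    replace (z - 0)%C with z in Hw by ring.
    specialize (Hw (Rlt_le_trans _ _ _ Hz (Rmin_l _ _))).
    replace (f z - taylor f 0 z)%C
      with ((f z - f 0 - C_derive f 0 * z) + C_derive f 0 * z)%C.
    2:{ unfold taylor. rewrite sum_O. simpl. field. }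
    eapply Rle_trans; [apply Cmod_triangle|]. rewrite Cmod_mult. simpl. lra.
  - destruct (IH (C_derive f)) as [K [r [HK [Hr HB]]]]; [easy| |].
    { intros z Hz. now apply analytic_at_derive, Hf. }
    exists K, r. split; [easy|]. split; [easy|]. intros z Hz.
    assert (Hseg : forall t, 0 <= t <= 1 -> Cmod (seg 0 z t) <= Cmod z).
    { intros t Ht. unfold seg. replace (0 + t * (z - 0))%C with (t * z)%C by ring.
      rewrite Cmod_mult, Cmod_R, Rabs_pos_eq by lra.
      pose proof (Cmod_ge_0 z). nra. }
    pose proof (segment_mvt (fun w => f w - taylor f (S m) w)%C
      (fun w => C_derive f w - taylor (C_derive f) m w)%C 0 0 z (K * Cmod z ^ (S m))) as H.
    cbv beta in H. rewrite taylor_at_0 in H.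
    replace (f z - taylor f (S m) z - (f 0 - f 0) - 0 * (z - 0))%C
      with (f z - taylor f (S m) z)%C in H by ring.
    replace (z - 0)%C with z in H by ring.
    replace (K * Cmod z ^ S (S m)) with (K * Cmod z ^ S m * Cmod z) by (simpl; ring).
    apply H; intros t Ht; specialize (Hseg t Ht).
    + apply cderiv_minus; [|apply taylor_derive].
      apply analytic_at_derive, Hf. lra.
    + replace (C_derive f (seg 0 z t) - taylor (C_derive f) m (seg 0 z t) - 0)%C
        with (C_derive f (seg 0 z t) - taylor (C_derive f) m (seg 0 z t))%C by ring.
      eapply Rle_trans; [apply HB; lra|]. apply Rmult_le_compat_l; [easy|].
      apply pow_incr. split; [apply Cmod_ge_0|easy].
Qed.

(** * Primitives on starlike domains *)

Definition copen (Om : C -> Prop) : Prop :=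
  forall z, Om z -> exists r, 0 < r /\ forall w, Cmod (w - z) < r -> Om w.

Definition starlike (c : C) (Om : C -> Prop) : Prop :=
  forall z t, Om z -> 0 <= t <= 1 -> Om (seg c z t).

(** Continuity of the derivative is built in, so that primitives come from differentiating under the
    integral sign and Goursat's lemma is avoided. *)
Definition holomorphic (F F' : C -> C) (Om : C -> Prop) : Prop :=
  forall z, Om z -> cderiv F z (F' z) /\ ccont F' z.

Definition seg_integral (F : C -> C) (a b : C) : C :=
  ((b - a) * RInt (V := C_R_CompleteNormedModule) (fun t => F (seg a b t)) 0 1)%C.

Lemma is_derive_seg (a b : C) (t : R) :
  is_derive (V := C_R_NormedModule) (seg a b) t (b - a)%C.
Proof.
  split. { apply is_linear_scal_l. }
  intros x Hx. rewrite <- (is_filter_lim_locally_unique (V := R_NormedModule) t x Hx).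
  intros e. apply filter_forall. intros u. rewrite norm_C_R.
  change (minus (minus (seg a b u) (seg a b t)) (scal (minus u t) (b - a)%C))
    with (minus (minus (seg a b u) (seg a b t)) (@scal _ C_R_ModuleSpace (minus u t) (b - a)%C)).
  rewrite scal_R_Cmult.
  change (Cmod ((seg a b u - seg a b t) - RtoC (u - t) * (b - a)) <= e * Rabs (u - t)).
  rewrite seg_diff, Cmod_refl.
  apply Rmult_le_pos; [left; apply cond_pos|apply Rabs_pos].
Qed.

Lemma is_derive_RtoC (t : R) : is_derive (V := C_R_NormedModule) RtoC t (RtoC 1).
Proof.
  replace (RtoC 1) with (1 - 0)%C by ring.
  apply (is_derive_ext (V := C_R_NormedModule) (seg 0 1)).
  - intros u. change (@eq C (seg 0 1 u) (RtoC u)). unfold seg. ring.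
  - apply is_derive_seg.
Qed.

Lemma continuous_derive (h : R -> C) (t : R) (v : C) :
  is_derive (V := C_R_NormedModule) h t v -> continuous (U := C_UniformSpace) h t.
Proof. intros H. apply (ex_derive_continuous (V := C_R_NormedModule)). now exists v. Qed.

Lemma ccont_path (F : C -> C) (h : R -> C) (t : R) :
  ccont F (h t) -> continuous (U := C_UniformSpace) h t ->
  continuous (U := C_UniformSpace) (fun u => F (h u)) t.
Proof.
  intros HF Hh. apply (continuous_comp h F); [exact Hh|now apply ccont_continuous].
Qed.

Lemma is_RInt_Cmult (k : C) (f : R -> C) (a b : R) (l : C) :
  is_RInt (V := C_R_NormedModule) f a b l ->
  is_RInt (V := C_R_NormedModule) (fun t => k * f t)%C a b (k * l)%C.
Proof.
  intros Hf.
  pose proof (is_RInt_fct_extend_fst (U := R_NormedModule) (V := R_NormedModule) f a b l Hf) as H1.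
  pose proof (is_RInt_fct_extend_snd (U := R_NormedModule) (V := R_NormedModule) f a b l Hf) as H2.
  apply (is_RInt_fct_extend_pair (U := R_NormedModule) (V := R_NormedModule)).
  - apply (is_RInt_minus (V := R_NormedModule)); now apply (is_RInt_scal (V := R_NormedModule)).
  - apply (is_RInt_plus (V := R_NormedModule)); now apply (is_RInt_scal (V := R_NormedModule)).
Qed.

Lemma ex_RInt_C (f : R -> C) (a b : R) :
  (forall t, Rmin a b <= t <= Rmax a b -> continuous (U := C_UniformSpace) f t) ->
  is_RInt (V := C_R_NormedModule) f a b (RInt (V := C_R_CompleteNormedModule) f a b).
Proof.
  intros H. apply (RInt_correct (V := C_R_CompleteNormedModule)).
  now apply (ex_RInt_continuous (V := C_R_CompleteNormedModule)).
Qed.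

Lemma posreal_choice (P : R -> R -> Prop) :
  (forall t, exists d, 0 < d /\ P t d) ->
  exists delta : R -> posreal, forall t, P t (delta t).
Proof.
  intros H.
  exists (fun t => let (d, Hd) := constructive_indefinite_description _ (H t) in
            mkposreal d (proj1 Hd)).
  intros t. destruct (constructive_indefinite_description _ (H t)) as [d [H1 H2]]. exact H2.
Qed.

(** A Lebesgue number for the cover by intervals of radius [d] about [t]. The clause [d0 <= d] is
    the point: whatever lies within [d0] of [x] lies within [2 * d] of the centre [t]. *)
Lemma lebesgue_number_1d (a b : R) (P : R -> R -> Prop) :
  (forall t, a <= t <= b -> exists d, 0 < d /\ P t d) ->
  exists d0, 0 < d0 /\
    forall x, a <= x <= b -> exists t d, a <= t <= b /\ P t d /\ Rabs (x - t) < d /\ d0 <= d.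
Proof.
  intros H.
  destruct (posreal_choice (fun t d => a <= t <= b -> P t d)) as [delta Hdelta].
  { intros t. destruct (classic (a <= t <= b)) as [h|h].
    - destruct (H t h) as [d [Hd HP]]. now exists d.
    - exists 1. split; [lra|easy]. }
  destruct (compactness_value_1d a b delta) as [d0 Hd0].
  exists d0. split; [apply cond_pos|]. intros x Hx.
  destruct (NNPP _ (Hd0 x Hx)) as [t [Ht [H1 H2]]].
  exists t, (delta t). auto.
Qed.

Section StarPrimitive.
Variables (F F' : C -> C) (Om : C -> Prop) (c : C).
Hypothesis Hopen : copen Om.
Hypothesis Hstar : starlike c Om.
Hypothesis Hhol : holomorphic F F' Om.

(** Compactness of the segment from [c] to [z] turns continuity of [F'] along it into one [eta] for
    all [t]; this is what justifies differentiating under the integral sign. *)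
Lemma uniform_remainder (z : C) (e : R) : Om z -> 0 < e ->
  exists eta, 0 < eta /\ forall t h, 0 <= t <= 1 -> Cmod h < eta ->
    Om (seg c z t + h)%C /\
    Cmod (F (seg c z t + h)%C - F (seg c z t) - F' (seg c z t) * h) <= e * Cmod h.
Proof.
  intros Hz He. set (L := Cmod (z - c)). assert (HL : 0 <= L) by apply Cmod_ge_0.
  destruct (lebesgue_number_1d 0 1 (fun t d => forall w,
      Cmod (w - seg c z t) < 2 * (L + 1) * d ->
      Om w /\ Cmod (F' w - F' (seg c z t)) <= e / 2)) as [d0 [Hd0 Hleb]].
  { intros t Ht. pose proof (Hstar z t Hz Ht) as Hzt.
    destruct (Hopen _ Hzt) as [r [Hr Hrw]].
    destruct (proj2 (Hhol _ Hzt) (e / 2)) as [r2 [Hr2 Hrw2]]; [lra|].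
    assert (Hm : 0 < Rmin r r2) by now apply Rmin_pos.
    exists (Rmin r r2 / (2 * (L + 1))). split; [apply Rdiv_lt_0_compat; lra|].
    intros w Hw.
    replace (2 * (L + 1) * (Rmin r r2 / (2 * (L + 1)))) with (Rmin r r2) in Hw by (field; lra).
    split.
    - apply Hrw. eapply Rlt_le_trans; [exact Hw|apply Rmin_l].
    - apply Hrw2. eapply Rlt_le_trans; [exact Hw|apply Rmin_r]. }
  exists d0. split; [easy|]. intros t h Ht Hh.
  destruct (Hleb t Ht) as [t0 [d [Ht0 [HP [Htt Hdd]]]]].
  assert (Hnear : forall u, 0 <= u <= 1 ->
    Cmod (seg (seg c z t) (seg c z t + h) u - seg c z t0) < 2 * (L + 1) * d).
  { intros u Hu.
    replace (seg (seg c z t) (seg c z t + h) u - seg c z t0)%C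
      with (RtoC u * h + (seg c z t - seg c z t0))%C by (unfold seg; ring).
    eapply Rle_lt_trans; [apply Cmod_triangle|].
    rewrite seg_diff, !Cmod_mult, !Cmod_R, (Rabs_pos_eq u) by lra. fold L.
    pose proof (Cmod_ge_0 h). pose proof (Rabs_pos (t - t0)).
    assert (u * Cmod h <= 1 * Cmod h) by (apply Rmult_le_compat_r; lra).
    assert (Rabs (t - t0) * L <= d * L) by (apply Rmult_le_compat_r; lra).
    nra. }
  split.
  - rewrite <- (seg_1 (seg c z t) (seg c z t + h)). apply HP, Hnear. lra.
  - pose proof (segment_mvt F F' (F' (seg c z t)) (seg c z t) (seg c z t + h) e) as H.
    replace (seg c z t + h - seg c z t)%C with h in H by ring. apply H.
    + intros u Hu. apply Hhol, HP, Hnear, Hu.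
    + intros u Hu. eapply Rle_trans; [apply (Cmod_triangle3 _ (F' (seg c z t0)))|].
      assert (H1 := proj2 (HP _ (Hnear u Hu))).
      assert (H2 := proj2 (HP _ (Hnear 0 ltac:(lra)))). rewrite seg_0 in H2.
      rewrite Cmod_minus_sym in H2. lra.
Qed.

Lemma seg_continuous_F (z : C) (t : R) : Om z -> 0 <= t <= 1 ->
  continuous (U := C_UniformSpace) (fun u => F (seg c z u)) t.
Proof.
  intros Hz Ht. apply ccont_path.
  - eapply cderiv_ccont. apply Hhol, Hstar; assumption.
  - eapply continuous_derive, is_derive_seg.
Qed.

(** The product rule gives the derivative I z + (z - c) I2, where I2 is the integral of t F'(c + t
    (z - c)). Integrating the derivative of t F(c + t (z - c)) over [0, 1] shows that this sum is F
    z. *)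
Lemma star_primitive (z : C) : Om z -> cderiv (seg_integral F c) z (F z).
Proof.
  intros Hz.
  assert (HIF : forall w, Om w -> is_RInt (V := C_R_NormedModule) (fun t => F (seg c w t)) 0 1
     (RInt (V := C_R_CompleteNormedModule) (fun t => F (seg c w t)) 0 1)).
  { intros w Hw. apply ex_RInt_C. rewrite Rmin_left, Rmax_right by lra.
    intros t Ht. now apply seg_continuous_F. }
  set (I := fun w => RInt (V := C_R_CompleteNormedModule) (fun t => F (seg c w t)) 0 1 : C).
  set (g2 := fun t => (RtoC t * F' (seg c z t))%C).
  assert (Hg2c : forall t, 0 <= t <= 1 -> continuous (U := C_UniformSpace) g2 t).
  { intros t Ht.
    apply (continuous_ext (fun t => @scal R_Ring C_R_ModuleSpace t (F' (seg c z t)))).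
    { intros u. apply scal_R_Cmult. }
    apply (continuous_scal (V := C_R_NormedModule)); [apply continuous_id|].
    apply ccont_path; [now apply Hhol, Hstar|]. eapply continuous_derive, is_derive_seg. }
  assert (Hg2 : is_RInt (V := C_R_NormedModule) g2 0 1
     (RInt (V := C_R_CompleteNormedModule) g2 0 1)).
  { apply ex_RInt_C. rewrite Rmin_left, Rmax_right by lra. exact Hg2c. }
  set (I2 := RInt (V := C_R_CompleteNormedModule) g2 0 1 : C) in *.
  assert (HFz : (F z = I z + (z - c) * I2)%C).
  { set (Phi := fun tau => (tau * F (c + tau * (z - c)))%C).
    assert (Hd : forall t, 0 <= t <= 1 ->
      is_derive (V := C_R_NormedModule) (fun t => Phi (RtoC t)) t
        (F (seg c z t) + (z - c) * g2 t)%C).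
    { intros t Ht.
      replace (F (seg c z t) + (z - c) * g2 t)%C
        with ((F (seg c z t) + (z - c) * g2 t) * 1)%C by ring.
      apply cderiv_path; [|apply is_derive_RtoC].
      unfold Phi, g2.
      replace (F (seg c z t) + (z - c) * (t * F' (seg c z t)))%C
        with (1 * F (c + t * (z - c)) + t * (F' (seg c z t) * (z - c)))%C
        by (unfold seg; ring).
      apply (cderiv_mult (fun w => w) (fun w => F (c + w * (z - c))%C));
        [apply cderiv_id|].
      apply (cderiv_comp F (fun w => c + w * (z - c))%C).
      + change (cderiv F (seg c z t) (F' (seg c z t))). now apply Hhol, Hstar.
      + apply (cderiv_ext_loc (fun w => c + (z - c) * w)%C _ _ _ 1 Rlt_0_1);
          [intros; ring|].
        assert (Haff : cderiv (fun w => c + (z - c) * w)%C (RtoC t) (0 + (z - c) * 1)%C).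
        { apply cderiv_plus; [apply cderiv_const|apply cderiv_scal, cderiv_id]. }
        now replace (0 + (z - c) * 1)%C with (z - c)%C in Haff by ring. }
    assert (Hint : is_RInt (V := C_R_NormedModule)
      (fun t => F (seg c z t) + (z - c) * g2 t)%C 0 1 (F z)).
    { replace (F z) with (minus (Phi (RtoC 1)) (Phi (RtoC 0)) : C).
      2:{ change (Phi 1 - Phi 0 = F z)%C. unfold Phi.
          replace (c + 1 * (z - c))%C with z by ring. ring. }
      apply (is_RInt_derive (V := C_R_CompleteNormedModule) (fun t => Phi (RtoC t)));
        rewrite Rmin_left, Rmax_right by lra; [exact Hd|].
      intros t Ht. apply (continuous_plus (V := C_R_NormedModule)).
      - now apply seg_continuous_F.
      - apply (ccont_path (fun y => (z - c) * y)%C g2); [|now apply Hg2c].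
        eapply cderiv_ccont, cderiv_scal, cderiv_id. }
    apply (is_RInt_unique (V := C_R_CompleteNormedModule)) in Hint. rewrite <- Hint.
    apply (is_RInt_unique (V := C_R_CompleteNormedModule)).
    apply (is_RInt_plus (V := C_R_NormedModule)); [now apply HIF|].
    now apply is_RInt_Cmult. }
  intros e He.
  pose proof (Cmod_ge_0 (z - c)) as HL. pose proof (Cmod_ge_0 I2) as HI2.
  set (K := Cmod (z - c) + 1 + Cmod I2 + 1).
  assert (HK : 1 <= K) by (unfold K; lra).
  set (e1 := Rmin 1 (e / K)).
  assert (HeK : 0 < e / K) by (apply Rdiv_lt_0_compat; lra).
  assert (He1 : 0 < e1) by (apply Rmin_pos; lra).
  assert (He1K : e1 * K <= e).
  { replace e with (e / K * K) by (field; lra).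
    apply Rmult_le_compat_r; [lra|apply Rmin_r]. }
  destruct (uniform_remainder z e1 Hz He1) as [eta [Heta Hunif]].
  exists (Rmin eta e1). split; [now apply Rmin_pos|]. intros w Hw.
  set (h := (w - z)%C) in *.
  pose proof (Rlt_le_trans _ _ _ Hw (Rmin_l _ _)) as Hh1.
  pose proof (Rlt_le_trans _ _ _ Hw (Rmin_r _ _)) as Hh2.
  assert (Hh0 : 0 <= Cmod h) by apply Cmod_ge_0.
  assert (Hwz : w = (z + h)%C) by (unfold h; ring).
  assert (Hth : forall t, 0 <= t <= 1 -> Cmod (RtoC t * h) <= Cmod h).
  { intros t Ht. rewrite Cmod_mult, Cmod_R, Rabs_pos_eq by lra. nra. }
  assert (Hsegw : forall t, seg c w t = (seg c z t + RtoC t * h)%C).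
  { intros t. rewrite Hwz. unfold seg. ring. }
  assert (Hw' : Om w).
  { destruct (Hunif 1 h ltac:(lra) Hh1) as [Ho _]. now rewrite seg_1, <- Hwz in Ho. }
  assert (Hrem : Cmod (I w - I z - h * I2) <= e1 * Cmod h).
  { assert (Hint : is_RInt (V := C_R_NormedModule)
      (fun t => F (seg c w t) - F (seg c z t) - h * g2 t)%C 0 1 (I w - I z - h * I2)%C).
    { apply (is_RInt_minus (V := C_R_NormedModule)); [|now apply is_RInt_Cmult].
      apply (is_RInt_minus (V := C_R_NormedModule)); now apply HIF. }
    rewrite <- norm_C_R.
    replace (e1 * Cmod h) with ((1 - 0) * (e1 * Cmod h)) by ring.
    refine (norm_RInt_le_const (V := C_R_NormedModule) _ 0 1 _ _ Rle_0_1 _ Hint).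
    intros t Ht. rewrite norm_C_R. specialize (Hth t Ht).
    destruct (Hunif t (RtoC t * h)%C Ht) as [_ H]; [lra|].
    rewrite Hsegw.
    replace (F (seg c z t + t * h) - F (seg c z t) - h * g2 t)%C
      with (F (seg c z t + t * h) - F (seg c z t) - F' (seg c z t) * (t * h))%C
      by (unfold g2; ring).
    eapply Rle_trans; [exact H|]. apply Rmult_le_compat_l; lra. }
  unfold seg_integral. fold (I w) (I z).
  (* Substituting [HFz] leaves the remainder of [I] and a term quadratic in [h]. *)
  replace ((w - c) * I w - (z - c) * I z - F z * h)%C
    with ((z - c + h) * (I w - I z - h * I2) + h * h * I2)%C
    by (rewrite HFz, Hwz; ring).
  eapply Rle_trans; [apply Cmod_triangle|]. rewrite !Cmod_mult.
  assert (H1 : Cmod (z - c + h) <= Cmod (z - c) + 1).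
  { eapply Rle_trans; [apply Cmod_triangle|].
    assert (e1 <= 1) by apply Rmin_l. lra. }
  assert (H2 : Cmod (z - c + h) * Cmod (I w - I z - h * I2)
     <= (Cmod (z - c) + 1) * (e1 * Cmod h)).
  { apply Rmult_le_compat; try apply Cmod_ge_0; easy. }
  assert (H3 : Cmod h * Cmod h * Cmod I2 <= e1 * Cmod h * Cmod I2).
  { apply Rmult_le_compat_r; [easy|]. apply Rmult_le_compat_r; lra. }
  assert (H4 : e1 * K * Cmod h <= e * Cmod h) by (apply Rmult_le_compat_r; lra).
  unfold K in H4. assert (0 <= e1 * Cmod h) by nra. lra.
Qed.

End StarPrimitive.

Definition disc (z0 : C) (r : R) (z : C) : Prop := Cmod (z - z0) < r.

Lemma disc_open (z0 : C) (r : R) : copen (disc z0 r).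
Proof.
  intros z Hz. exists (r - Cmod (z - z0)). unfold disc in *. split; [lra|].
  intros w Hw. pose proof (Cmod_triangle3 w z z0). lra.
Qed.

Lemma disc_convex (z0 a : C) (r : R) : disc z0 r a -> starlike a (disc z0 r).
Proof.
  intros Ha z t Hz Ht. unfold disc in *.
  replace (seg a z t - z0)%C with (RtoC (1 - t) * (a - z0) + RtoC t * (z - z0))%C
    by (unfold seg; rewrite RtoC_minus; ring).
  eapply Rle_lt_trans; [apply Cmod_triangle|].
  rewrite !Cmod_mult, !Cmod_R, !Rabs_pos_eq by lra.
  destruct (Req_dec t 0) as [->|Ht0]; [lra|].
  assert (t * Cmod (z - z0) < t * r) by (apply Rmult_lt_compat_l; lra).
  assert ((1 - t) * Cmod (a - z0) <= (1 - t) * r) by (apply Rmult_le_compat_l; lra). lra.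
Qed.

Lemma seg_integral_refl (F : C -> C) (a : C) : seg_integral F a a = 0.
Proof. unfold seg_integral. ring. Qed.

Lemma seg_integral_primitive (F F' : C -> C) (Phi : C -> C) (z0 : C) (r : R) (a b : C) :
  holomorphic F F' (disc z0 r) ->
  (forall z, disc z0 r z -> cderiv Phi z (F z)) ->
  disc z0 r a -> disc z0 r b -> seg_integral F a b = (Phi b - Phi a)%C.
Proof.
  intros Hhol HPhi Ha Hb.
  enough ((seg_integral F a b - Phi b) = (seg_integral F a a - Phi a))%C as H.
  { rewrite seg_integral_refl in H.
    replace (seg_integral F a b) with (seg_integral F a b - Phi b + Phi b)%C by ring.
    rewrite H. ring. }
  apply (segment_constant (fun w => seg_integral F a w - Phi w)%C).
  intros t Ht. assert (Hs : disc z0 r (seg a b t)) by (apply disc_convex; trivial).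
  replace (RtoC 0) with (F (seg a b t) - F (seg a b t))%C by ring.
  apply cderiv_minus; [|now apply HPhi].
  eapply star_primitive; eauto using disc_open, disc_convex.
Qed.

(** Cauchy's theorem for a triangle inside a disc, where a primitive is at hand. *)
Lemma seg_integral_additive (F F' : C -> C) (z0 : C) (r : R) (a b c : C) :
  holomorphic F F' (disc z0 r) -> disc z0 r a -> disc z0 r b -> disc z0 r c ->
  (seg_integral F a b + seg_integral F b c = seg_integral F a c)%C.
Proof.
  intros Hhol Ha Hb Hc.
  rewrite (seg_integral_primitive F F' (seg_integral F a) z0 r b c); trivial.
  - ring.
  - intros z Hz. eapply star_primitive; eauto using disc_open, disc_convex.
Qed.

(** * Principal powers *)

Lemma Cmod_le_sum (z : C) : Cmod z <= Rabs (Re z) + Rabs (Im z).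
Proof.
  replace z with (RtoC (Re z) + Ci * RtoC (Im z))%C at 1.
  - eapply Rle_trans; [apply Cmod_triangle|].
    rewrite Cmod_mult, Cmod_Ci, !Cmod_R. lra.
  - destruct z; unfold RtoC, Ci, Cmult, Cplus; simpl; f_equal; ring.
Qed.

Lemma Rabs_Re_le (z : C) : Rabs (Re z) <= Cmod z.
Proof. eapply Rle_trans; [apply Rmax_l|apply Rmax_Cmod]. Qed.

Lemma Rabs_Im_le (z : C) : Rabs (Im z) <= Cmod z.
Proof. eapply Rle_trans; [apply Rmax_r|apply Rmax_Cmod]. Qed.

Lemma Cmod_sqr (z : C) : Cmod z * Cmod z = Re z * Re z + Im z * Im z.
Proof. pose proof (Cmod2_alt z). simpl in H. lra. Qed.

(** * Complex exponential, argument, logarithm and powers *)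

Definition cis (x : R) : C := (cos x, sin x).

Lemma cis_plus (x y : R) : cis (x + y) = (cis x * cis y)%C.
Proof. unfold cis, Cmult; simpl. rewrite cos_plus, sin_plus. f_equal; ring. Qed.

Lemma cis_0 : cis 0 = RtoC 1.
Proof. unfold cis, RtoC. now rewrite cos_0, sin_0. Qed.

Lemma Cmod_cis (x : R) : Cmod (cis x) = 1.
Proof.
  unfold Cmod, cis; simpl. pose proof (sin2_cos2 x) as H. unfold Rsqr in H.
  replace (cos x * (cos x * 1) + sin x * (sin x * 1)) with 1 by lra. apply sqrt_1.
Qed.

Lemma cis_nPI (k : nat) : cis (INR k * PI) = RtoC ((-1) ^ k).
Proof.
  induction k as [|k IH].
  - simpl. rewrite Rmult_0_l. apply cis_0.
  - rewrite S_INR, Rmult_plus_distr_r, cis_plus, IH, Rmult_1_l.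
    unfold cis, RtoC, Cmult; simpl. rewrite cos_PI, sin_PI. f_equal; ring.
Qed.

Definition Cexp (z : C) : C := (RtoC (exp (Re z)) * cis (Im z))%C.

Lemma Cexp_plus (z w : C) : Cexp (z + w) = (Cexp z * Cexp w)%C.
Proof. unfold Cexp. rewrite re_plus, im_plus, exp_plus, RtoC_mult, cis_plus. ring. Qed.

Lemma Cexp_0 : Cexp 0 = 1.
Proof. unfold Cexp; simpl. rewrite exp_0, cis_0. ring. Qed.

Lemma real_first_order (m : R -> R) (t e l : R) : is_derive m t l -> 0 < e ->
  exists d, 0 < d /\ forall u, Rabs (u - t) < d ->
    Rabs (m u - m t - (u - t) * l) <= e * Rabs (u - t).
Proof.
  intros [_ Hh] He. specialize (Hh t (fun P HP => HP) (mkposreal e He)).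
  apply locally_R_eps in Hh. destruct Hh as [d [Hd Hw]]. exists d. split; [easy|].
  intros u Hu. exact (Hw u Hu).
Qed.

Lemma first_order_at_0 (f : R -> R) (l e : R) : is_derive f 0 l -> 0 < e ->
  exists d, 0 < d /\ forall x, Rabs x < d -> Rabs (f x - f 0 - l * x) <= e * Rabs x.
Proof.
  intros Hf He. destruct (real_first_order f 0 e l Hf He) as [d [Hd Hw]].
  exists d. split; [easy|]. intros x Hx. specialize (Hw x).
  rewrite Rminus_0_r, (Rmult_comm x) in Hw. now apply Hw.
Qed.

Lemma Cexp_cderiv_0 : cderiv Cexp 0 1.
Proof.
  (* The real part will cost [4 * e * N] and the imaginary part [5 * e * N], where [N] is the
     modulus of the increment. *)
  intros e0 He0. set (e := Rmin 1 (e0 / 10)).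
  assert (He : 0 < e) by (apply Rmin_pos; lra).
  assert (He1 : e <= 1) by apply Rmin_l.
  assert (He10 : e <= e0 / 10) by apply Rmin_r.
  destruct (first_order_at_0 exp 1 e) as [d1 [Hd1 H1]]; [|easy|].
  { apply is_derive_Reals. apply derivable_pt_lim_exp_0. }
  destruct (first_order_at_0 cos 0 e) as [d2 [Hd2 H2]]; [|easy|].
  { apply is_derive_Reals. pose proof (derivable_pt_lim_cos 0) as H.
    now rewrite sin_0, Ropp_0 in H. }
  destruct (first_order_at_0 sin 1 e) as [d3 [Hd3 H3]]; [|easy|].
  { apply is_derive_Reals. pose proof (derivable_pt_lim_sin 0) as H.
    now rewrite cos_0 in H. }
  exists (Rmin (Rmin d1 e) (Rmin d2 d3)).
  split; [apply Rmin_pos; apply Rmin_pos; easy|].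
  intros w Hw. replace (w - 0)%C with w in * by ring. rewrite Cexp_0.
  pose proof (Rmin_l (Rmin d1 e) (Rmin d2 d3)). pose proof (Rmin_r (Rmin d1 e) (Rmin d2 d3)).
  pose proof (Rmin_l d1 e). pose proof (Rmin_r d1 e).
  pose proof (Rmin_l d2 d3). pose proof (Rmin_r d2 d3).
  pose proof (Rabs_Re_le w) as Hx. pose proof (Rabs_Im_le w) as Hy.
  set (x := Re w) in *. set (y := Im w) in *. set (N := Cmod w) in *.
  specialize (H1 x ltac:(lra)). specialize (H2 y ltac:(lra)). specialize (H3 y ltac:(lra)).
  rewrite exp_0 in H1. rewrite cos_0 in H2. rewrite sin_0 in H3.
  eapply Rle_trans; [apply Cmod_le_sum|].
  replace (Re (Cexp w - 1 - 1 * w)) with (exp x * cos y - 1 - x)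
    by (unfold Cexp, cis, x, y; simpl; unfold Re, Im; ring).
  replace (Im (Cexp w - 1 - 1 * w)) with (exp x * sin y - y)
    by (unfold Cexp, cis, x, y; simpl; unfold Re, Im; ring).
  set (r1 := exp x - 1 - 1 * x) in *. set (r2 := cos y - 1 - 0 * y) in *.
  set (r3 := sin y - 0 - 1 * y) in *.
  replace (exp x * cos y - 1 - x) with (r1 + (1 + x + r1) * r2) by (unfold r1, r2; ring).
  replace (exp x * sin y - y) with ((x + r1) * y + (1 + x + r1) * r3)
    by (unfold r1, r3; ring).
  pose proof (Rabs_pos x). pose proof (Rabs_pos y). pose proof (Rabs_pos r1).
  pose proof (Rabs_pos r2). pose proof (Rabs_pos r3).
  assert (HN : 0 <= N) by apply Cmod_ge_0.
  assert (K1 : Rabs r1 <= e * N) by nra.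
  assert (K2 : Rabs r2 <= e * N) by nra.
  assert (K3 : Rabs r3 <= e * N) by nra.
  assert (K4 : Rabs (x + r1) <= 2 * e).
  { eapply Rle_trans; [apply Rabs_triang|]. assert (e * N <= 1 * N) by nra. lra. }
  assert (K5 : Rabs (1 + x + r1) <= 3).
  { rewrite Rplus_assoc. eapply Rle_trans; [apply Rabs_triang|]. rewrite Rabs_R1. lra. }
  pose proof (Rabs_pos (x + r1)). pose proof (Rabs_pos (1 + x + r1)).
  assert (M1 : Rabs (r1 + (1 + x + r1) * r2) <= e * N + 3 * (e * N)).
  { eapply Rle_trans; [apply Rabs_triang|]. rewrite Rabs_mult.
    apply Rplus_le_compat; [easy|]. apply Rmult_le_compat; easy. }
  assert (M2 : Rabs ((x + r1) * y + (1 + x + r1) * r3) <= 2 * e * N + 3 * (e * N)).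
  { eapply Rle_trans; [apply Rabs_triang|]. rewrite !Rabs_mult.
    apply Rplus_le_compat; apply Rmult_le_compat; easy. }
  assert (10 * e * N <= e0 * N) by (apply Rmult_le_compat_r; lra).
  assert (0 <= e * N) by nra. lra.
Qed.

Lemma Cexp_cderiv (z : C) : cderiv Cexp z (Cexp z).
Proof.
  apply (cderiv_ext_loc (fun w => Cexp z * Cexp (w - z))%C _ _ _ 1 Rlt_0_1).
  { intros w _. rewrite <- Cexp_plus. f_equal. ring. }
  enough (H : cderiv (fun w => Cexp z * Cexp (w - z))%C z (Cexp z * (1 * 1))%C).
  { now replace (Cexp z * (1 * 1))%C with (Cexp z) in H by ring. }
  apply (cderiv_scal (fun w => Cexp (w - z))%C). apply (cderiv_comp Cexp (fun w => w - z)%C).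
  - replace (z - z)%C with (RtoC 0) by ring.
    apply Cexp_cderiv_0.
  - replace (RtoC 1) with (1 - 0)%C by ring.
    apply cderiv_minus; [apply cderiv_id|apply cderiv_const].
Qed.

Definition slit_plane (w : C) : Prop := 0 < Re w \/ Im w <> 0.

Lemma slit_plane_neq_0 (w : C) : slit_plane w -> w <> 0.
Proof. intros [H|H] ->; simpl in H; lra. Qed.

Lemma Carg_cos_sin (w : C) : w <> 0 ->
  cos (Carg w) = Re w / Cmod w /\ sin (Carg w) = Im w / Cmod w.
Proof.
  intros Hw. apply Cmod_gt_0 in Hw. pose proof (Cmod_sqr w) as Hs.
  pose proof (Rabs_Re_le w) as HR.
  assert (Hc : -1 <= Re w / Cmod w <= 1).
  { pose proof (Rabs_le_between (Re w) (Cmod w)) as [Hb _]. specialize (Hb HR).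
    split; apply (Rmult_le_reg_r (Cmod w)); try easy;
      unfold Rdiv; rewrite Rmult_assoc, Rinv_l; lra. }
  assert (Hsin : sin (acos (Re w / Cmod w)) = Rabs (Im w) / Cmod w).
  { rewrite sin_acos by easy.
    apply Rsqr_inj.
    - apply sqrt_pos.
    - apply Rmult_le_pos; [apply Rabs_pos|]. left. now apply Rinv_0_lt_compat.
    - rewrite Rsqr_sqrt.
      + unfold Rsqr.
        replace (Rabs (Im w) / Cmod w * (Rabs (Im w) / Cmod w))
          with (Rabs (Im w) * Rabs (Im w) / (Cmod w * Cmod w)) by (field; lra).
        rewrite <- Rabs_mult, (Rabs_pos_eq (Im w * Im w)) by apply Rle_0_sqr.
        replace (Im w * Im w) with (Cmod w * Cmod w - Re w * Re w) by lra. field. lra.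
      + assert (Rsqr (Re w / Cmod w) <= 1); [|lra].
        rewrite <- Rsqr_1. apply Rsqr_le_abs_1. rewrite Rabs_R1. now apply Rabs_le. }
  unfold Carg. destruct (Rle_dec 0 (Im w)) as [h|h].
  - rewrite cos_acos, Hsin, Rabs_pos_eq; easy.
  - rewrite cos_neg, sin_neg, cos_acos, Hsin, Rabs_left by lra. split; [easy|]. field. lra.
Qed.

Definition Clog (w : C) : C := (ln (Cmod w), Carg w).

Lemma Cexp_Clog (w : C) : w <> 0 -> Cexp (Clog w) = w.
Proof.
  intros Hw. destruct (Carg_cos_sin w Hw) as [Hc Hs]. apply Cmod_gt_0 in Hw.
  unfold Cexp, Clog, cis. simpl. rewrite exp_ln, Hc, Hs by easy.
  destruct w as [x y]. unfold RtoC, Cmult; simpl. f_equal; field; lra.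
Qed.

Lemma Cpower_Cexp (w : C) (b : R) : Cpower w b = Cexp (RtoC b * Clog w).
Proof.
  unfold Cpower, Cexp, cis, Rpower. rewrite re_scal_l, im_scal_l. reflexivity.
Qed.

Lemma Carg_range (w : C) : - PI <= Carg w <= PI.
Proof.
  pose proof PI_RGT_0. unfold Carg. pose proof (acos_bound (Re w / Cmod w)).
  destruct (Rle_dec 0 (Im w)); lra.
Qed.

(** The right, upper and lower half planes cover the slit plane, and on each the argument is an
    arctangent of a quotient of coordinates up to sign and shift; continuity of [Carg] is read off
    from these three charts. *)
Lemma Carg_right (w : C) : 0 < Re w -> Carg w = atan (Im w / Re w).
Proof.
  intros H. assert (Hw : w <> 0) by (apply slit_plane_neq_0; now left).
  destruct (Carg_cos_sin w Hw) as [Hc Hs]. apply Cmod_gt_0 in Hw.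
  pose proof (Carg_range w) as Hr. pose proof PI_RGT_0.
  assert (Hcp : 0 < cos (Carg w)) by (rewrite Hc; now apply Rdiv_lt_0_compat).
  rewrite <- (atan_tan (Carg w)).
  - f_equal. unfold tan. rewrite Hs, Hc. field. lra.
  - split.
    + apply Rnot_le_lt. intros Hn. rewrite <- cos_neg in Hcp.
      assert (cos (- Carg w) <= 0) by (apply cos_le_0; lra). lra.
    + apply Rnot_le_lt. intros Hn.
      assert (cos (Carg w) <= 0) by (apply cos_le_0; lra). lra.
Qed.

Lemma Carg_upper (w : C) : 0 < Im w -> Carg w = PI / 2 - atan (Re w / Im w) /\ 0 < Carg w < PI.
Proof.
  intros H. assert (Hw : w <> 0) by (apply slit_plane_neq_0; right; lra).
  destruct (Carg_cos_sin w Hw) as [Hc Hs]. apply Cmod_gt_0 in Hw.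
  pose proof (Carg_range w) as Hr. pose proof PI_RGT_0.
  assert (Hsp : 0 < sin (Carg w)) by (rewrite Hs; now apply Rdiv_lt_0_compat).
  assert (Hb : 0 < Carg w < PI).
  { split; apply Rnot_le_lt; intros Hn.
    - assert (0 <= sin (- Carg w)) by (apply sin_ge_0; lra).
      rewrite sin_neg in *. lra.
    - assert (Carg w = PI) as He by lra. rewrite He, sin_PI in Hsp. lra. }
  split; [|easy].
  enough (atan (Re w / Im w) = PI / 2 - Carg w) by lra.
  rewrite <- (atan_tan (PI / 2 - Carg w)) by lra.
  f_equal. unfold tan. rewrite sin_shift, cos_shift, Hs, Hc. field. lra.
Qed.

(** The opposite turns of the principal argument above and below the axis are the origin of the two
    different factors in front of Phi0. *)
Lemma Carg_opp_upper (w : C) : 0 < Im w -> Carg (- w) = Carg w - PI.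
Proof.
  intros H. unfold Carg. rewrite re_opp, im_opp, Cmod_opp.
  destruct (Rle_dec 0 (- Im w)); [lra|]. destruct (Rle_dec 0 (Im w)); [|lra].
  replace (- Re w / Cmod w) with (- (Re w / Cmod w)) by (unfold Rdiv; ring).
  rewrite acos_opp. ring.
Qed.

Lemma Carg_opp_lower (w : C) : Im w < 0 -> Carg (- w) = Carg w + PI.
Proof.
  intros H. unfold Carg. rewrite re_opp, im_opp, Cmod_opp.
  destruct (Rle_dec 0 (- Im w)); [|lra]. destruct (Rle_dec 0 (Im w)); [lra|].
  replace (- Re w / Cmod w) with (- (Re w / Cmod w)) by (unfold Rdiv; ring).
  rewrite acos_opp. ring.
Qed.

Lemma Carg_lower (w : C) : Im w < 0 -> Carg w = - (PI / 2) - atan (Re w / Im w).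
Proof.
  intros H.
  assert (H' : 0 < Im (- w)) by (rewrite im_opp; lra).
  pose proof (Carg_opp_lower w H) as E. destruct (Carg_upper _ H') as [E2 _].
  rewrite re_opp, im_opp in E2.
  replace (- Re w / - Im w) with (Re w / Im w) in E2 by (field; lra). lra.
Qed.

Lemma continuous_Re (w : C) : continuous (T := C_UniformSpace) (U := R_UniformSpace) Re w.
Proof. destruct w. apply (continuous_fst (U := R_UniformSpace) (V := R_UniformSpace)). Qed.

Lemma continuous_Im (w : C) : continuous (T := C_UniformSpace) (U := R_UniformSpace) Im w.
Proof. destruct w. apply (continuous_snd (U := R_UniformSpace) (V := R_UniformSpace)). Qed.

Lemma continuous_quotient (f g : C -> R) (w : C) :
  continuous (T := C_UniformSpace) (U := R_UniformSpace) f w ->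
  continuous (T := C_UniformSpace) (U := R_UniformSpace) g w -> g w <> 0 ->
  continuous (T := C_UniformSpace) (U := R_UniformSpace) (fun z => atan (f z / g z)) w.
Proof.
  intros Hf Hg H0.
  apply (continuous_comp (U := C_UniformSpace) (fun z => f z / g z) atan).
  - apply (continuous_mult (U := C_UniformSpace) (K := R_AbsRing)); [exact Hf|].
    apply (continuous_comp (U := C_UniformSpace) g Rinv); [exact Hg|].
    now apply continuous_Rinv.
  - apply (ex_derive_continuous (V := R_NormedModule)). auto_derive. easy.
Qed.

Lemma locally_Re_pos (w : C) : 0 < Re w -> locally (T := C_UniformSpace) w (fun z => 0 < Re z).
Proof. intros H. apply (continuous_Re w). now apply (open_gt 0). Qed.

Lemma locally_Im_pos (w : C) : 0 < Im w -> locally (T := C_UniformSpace) w (fun z => 0 < Im z).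
Proof. intros H. apply (continuous_Im w). now apply (open_gt 0). Qed.

Lemma locally_Im_neg (w : C) : Im w < 0 -> locally (T := C_UniformSpace) w (fun z => Im z < 0).
Proof. intros H. apply (continuous_Im w (fun y => y < 0)). now apply (open_lt 0). Qed.

Lemma slit_plane_open : copen slit_plane.
Proof.
  intros w Hw. apply (locally_C_eps w).
  destruct (Rlt_dec 0 (Re w)) as [h|h].
  - generalize (locally_Re_pos w h). apply filter_imp. now left.
  - destruct Hw as [Hw|Hw]; [easy|]. destruct (Rlt_dec 0 (Im w)) as [h2|h2].
    + generalize (locally_Im_pos w h2). apply filter_imp. intros z; right; lra.
    + assert (h3 : Im w < 0) by lra.
      generalize (locally_Im_neg w h3). apply filter_imp. intros z; right; lra.
Qed.

Lemma continuous_Carg (w : C) : slit_plane w ->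
  continuous (T := C_UniformSpace) (U := R_UniformSpace) Carg w.
Proof.
  intros Hw. destruct (Rlt_dec 0 (Re w)) as [h|h].
  - apply (continuous_ext_loc (T := C_UniformSpace) _ (fun z => atan (Im z / Re z))).
    + generalize (locally_Re_pos w h). apply filter_imp. intros z Hz. now rewrite Carg_right.
    + apply continuous_quotient; auto using continuous_Re, continuous_Im. lra.
  - destruct Hw as [Hw|Hw]; [easy|]. destruct (Rlt_dec 0 (Im w)) as [h2|h2].
    + apply (continuous_ext_loc (T := C_UniformSpace) _
        (fun z => plus (PI / 2) (opp (atan (Re z / Im z))))).
      * generalize (locally_Im_pos w h2). apply filter_imp. intros z Hz.
        symmetry. now apply Carg_upper.
      * apply (continuous_plus (V := R_NormedModule)); [apply continuous_const|].
        apply (continuous_opp (V := R_NormedModule)).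
        apply continuous_quotient; auto using continuous_Re, continuous_Im.
    + assert (h3 : Im w < 0) by lra.
      apply (continuous_ext_loc (T := C_UniformSpace) _
        (fun z => plus (- (PI / 2)) (opp (atan (Re z / Im z))))).
      * generalize (locally_Im_neg w h3). apply filter_imp. intros z Hz.
        symmetry. now apply Carg_lower.
      * apply (continuous_plus (V := R_NormedModule)); [apply continuous_const|].
        apply (continuous_opp (V := R_NormedModule)).
        apply continuous_quotient; auto using continuous_Re, continuous_Im.
Qed.

Lemma continuous_ln_Cmod (w : C) : w <> 0 ->
  continuous (T := C_UniformSpace) (U := R_UniformSpace) (fun z => ln (Cmod z)) w.
Proof.
  intros Hw. apply Cmod_gt_0 in Hw.
  apply (continuous_comp (U := C_UniformSpace) Cmod ln).
  - apply (filterlim_norm (V := C_NormedModule)).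
  - apply (ex_derive_continuous (V := R_NormedModule)). auto_derive. easy.
Qed.

Lemma continuous_real_eps (f : C -> R) (w : C) (e : R) :
  continuous (T := C_UniformSpace) (U := R_UniformSpace) f w -> 0 < e ->
  locally (T := C_UniformSpace) w (fun z => Rabs (f z - f w) < e).
Proof.
  intros Hf He. apply (Hf (fun y => Rabs (y - f w) < e)).
  apply locally_R_eps. now exists e.
Qed.

Lemma Clog_ccont (w : C) : slit_plane w -> ccont Clog w.
Proof.
  intros Hw e He.
  pose proof (continuous_real_eps _ w (e / 2)
    (continuous_ln_Cmod w (slit_plane_neq_0 w Hw)) ltac:(lra)) as H1.
  pose proof (continuous_real_eps _ w (e / 2) (continuous_Carg w Hw) ltac:(lra)) as H2.
  pose proof (filter_and _ _ H1 H2) as H. apply locally_C_eps in H.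
  destruct H as [d [Hd H]]. exists d; split; [easy|]. intros z Hz.
  destruct (H z Hz) as [K1 K2]. eapply Rle_trans; [apply Cmod_le_sum|].
  unfold Clog; simpl. unfold Rminus in *. lra.
Qed.

(** Inverse function argument: [Cexp] has the nonzero derivative [w] at [Clog w], and continuity of
    [Clog] keeps [Clog z] where that first-order expansion is valid. *)
Lemma Clog_cderiv (w : C) : slit_plane w -> cderiv Clog w (/ w).
Proof.
  intros Hw. pose proof (slit_plane_neq_0 w Hw) as Hn.
  assert (HW : 0 < Cmod w) by now apply Cmod_gt_0.
  intros e He. set (W := Cmod w) in *.
  (* The bound [W / 2] lets the error be absorbed in [Hk]; the other one makes the final error
     [e1 * (2 / (W * W))] at most [e]. *)
  set (e1 := Rmin (W / 2) (e * (W * W) / 2)).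
  assert (HWW : 0 < W * W) by nra.
  assert (He1 : 0 < e1) by (apply Rmin_pos; nra).
  assert (He1W : e1 <= W / 2) by apply Rmin_l.
  assert (He1e : e1 <= e * (W * W) / 2) by apply Rmin_r.
  destruct (Cexp_cderiv (Clog w) e1 He1) as [d1 [Hd1 H1]].
  destruct (Clog_ccont w Hw (d1 / 2)) as [d2 [Hd2 H2]]; [lra|].
  destruct (slit_plane_open w Hw) as [d3 [Hd3 H3]].
  exists (Rmin d2 d3). split; [now apply Rmin_pos|]. intros z Hz.
  pose proof (Rlt_le_trans _ _ _ Hz (Rmin_l _ _)) as Hz2.
  pose proof (Rlt_le_trans _ _ _ Hz (Rmin_r _ _)) as Hz3.
  specialize (H3 z Hz3). specialize (H2 z Hz2). specialize (H1 (Clog z) ltac:(lra)).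
  rewrite !Cexp_Clog in H1 by (trivial; now apply slit_plane_neq_0).
  set (k := (Clog z - Clog w)%C) in *. set (h := (z - w)%C) in *.
  assert (Hk : Cmod k <= 2 / W * Cmod h).
  { assert (W * Cmod k <= Cmod h + e1 * Cmod k).
    { unfold W. rewrite <- Cmod_mult.
      replace (w * k)%C with (h - (h - w * k))%C by ring.
      eapply Rle_trans; [apply Cmod_triangle|]. rewrite Cmod_opp. lra. }
    pose proof (Cmod_ge_0 k). assert (e1 * Cmod k <= W / 2 * Cmod k) by nra.
    apply (Rmult_le_reg_l (W / 2)); [lra|].
    replace (W / 2 * (2 / W * Cmod h)) with (Cmod h) by (field; lra). lra. }
  replace (k - / w * h)%C with (- / w * (h - w * k))%C by (field; easy).
  rewrite Cmod_mult, Cmod_opp, Cmod_inv by easy. fold W.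
  apply Rle_trans with (/ W * (e1 * (2 / W * Cmod h))).
  { apply Rmult_le_compat_l; [left; now apply Rinv_0_lt_compat|].
    eapply Rle_trans; [exact H1|]. apply Rmult_le_compat_l; lra. }
  replace (/ W * (e1 * (2 / W * Cmod h))) with (e1 * (2 / (W * W)) * Cmod h) by (field; lra).
  apply Rmult_le_compat_r; [apply Cmod_ge_0|].
  apply (Rmult_le_reg_r (W * W / 2)); [lra|].
  replace (e1 * (2 / (W * W)) * (W * W / 2)) with e1 by (field; lra). lra.
Qed.

Lemma Cpower_plus_nat (w : C) (b : R) (k : nat) : w <> 0 ->
  Cpower w (b + INR k) = (Cpower w b * w ^ k)%C.
Proof.
  intros Hw. induction k as [|k IH].
  - simpl. rewrite Rplus_0_r. ring.
  - rewrite S_INR, <- Rplus_assoc, Cpow_S.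
    replace (Cpower w b * (w * w ^ k))%C with (Cpower w b * w ^ k * w)%C by ring.
    rewrite <- IH, !Cpower_Cexp. rewrite RtoC_plus.
    replace ((RtoC (b + INR k) + 1) * Clog w)%C
      with (RtoC (b + INR k) * Clog w + Clog w)%C by ring.
    now rewrite Cexp_plus, Cexp_Clog.
Qed.

Lemma Cpower_pred (w : C) (b : R) : w <> 0 -> Cpower w b = (Cpower w (b - 1) * w)%C.
Proof.
  intros Hw. pose proof (Cpower_plus_nat w (b - 1) 1 Hw) as H.
  rewrite Cpow_1_r in H. simpl in H. now replace (b - 1 + 1) with b in H by ring.
Qed.

Lemma Cpower_cderiv (w : C) (b : R) : slit_plane w ->
  cderiv (fun z => Cpower z b) w (RtoC b * Cpower w (b - 1))%C.
Proof.
  intros Hw. pose proof (slit_plane_neq_0 w Hw) as Hn.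
  apply (cderiv_ext_loc (fun z => Cexp (RtoC b * Clog z)) _ _ _ 1 Rlt_0_1).
  { intros z _. now rewrite Cpower_Cexp. }
  replace (RtoC b * Cpower w (b - 1))%C with (Cexp (RtoC b * Clog w) * (RtoC b * / w))%C.
  - apply (cderiv_comp Cexp (fun z => RtoC b * Clog z)%C); [apply Cexp_cderiv|].
    now apply cderiv_scal, Clog_cderiv.
  - rewrite <- Cpower_Cexp, (Cpower_pred w b Hn). field. easy.
Qed.

Lemma Cmod_Cpower (w : C) (b : R) : Cmod (Cpower w b) = Rpower (Cmod w) b.
Proof.
  unfold Cpower. rewrite Cmod_mult. change (cos (b * Carg w), sin (b * Carg w)) with (cis (b * Carg w)).
  rewrite Cmod_cis, Cmod_R, Rabs_pos_eq; [ring|]. left. apply exp_pos.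
Qed.

Lemma Cpower_opp_upper (w : C) (b : R) : 0 < Im w ->
  Cpower (- w) b = (cis (- (PI * b)) * Cpower w b)%C.
Proof.
  intros H. unfold Cpower. rewrite Carg_opp_upper, Cmod_opp by easy.
  change (RtoC (Rpower (Cmod w) b) * cis (b * (Carg w - PI))
    = cis (- (PI * b)) * (RtoC (Rpower (Cmod w) b) * cis (b * Carg w)))%C.
  replace (b * (Carg w - PI)) with (- (PI * b) + b * Carg w) by ring.
  rewrite cis_plus. ring.
Qed.

Lemma Cpower_opp_lower (w : C) (b : R) : Im w < 0 ->
  Cpower (- w) b = (cis (PI * b) * Cpower w b)%C.
Proof.
  intros H. unfold Cpower. rewrite Carg_opp_lower, Cmod_opp by easy.
  change (RtoC (Rpower (Cmod w) b) * cis (b * (Carg w + PI))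
    = cis (PI * b) * (RtoC (Rpower (Cmod w) b) * cis (b * Carg w)))%C.
  replace (b * (Carg w + PI)) with (PI * b + b * Carg w) by ring.
  rewrite cis_plus. ring.
Qed.

Lemma Cpower_pos (x b : R) : 0 < x -> Cpower (RtoC x) b = RtoC (Rpower x b).
Proof.
  intros Hx. unfold Cpower. rewrite Carg_right by easy. simpl.
  unfold Rdiv. rewrite Rmult_0_l, atan_0, Rmult_0_r, cos_0, sin_0, Cmod_R, Rabs_pos_eq by lra.
  change (RtoC (Rpower x b) * RtoC 1 = RtoC (Rpower x b))%C. ring.
Qed.

(** * Potentials along a homotopy *)

Definition near (lam : R) (p q : R * R) : Prop :=
  - lam < fst p - fst q < lam /\ - lam < snd p - snd q < lam.

Definition midpoint (p q : R * R) : R * R :=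
  ((fst p + fst q) / 2, (snd p + snd q) / 2).

(** A cocycle condition imposed on small triangles only; for segment integrals it is Cauchy's
    theorem in discs. *)
Definition additive (X : R * R -> Prop) (lam : R) (delta : R * R -> R * R -> C) : Prop :=
  forall p q r, X p -> X q -> X r -> near lam p q -> near lam q r -> near lam p r ->
    (delta p q + delta q r = delta p r)%C.

(** Halving every side of a triangle of size [< 2 lam] cuts it into four
    triangles of size [< lam]. *)
Lemma additive_double (X : R * R -> Prop) (lam : R) (delta : R * R -> R * R -> C) :
  0 < lam ->
  (forall p q, X p -> X q -> X (midpoint p q)) ->
  additive X lam delta ->
  exists delta', additive X (2 * lam) delta' /\
    forall p q, X p -> X q -> near lam p q -> delta' p q = delta p q.
Proof.
  intros Hlam Hmid Hadd.
  exists (fun p q => delta p (midpoint p q) + delta (midpoint p q) q)%C. split.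
  - intros p q r Hp Hq Hr Hpq Hqr Hpr.
    pose proof (Hmid p q Hp Hq) as Hm. pose proof (Hmid q r Hq Hr) as Hn.
    pose proof (Hmid p r Hp Hr) as Ho.
    assert (E1 := Hadd (midpoint p q) q (midpoint q r) Hm Hq Hn).
    assert (E2 := Hadd p (midpoint p q) (midpoint p r) Hp Hm Ho).
    assert (E3 := Hadd (midpoint p r) (midpoint q r) r Ho Hn Hr).
    assert (E4 := Hadd (midpoint p q) (midpoint p r) (midpoint q r) Hm Ho Hn).
    unfold near, midpoint in *; simpl in *.
    rewrite <- E2, <- E3 by lra.
    rewrite <- E1 in E4 by lra.
    set (a := ((fst p + fst q) / 2, (snd p + snd q) / 2)) in *.
    set (b := ((fst q + fst r) / 2, (snd q + snd r) / 2)) in *.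
    set (o := ((fst p + fst r) / 2, (snd p + snd r) / 2)) in *.
    replace (delta p a + delta a q + (delta q b + delta b r))%C
      with (delta p a + (delta a q + delta q b) + delta b r)%C by ring.
    rewrite <- E4 by lra. ring.
  - intros p q Hp Hq Hpq. apply Hadd; auto; unfold near, midpoint in *; simpl; lra.
Qed.

(** Doubling until the scale exceeds the diameter [B] makes the cocycle condition global, and a
    global cocycle is the coboundary of its values from a base point. Closure under midpoints plays
    the part of simple connectedness. *)
Lemma additive_potential (X : R * R -> Prop) (lam B : R) (delta : R * R -> R * R -> C) :
  0 < lam ->
  (forall p q, X p -> X q -> X (midpoint p q)) ->
  (forall p q, X p -> X q -> near B p q) ->
  additive X lam delta ->
  exists P : R * R -> C, forall p q, X p -> X q -> near lam p q ->
    delta p q = (P q - P p)%C.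
Proof.
  intros Hlam Hmid HB Hadd.
  destruct (classic (exists p0, X p0)) as [[p0 Hp0]|Hno].
  2:{ exists (fun _ => RtoC 0). intros p q Hp. exfalso. eauto. }
  assert (Hk : forall k, exists delta', additive X (2 ^ k * lam) delta' /\
    forall p q, X p -> X q -> near lam p q -> delta' p q = delta p q).
  { induction k as [|k [d1 [H1 H2]]].
    - exists delta. simpl. rewrite Rmult_1_l. auto.
    - assert (Hpow : 1 <= 2 ^ k) by (apply pow_R1_Rle; lra).
      destruct (additive_double X (2 ^ k * lam) d1) as [d2 [H3 H4]]; try easy.
      { nra. }
      exists d2. split.
      + simpl. rewrite Rmult_assoc. exact H3.
      + intros p q Hp Hq Hpq. rewrite H4, H2; auto. unfold near in *. nra. }
  destruct (Pow_x_infinity 2 ltac:(rewrite Rabs_pos_eq; lra) (B / lam)) as [k Hk2].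
  specialize (Hk2 k ltac:(lia)).
  rewrite Rabs_pos_eq in Hk2 by (apply pow_le; lra).
  assert (HBk : B <= 2 ^ k * lam).
  { apply Rge_le in Hk2. apply (Rmult_le_compat_r lam) in Hk2; [|lra].
    replace (B / lam * lam) with B in Hk2 by (field; lra). exact Hk2. }
  destruct (Hk k) as [d [H1 H2]].
  exists (fun q => d p0 q). intros p q Hp Hq Hpq. rewrite <- (H2 p q Hp Hq Hpq).
  assert (Hn : forall p q, X p -> X q -> near (2 ^ k * lam) p q).
  { intros a b Ha Hb. specialize (HB a b Ha Hb). unfold near in *. lra. }
  rewrite <- (H1 p0 p q); auto. ring.
Qed.

Lemma lebesgue_number_2d (a b a' b' : R) (P : R -> R -> R -> Prop) :
  (forall s t, a <= s <= b -> a' <= t <= b' -> exists d, 0 < d /\ P s t d) ->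
  exists d0, 0 < d0 /\
    forall x y, a <= x <= b -> a' <= y <= b' -> exists s t d,
      a <= s <= b /\ a' <= t <= b' /\ P s t d /\
      Rabs (x - s) < d /\ Rabs (y - t) < d /\ d0 <= d.
Proof.
  intros H.
  assert (H' : forall s t, exists d, 0 < d /\ (a <= s <= b -> a' <= t <= b' -> P s t d)).
  { intros s t. destruct (classic (a <= s <= b /\ a' <= t <= b')) as [[h1 h2]|h].
    - destruct (H s t h1 h2) as [d [Hd HP]]. now exists d.
    - exists 1. split; [lra|]. intros h1 h2. exfalso; auto. }
  set (delta := fun s t => let (d, Hd) := constructive_indefinite_description _ (H' s t) in
            mkposreal d (proj1 Hd)).
  assert (Hdelta : forall s t, a <= s <= b -> a' <= t <= b' -> P s t (delta s t)).
  { intros s t. unfold delta.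
    destruct (constructive_indefinite_description _ (H' s t)) as [d [H1 H2]]. exact H2. }
  destruct (compactness_value_2d a b a' b' delta) as [d0 Hd0].
  exists d0. split; [apply cond_pos|]. intros x y Hx Hy.
  destruct (NNPP _ (Hd0 x y Hx Hy)) as [s [t [Hs [Ht [H1 [H2 H3]]]]]].
  exists s, t, (delta s t). auto 7.
Qed.

(** * Integrals along piecewise C1 paths *)

Lemma is_derive_Re_Im (h : R -> C) (t : R) (v : C) :
  is_derive (V := C_R_NormedModule) h t v ->
  is_derive (fun u => Re (h u)) t (Re v) /\ is_derive (fun u => Im (h u)) t (Im v).
Proof.
  intros Hh. split.
  - refine (filterdiff_comp' (V := C_R_NormedModule) (W := R_NormedModule)
      h (fun z : C => Re z) t _ (fun z : C => Re z) Hh _).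
    apply (filterdiff_linear (V := R_NormedModule)), (is_linear_fst (U := R_NormedModule) (V := R_NormedModule)).
  - refine (filterdiff_comp' (V := C_R_NormedModule) (W := R_NormedModule)
      h (fun z : C => Im z) t _ (fun z : C => Im z) Hh _).
    apply (filterdiff_linear (V := R_NormedModule)), (is_linear_snd (U := R_NormedModule) (V := R_NormedModule)).
Qed.

(** Restricted to interior points: at the ends of a C1 piece [velocity g] may have junk values,
    which the integral ignores. *)
Lemma velocity_between (g h dh : R -> C) (a b x : R) :
  (forall t, is_derive (V := C_R_NormedModule) h t (dh t)) ->
  (forall t, a <= t <= b -> g t = h t) -> a < x < b -> velocity g x = dh x.
Proof.
  intros Hh Hgh Hx. destruct (is_derive_Re_Im h x (dh x) (Hh x)) as [H1 H2].
  assert (Hloc : locally x (fun u => h u = g u)).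
  { apply locally_R_eps. exists (Rmin (x - a) (b - x)). split; [apply Rmin_pos; lra|].
    intros y Hy. symmetry. apply Hgh.
    pose proof (Rlt_le_trans _ _ _ Hy (Rmin_l _ _)) as K1.
    pose proof (Rlt_le_trans _ _ _ Hy (Rmin_r _ _)) as K2.
    apply Rabs_def2 in K1. apply Rabs_def2 in K2. lra. }
  unfold velocity. rewrite (surjective_pairing (dh x)). f_equal.
  - apply is_derive_unique. revert H1. apply is_derive_ext_loc.
    revert Hloc. apply filter_imp. intros u ->. reflexivity.
  - apply is_derive_unique. revert H2. apply is_derive_ext_loc.
    revert Hloc. apply filter_imp. intros u ->. reflexivity.
Qed.

Lemma continuous_Cmult (f g : R -> C) (t : R) :
  continuous (U := C_UniformSpace) f t -> continuous (U := C_UniformSpace) g t ->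
  continuous (U := C_UniformSpace) (fun u => f u * g u)%C t.
Proof.
  intros Hf Hg.
  apply (filterlim_comp_2 (F := locally t)
    (G := locally (T := AbsRing_UniformSpace C_AbsRing) (f t))
    (H := locally (T := AbsRing_UniformSpace C_AbsRing) (g t)) f g Cmult).
  - intros P HP. apply Hf. now apply locally_C.
  - intros P HP. apply Hg. now apply locally_C.
  - intros P HP. apply (filterlim_mult (K := C_AbsRing) (f t) (g t) P). now apply locally_C.
Qed.

Section ContourIntegral.
Variables (F : C -> C) (g p : R -> C) (a b : R).
Hypothesis Hg : piecewise_C1 g.
Hypothesis Hp : forall t0, a <= t0 <= b -> exists Phi r, 0 < r /\
  (forall z, disc (g t0) r z -> cderiv Phi z (F z) /\ ccont F z) /\
  exists d, 0 < d /\ forall t, a <= t <= b -> Rabs (t - t0) < d ->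
    (p t - p t0 = Phi (g t) - Phi (g t0))%C.

Lemma C1_piece_integral (h dh : R -> C) (t0 r : R) (Phi : C -> C) (u v : R) :
  u <= v ->
  (forall t, is_derive (V := C_R_NormedModule) h t (dh t)) ->
  (forall t, continuous dh t) ->
  (forall t, u <= t <= v -> g t = h t) ->
  (forall t, u <= t <= v -> disc (g t0) r (h t)) ->
  (forall z, disc (g t0) r z -> cderiv Phi z (F z) /\ ccont F z) ->
  is_RInt (V := C_R_NormedModule) (fun t => F (g t) * velocity g t)%C u v
    (Phi (g v) - Phi (g u))%C.
Proof.
  intros Huv Hh Hdh Hgh Hdisc HPhi.
  rewrite (Hgh v), (Hgh u) by lra.
  apply (is_RInt_ext (V := C_R_NormedModule) (fun t => F (h t) * dh t)%C).
  { rewrite Rmin_left, Rmax_right by lra. intros x Hx.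
    rewrite (velocity_between g h dh u v x), Hgh; trivial. lra. }
  apply (is_RInt_derive (V := C_R_CompleteNormedModule) (fun t => Phi (h t)));
    rewrite Rmin_left, Rmax_right by lra; intros t Ht.
  - apply cderiv_path; [now apply HPhi, Hdisc|apply Hh].
  - assert (H1 : continuous (U := C_UniformSpace) (fun t => F (h t)) t).
    { apply ccont_path; [now apply HPhi, Hdisc|]. eapply continuous_derive, Hh. }
    now apply continuous_Cmult.
Qed.

(** Around every [t] there is a C1 piece ending at [t] and one starting there, and the fundamental
    theorem of calculus with a local primitive applies to each. Corners thus always fall on ends of
    pieces. *)
Lemma contour_integral_primitive : a <= b ->
  is_RInt (V := C_R_NormedModule) (fun t => F (g t) * velocity g t)%C a b (p b - p a)%C.
Proof.
  intros Hab.
  apply (interval_induction (fun u v => is_RInt (V := C_R_NormedModule)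
     (fun t => F (g t) * velocity g t)%C u v (p v - p u)%C)); [easy| |].
  - intros x y z _ _ _ _ H1 H2.
    replace (p z - p x)%C with ((p y - p x) + (p z - p y))%C by ring.
    exact (is_RInt_Chasles (V := C_R_NormedModule) _ x y z _ _ H1 H2).
  - intros t Ht. destruct (Hp t Ht) as [Phi [r [Hr [HPhi [d1 [Hd1 Hpd]]]]]].
    destruct (Hg t) as [d2 [Hd2 [[h1 [dh1 [H1a [H1b H1c]]]] [h2 [dh2 [H2a [H2b H2c]]]]]]].
    assert (Hnear : forall h dh, (forall t, is_derive (V := C_R_NormedModule) h t (dh t)) ->
       g t = h t -> exists e, 0 < e /\ forall u, Rabs (u - t) < e -> disc (g t) r (h u)).
    { intros h dh Hh Hgt. apply locally_R_eps. rewrite Hgt.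
      apply (continuous_derive h t (dh t) (Hh t) (disc (h t) r)).
      apply locally_C_eps. now exists r. }
    destruct (Hnear h1 dh1 H1a) as [e1 [He1 Hn1]]; [apply H1c; lra|].
    destruct (Hnear h2 dh2 H2a) as [e2 [He2 Hn2]]; [apply H2c; lra|].
    set (m := Rmin (Rmin d1 d2) (Rmin e1 e2)).
    assert (Hm : 0 < m) by (unfold m; repeat apply Rmin_pos; assumption).
    pose proof (Rmin_l (Rmin d1 d2) (Rmin e1 e2)) as L1.
    pose proof (Rmin_r (Rmin d1 d2) (Rmin e1 e2)) as L2. fold m in L1, L2.
    pose proof (Rmin_l d1 d2). pose proof (Rmin_r d1 d2).
    pose proof (Rmin_l e1 e2). pose proof (Rmin_r e1 e2).
    exists (m / 2). split; [lra|]. split; intros u Hu Hut.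
    + replace (p t - p u)%C with (Phi (g t) - Phi (g u))%C.
      2:{ assert (E : (p u - p t = Phi (g u) - Phi (g t))%C).
          { apply Hpd; [lra|]. rewrite Rabs_left1; lra. }
          replace (p t - p u)%C with (- (p u - p t))%C by ring. rewrite E. ring. }
      apply (C1_piece_integral h1 dh1 t r); trivial; try lra.
      * intros v Hv. apply H1c. lra.
      * intros v Hv. apply Hn1. rewrite Rabs_left1; lra.
    + rewrite (Hpd u) by (lra || rewrite Rabs_pos_eq; lra).
      apply (C1_piece_integral h2 dh2 t r); trivial; try lra.
      * intros v Hv. apply H2c. lra.
      * intros v Hv. apply Hn2. rewrite Rabs_pos_eq; lra.
Qed.

End ContourIntegral.

(** * Potentials of F over the parameter rectangle of the deformation *)

Definition strip_continuous (H : R -> R -> C) : Prop :=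
  forall s t e, 0 <= s <= 1 -> 0 < e -> exists d, 0 < d /\
    forall s' t', 0 <= s' <= 1 -> Rabs (s' - s) < d -> Rabs (t' - t) < d ->
      Cmod (H s' t' - H s t) < e.

Section Homotopy.
Variables (F F' : C -> C) (Om : C -> Prop) (H : R -> R -> C) (sigma t1 t2 : R).
Hypothesis Hopen : copen Om.
Hypothesis Hhol : holomorphic F F' Om.
Hypothesis Hcont : strip_continuous H.
Hypothesis Hsigma : 0 < sigma <= 1.
Hypothesis HOm : forall s t, sigma <= s <= 1 -> t1 <= t <= t2 -> Om (H s t).

(** A primitive of the pullback of F dz by [H], in a form that makes sense for a merely continuous
    [H]. Quantifying over all local primitives lets each later argument use its own [Phi]. *)
Definition potential_along (P : R -> R -> C) : Prop :=
  forall s0 t0 r Phi, sigma <= s0 <= 1 -> t1 <= t0 <= t2 -> 0 < r ->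
    (forall z, disc (H s0 t0) r z -> Om z) ->
    (forall z, disc (H s0 t0) r z -> cderiv Phi z (F z)) ->
    exists d, 0 < d /\ forall s t, sigma <= s <= 1 -> t1 <= t <= t2 ->
      Rabs (s - s0) < d -> Rabs (t - t0) < d ->
      (P s t - P s0 t0 = Phi (H s t) - Phi (H s0 t0))%C.

(** The segment integral between the images of two parameters is a cocycle at the scale of a
    Lebesgue number, because three close parameters have their images in one disc contained in
    [Om]. *)
Lemma potential_along_exists : exists P, potential_along P.
Proof.
  set (X := fun p : R * R => sigma <= fst p <= 1 /\ t1 <= snd p <= t2).
  destruct (lebesgue_number_2d sigma 1 t1 t2 (fun s t d =>
    exists r, (forall z, disc (H s t) r z -> Om z) /\
      forall s' t', 0 <= s' <= 1 -> Rabs (s' - s) < 2 * d -> Rabs (t' - t) < 2 * d ->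
        disc (H s t) r (H s' t'))) as [lam [Hlam Hleb]].
  { intros s t Hs Ht. destruct (Hopen _ (HOm s t Hs Ht)) as [r [Hr Hrw]].
    destruct (Hcont s t r) as [d [Hd Hw]]; [lra|easy|].
    exists (d / 2). split; [lra|]. exists r. split; [exact Hrw|].
    intros s' t' Hs' K1 K2. apply Hw; lra. }
  (* The last 1 makes the bound on the size of the rectangle strict, as [near] demands. *)
  destruct (additive_potential X lam (1 + Rabs (t2 - t1) + 1)
    (fun p q => seg_integral F (H (fst p) (snd p)) (H (fst q) (snd q)))) as [P HP].
  - easy.
  - intros p q [Hp1 Hp2] [Hq1 Hq2]. unfold X, midpoint; simpl. lra.
  - intros p q [Hp1 Hp2] [Hq1 Hq2]. pose proof (Rle_abs (t2 - t1)). unfold near. lra.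
  - intros p q r [Hp1 Hp2] [Hq1 Hq2] [Hr1 Hr2] Hpq Hqr Hpr.
    destruct (Hleb (fst p) (snd p) Hp1 Hp2)
      as [s [t [d [Hs [Ht [[rho [HO HD]] [K1 [K2 K3]]]]]]]].
    apply Rabs_def2 in K1. apply Rabs_def2 in K2. unfold near in *.
    apply (seg_integral_additive F F' (H s t) rho).
    + intros z Hz. now apply Hhol, HO.
    + apply HD; [lra| |]; apply Rabs_def1; lra.
    + apply HD; [lra| |]; apply Rabs_def1; lra.
    + apply HD; [lra| |]; apply Rabs_def1; lra.
  - exists (fun s t => P (s, t)). intros s0 t0 r Phi Hs0 Ht0 Hr HrOm HPhi.
    destruct (Hcont s0 t0 r) as [d [Hd Hw]]; [lra|easy|].
    exists (Rmin d lam). split; [now apply Rmin_pos|]. intros s t Hs Ht K1 K2.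
    pose proof (Rmin_l d lam). pose proof (Rmin_r d lam).
    rewrite <- (HP (s0, t0) (s, t)).
    + apply (seg_integral_primitive F F' Phi (H s0 t0) r).
      * intros z Hz. now apply Hhol, HrOm.
      * exact HPhi.
      * unfold disc; simpl. now rewrite Cmod_refl.
      * apply Hw; simpl; lra.
    + now split.
    + now split.
    + apply Rabs_def2 in K1. apply Rabs_def2 in K2. unfold near; simpl. lra.
Qed.

Lemma local_primitive (z0 : C) : Om z0 -> exists Phi r, 0 < r /\
  (forall z, disc z0 r z -> Om z) /\ (forall z, disc z0 r z -> cderiv Phi z (F z)).
Proof.
  intros Hz0. destruct (Hopen z0 Hz0) as [r [Hr Hrw]].
  exists (seg_integral F z0), r. split; [easy|]. split; [exact Hrw|].
  assert (Hc : disc z0 r z0) by (unfold disc; now rewrite Cmod_refl).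
  intros z Hz. apply (star_primitive F F' (disc z0 r)); trivial.
  - apply disc_open.
  - now apply disc_convex.
  - intros w Hw. now apply Hhol, Hrw.
Qed.

Lemma potential_end (P : R -> R -> C) (g : R -> C) :
  potential_along P -> t1 <= t2 -> piecewise_C1 g -> (forall t, H 1 t = g t) ->
  is_RInt (V := C_R_NormedModule) (fun t => F (g t) * velocity g t)%C t1 t2
    (P 1 t2 - P 1 t1)%C.
Proof.
  intros HP H12 Hg HH1. apply (contour_integral_primitive F g (P 1) t1 t2); trivial.
  intros t0 Ht0.
  destruct (local_primitive (H 1 t0)) as [Phi [r [Hr [HO HPhi]]]]; [apply HOm; lra|].
  exists Phi, r. split; [easy|]. rewrite <- HH1. split.
  - intros z Hz. split; [now apply HPhi|].
    eapply cderiv_ccont. now apply Hhol, HO.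
  - destruct (HP 1 t0 r Phi) as [d [Hd Hw]]; trivial; [lra|].
    exists d. split; [easy|]. intros t Ht Htd. rewrite <- HH1. apply Hw; trivial; [lra|].
    now rewrite Rminus_diag, Rabs_R0.
Qed.

(** At fixed [t] the potential grows in s at a rate of at most |F| times the Lipschitz constant
    [K * Cmod (H s t)], that is at most [B], over a parameter length [1 - sigma <= 1]. *)
Lemma potential_side (P : R -> R -> C) (t K B : R) :
  potential_along P -> t1 <= t <= t2 -> 0 <= K ->
  (forall s s', sigma <= s <= 1 -> sigma <= s' <= 1 ->
     Cmod (H s t - H s' t) <= K * Rabs (s - s') * Cmod (H s t)) ->
  (forall s, sigma <= s <= 1 -> Cmod (F (H s t)) * (K * Cmod (H s t)) <= B) ->
  Cmod (P 1 t - P sigma t) <= B.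
Proof.
  intros HP Ht HK Hlip HB.
  assert (HB0 : 0 <= B).
  { eapply Rle_trans; [|apply (HB 1); lra].
    apply Rmult_le_pos; [apply Cmod_ge_0|apply Rmult_le_pos; [easy|apply Cmod_ge_0]]. }
  apply Rle_trans with (B * (1 - sigma)); [|nra].
  apply (increment_le_lipschitz (fun s => P s t)); [lra|]. intros s e Hs He.
  destruct (local_primitive (H s t)) as [Phi [r [Hr [HO HPhi]]]]; [now apply HOm|].
  destruct (HP s t r Phi) as [d1 [Hd1 H1]]; trivial.
  set (N := K * Cmod (H s t)).
  assert (HN : 0 <= N) by (apply Rmult_le_pos; [easy|apply Cmod_ge_0]).
  destruct (HPhi (H s t)) with (e := e / (N + 1)) as [d2 [Hd2 H2]].
  { unfold disc. now rewrite Cmod_refl. }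
  { apply Rdiv_lt_0_compat; lra. }
  destruct (Hcont s t d2) as [d3 [Hd3 H3]]; [lra|easy|].
  exists (Rmin d1 d3 / 2). assert (Hm : 0 < Rmin d1 d3) by now apply Rmin_pos.
  pose proof (Rmin_l d1 d3). pose proof (Rmin_r d1 d3).
  split; [lra|]. intros u Hu Hud.
  rewrite (H1 u t) by (trivial; try lra; rewrite Rminus_diag, Rabs_R0; lra).
  assert (Hlu : Cmod (H u t - H s t) <= N * Rabs (u - s)).
  { rewrite Cmod_minus_sym. eapply Rle_trans; [now apply Hlip|].
    rewrite <- Rabs_Ropp, Ropp_minus_distr. unfold N. right. ring. }
  specialize (H2 (H u t) ltac:(apply H3; try lra; rewrite Rminus_diag, Rabs_R0; lra)).
  replace (Phi (H u t) - Phi (H s t))%C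
    with ((Phi (H u t) - Phi (H s t) - F (H s t) * (H u t - H s t))
          + F (H s t) * (H u t - H s t))%C by ring.
  eapply Rle_trans; [apply Cmod_triangle|]. rewrite (Cmod_mult (F (H s t))).
  specialize (HB s Hs). fold N in HB.
  pose proof (Cmod_ge_0 (F (H s t))). pose proof (Rabs_pos (u - s)).
  pose proof (Cmod_ge_0 (H u t - H s t)).
  assert (A1 : Cmod (F (H s t)) * Cmod (H u t - H s t) <= B * Rabs (u - s)).
  { apply Rle_trans with (Cmod (F (H s t)) * (N * Rabs (u - s))).
    - now apply Rmult_le_compat_l.
    - rewrite <- Rmult_assoc. now apply Rmult_le_compat_r. }
  assert (A2 : e / (N + 1) * Cmod (H u t - H s t) <= e * Rabs (u - s)).
  { apply Rle_trans with (e / (N + 1) * (N * Rabs (u - s))).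
    - apply Rmult_le_compat_l; [|easy]. left. apply Rdiv_lt_0_compat; lra.
    - rewrite <- Rmult_assoc. apply Rmult_le_compat_r; [easy|].
      apply (Rmult_le_reg_r (N + 1)); [lra|].
      replace (e / (N + 1) * N * (N + 1)) with (e * N) by (field; lra). nra. }
  lra.
Qed.

(** [Phi] is one primitive valid along the whole edge s = sigma, so its local comparisons with [P]
    add up from [t1] to [t2]. *)
Lemma potential_start (P : R -> R -> C) (Om1 : C -> Prop) (Phi : C -> C) :
  potential_along P -> t1 <= t2 ->
  copen Om1 -> (forall z, Om1 z -> Om z) ->
  (forall z, Om1 z -> cderiv Phi z (F z)) ->
  (forall t, t1 <= t <= t2 -> Om1 (H sigma t)) ->
  (P sigma t2 - P sigma t1 = Phi (H sigma t2) - Phi (H sigma t1))%C.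
Proof.
  intros HP H12 Hopen1 Hsub HPhi HOm1.
  apply (interval_induction (fun u v =>
    P sigma v - P sigma u = Phi (H sigma v) - Phi (H sigma u))%C); [easy| |].
  - intros x y z _ _ _ _ E1 E2.
    replace (P sigma z - P sigma x)%C
      with ((P sigma y - P sigma x) + (P sigma z - P sigma y))%C by ring.
    rewrite E1, E2. ring.
  - intros t Ht. destruct (Hopen1 _ (HOm1 t Ht)) as [r [Hr Hrw]].
    destruct (HP sigma t r Phi) as [d [Hd Hw]]; auto; [lra|].
    exists (d / 2). split; [lra|]. split; intros u Hu Hut.
    + assert (E : (P sigma u - P sigma t = Phi (H sigma u) - Phi (H sigma t))%C).
      { apply Hw; try lra; [rewrite Rminus_diag, Rabs_R0; lra|rewrite Rabs_left1; lra]. }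
      replace (P sigma t - P sigma u)%C with (- (P sigma u - P sigma t))%C by ring.
      rewrite E. ring.
    + apply Hw; try lra; [rewrite Rminus_diag, Rabs_R0; lra|rewrite Rabs_pos_eq; lra].
Qed.

End Homotopy.

(** * Primitives on the two sides of the cut *)

(** The inner map [u] will be the opposite or the identity, so that both branches are treated at
    once. *)
Lemma holomorphic_power (f : C -> C) (D : C -> Prop) (b : R) (u : C -> C) (k : C) :
  (forall z, cderiv u z k) -> analytic_on D f ->
  holomorphic (fun z => Cpower (u z) b * f z)%C
    (fun z => RtoC b * Cpower (u z) (b - 1) * k * f z + Cpower (u z) b * C_derive f z)%C
    (fun z => D z /\ slit_plane (u z)).
Proof.
  intros Hu Hf z [HD Hz].
  assert (Hpow : forall b, cderiv (fun w => Cpower (u w) b) z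
    (RtoC b * Cpower (u z) (b - 1) * k)%C).
  { intros b0. apply (cderiv_comp (fun w => Cpower w b0) u); [|apply Hu].
    now apply Cpower_cderiv. }
  destruct (analytic_at_derive f z (Hf z HD)) as [Ha1 Hd1].
  destruct (analytic_at_derive _ z Ha1) as [_ Hd2].
  split.
  - now apply cderiv_mult.
  - eapply cderiv_ccont. apply cderiv_plus; [|apply cderiv_mult; [apply Hpow|exact Hd2]].
    apply cderiv_mult; [|exact Hd1].
    apply (cderiv_ext_loc (fun w => RtoC b * k * Cpower (u w) (b - 1))%C _ _ _ 1 Rlt_0_1).
    + intros; ring.
    + apply cderiv_scal, Hpow.
Qed.

Lemma slit_plane_opp (z : C) : slit_plane (- z) <-> ~ nonneg_axis z.
Proof.
  unfold slit_plane, nonneg_axis. rewrite re_opp, im_opp. split.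
  - intros [H|H] [H1 H2]; lra.
  - intros H. destruct (Rlt_dec 0 (- Re z)) as [h|h]; [now left|].
    right. intros h2. apply H. lra.
Qed.

Lemma off_axis_open : copen (fun z => ~ nonneg_axis z).
Proof.
  intros z Hz. apply slit_plane_opp in Hz. destruct (slit_plane_open _ Hz) as [r [Hr Hw]].
  exists r. split; [easy|]. intros w Hwz. apply slit_plane_opp, Hw.
  replace (- w - - z)%C with (- (w - z))%C by ring. now rewrite Cmod_opp.
Qed.

Lemma copen_and (A B : C -> Prop) : copen A -> copen B -> copen (fun z => A z /\ B z).
Proof.
  intros HA HB z [Ha Hb]. destruct (HA z Ha) as [r1 [H1 K1]]. destruct (HB z Hb) as [r2 [H2 K2]].
  exists (Rmin r1 r2). split; [now apply Rmin_pos|]. intros w Hw. split.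
  - apply K1. eapply Rlt_le_trans; [exact Hw|apply Rmin_l].
  - apply K2. eapply Rlt_le_trans; [exact Hw|apply Rmin_r].
Qed.

(** The largest subset of [D] starlike about [c]. [D] may have holes, so explicit primitives are
    taken on such kernels. *)
Definition star_kernel (c : C) (D : C -> Prop) (z : C) : Prop :=
  forall t, 0 <= t <= 1 -> D (seg c z t).

Lemma star_kernel_sub (c : C) (D : C -> Prop) (z : C) : star_kernel c D z -> D z.
Proof. intros H. rewrite <- (seg_1 c z). apply H. lra. Qed.

Lemma star_kernel_star (c : C) (D : C -> Prop) : starlike c (star_kernel c D).
Proof.
  intros z t Hz Ht u Hu.
  replace (seg c (seg c z t) u) with (seg c z (u * t))
    by (unfold seg; rewrite RtoC_mult; ring).
  apply Hz. nra.
Qed.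

Lemma star_kernel_open (c : C) (D : C -> Prop) : copen D -> copen (star_kernel c D).
Proof.
  intros HD z Hz. set (L := Cmod (z - c)). assert (HL : 0 <= L) by apply Cmod_ge_0.
  destruct (lebesgue_number_1d 0 1 (fun t d =>
      forall w, Cmod (w - seg c z t) < (L + 1) * d -> D w)) as [d0 [Hd0 Hleb]].
  { intros t Ht. destruct (HD _ (Hz t Ht)) as [r [Hr Hrw]].
    exists (r / (L + 1)). split; [apply Rdiv_lt_0_compat; lra|].
    intros w Hw. apply Hrw. now replace ((L + 1) * (r / (L + 1))) with r in Hw by (field; lra). }
  exists d0. split; [easy|]. intros w Hw t Ht.
  destruct (Hleb t Ht) as [t0 [d [Ht0 [HP [K1 K2]]]]]. apply HP.
  replace (seg c w t - seg c z t0)%C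
    with (RtoC t * (w - z) + (seg c z t - seg c z t0))%C by (unfold seg; ring).
  eapply Rle_lt_trans; [apply Cmod_triangle|].
  rewrite seg_diff, !Cmod_mult, !Cmod_R, (Rabs_pos_eq t) by lra. fold L.
  pose proof (Cmod_ge_0 (w - z)). pose proof (Rabs_pos (t - t0)).
  assert (t * Cmod (w - z) <= 1 * Cmod (w - z)) by (apply Rmult_le_compat_r; lra).
  assert (Rabs (t - t0) * L <= d * L) by (apply Rmult_le_compat_r; lra).
  nra.
Qed.

(** Seen from - c the cut is the far end of a single ray: a segment from - c that meets it runs
    along the real line and ends on it. *)
Lemma off_axis_star (c : R) : 0 < c -> starlike (RtoC (- c)) (fun z => ~ nonneg_axis z).
Proof.
  intros Hc z t Hz Ht [H1 H2]. apply Hz. unfold seg in *.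
  rewrite re_plus, re_scal_l in H1. rewrite im_plus, im_scal_l in H2.
  unfold Cminus in *. rewrite re_plus, re_opp, re_RtoC in H1.
  rewrite im_plus, im_opp, im_RtoC in H2.
  assert (Htp : 0 < t).
  { destruct (Req_dec t 0) as [->|h]; lra. }
  split.
  - apply Rnot_lt_le. intros Hn. nra.
  - apply (Rmult_eq_reg_l t); lra.
Qed.

Lemma starlike_and (c : C) (A B : C -> Prop) :
  starlike c A -> starlike c B -> starlike c (fun z => A z /\ B z).
Proof. intros HA HB z t [Ha Hb] Ht. split; auto. Qed.

Lemma right_half_open : copen (fun z => 0 < Re z).
Proof. intros z Hz. apply (locally_C_eps z). now apply locally_Re_pos. Qed.

Lemma right_half_star (c : C) : 0 < Re c -> starlike c (fun z => 0 < Re z).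
Proof.
  intros Hc z t Hz Ht. unfold seg. rewrite re_plus, re_scal_l. unfold Cminus.
  rewrite re_plus, re_opp.
  destruct (Req_dec t 0) as [->|h]; [lra|]. assert (0 < t * Re z) by nra.
  assert (0 <= (1 - t) * Re c) by nra. lra.
Qed.

Lemma RtoC_axis (x : R) : 0 <= x -> nonneg_axis (RtoC x).
Proof. intros H. split; [exact H|reflexivity]. Qed.

Lemma axis_RtoC (z : C) : nonneg_axis z -> z = RtoC (Re z) /\ Cmod z = Re z.
Proof.
  intros [H1 H2]. assert (E : z = RtoC (Re z)).
  { destruct z as [x y]. simpl in *. subst y. reflexivity. }
  split; [easy|]. rewrite E, Cmod_R. simpl. now rewrite Rabs_pos_eq.
Qed.

Lemma seg_RtoC (a b t : R) : seg (RtoC a) (RtoC b) t = RtoC (a + t * (b - a)).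
Proof. unfold seg. now rewrite RtoC_plus, RtoC_mult, RtoC_minus. Qed.

Lemma half_disc_point (side x r : R) : (side = 1 \/ side = -1) -> 0 < r ->
  exists z, Cmod (z - RtoC x) < r /\ 0 < side * Im z.
Proof.
  intros Hside Hr. exists (RtoC x + RtoC (side * (r / 2)) * Ci)%C. split.
  - replace (x + (side * (r / 2))%R * Ci - x)%C
      with (RtoC (side * (r / 2)) * Ci)%C by ring.
    rewrite Cmod_mult, Cmod_R, Cmod_Ci, Rabs_mult, (Rabs_pos_eq (r / 2)) by lra.
    assert (Rabs side = 1) as -> by (destruct Hside as [->| ->];
      [apply Rabs_R1|rewrite Rabs_left; lra]). lra.
  - rewrite im_plus, im_RtoC, im_scal_l. simpl. destruct Hside as [->| ->]; lra.
Qed.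

Section Primitives.
Variables (f : C -> C) (D : C -> Prop) (b c : R).
Hypothesis HDopen : copen D.
Hypothesis HDaxis : forall z, nonneg_axis z -> D z.
Hypothesis Hf : analytic_on D f.
Hypothesis Hc : 0 < c.
Hypothesis HDc : forall x, - c <= x -> D (RtoC x).

(** [branch_opp] and [branch_pos] are F and F0 of the overview; [prim_opp] and [prim_pos], based at
    - c and at 1, are Phi and Phi0. *)
Definition branch_opp (z : C) : C := (Cpower (- z) b * f z)%C.
Definition branch_pos (z : C) : C := (Cpower z b * f z)%C.

Definition cut_domain (z : C) : Prop := D z /\ ~ nonneg_axis z.
Definition cut_star (z : C) : Prop := star_kernel (RtoC (- c)) D z /\ ~ nonneg_axis z.
Definition right_star (z : C) : Prop := star_kernel 1 D z /\ 0 < Re z.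

Definition prim_opp : C -> C := seg_integral branch_opp (RtoC (- c)).
Definition prim_pos : C -> C := seg_integral branch_pos 1.

Lemma cut_domain_open : copen cut_domain.
Proof. apply copen_and; [easy|apply off_axis_open]. Qed.

Lemma cut_star_open : copen cut_star.
Proof. apply copen_and; [now apply star_kernel_open|apply off_axis_open]. Qed.

Lemma right_star_open : copen right_star.
Proof. apply copen_and; [now apply star_kernel_open|apply right_half_open]. Qed.

Lemma branch_opp_holomorphic : exists F', holomorphic branch_opp F' cut_domain.
Proof.
  eexists. intros z [H1 H2]. apply (holomorphic_power f D b Copp (- (1))%C); trivial.
  - apply cderiv_opp.
  - split; [easy|]. now apply slit_plane_opp.
Qed.

Lemma prim_opp_cderiv (z : C) : cut_star z -> cderiv prim_opp z (branch_opp z).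
Proof.
  destruct branch_opp_holomorphic as [F' HF]. intros Hz.
  apply (star_primitive branch_opp F' cut_star (RtoC (- c))); trivial.
  - apply cut_star_open.
  - apply starlike_and; [apply star_kernel_star|now apply off_axis_star].
  - intros w [H1 H2]. apply HF. split; [|easy]. now apply star_kernel_sub in H1.
Qed.

Lemma prim_pos_cderiv (z : C) : right_star z -> cderiv prim_pos z (branch_pos z).
Proof.
  intros Hz.
  apply (star_primitive branch_pos
    (fun z => RtoC b * Cpower z (b - 1) * 1 * f z + Cpower z b * C_derive f z)%C
    right_star 1); trivial.
  - apply right_star_open.
  - apply starlike_and; [apply star_kernel_star|apply right_half_star; simpl; lra].
  - intros w [H1 H2]. apply (holomorphic_power f D b (fun z => z) 1); trivial.
    + apply cderiv_id.
    + split; [now apply star_kernel_sub in H1|now left].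
Qed.

(** The segment from - c to a point of the axis stays on the real line inside [D], so the open star
    kernel contains a full disc about that point, on both sides of the cut. The origin is
    included. *)
Lemma cut_star_near_axis (x : R) : 0 <= x -> exists r, 0 < r /\
  forall z, Cmod (z - RtoC x) < r -> ~ nonneg_axis z -> cut_star z.
Proof.
  intros Hx.
  destruct (star_kernel_open (RtoC (- c)) D HDopen (RtoC x)) as [r [Hr Hw]].
  { intros t Ht. rewrite seg_RtoC. apply HDc. nra. }
  exists r. split; [easy|]. intros z Hz Hn. split; [now apply Hw|easy].
Qed.

Lemma right_star_axis (x : R) : 0 < x -> right_star (RtoC x).
Proof.
  intros Hx. split; [|exact Hx]. intros t Ht. rewrite seg_RtoC.
  apply HDaxis, RtoC_axis. nra.
Qed.

Lemma prim_pos_cderiv_axis (x : R) : 0 < x ->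
  cderiv prim_pos (RtoC x) (RtoC (Rpower x b) * f (RtoC x))%C.
Proof.
  intros Hx. rewrite <- Cpower_pos by easy. now apply prim_pos_cderiv, right_star_axis.
Qed.

(** [side = 1] and [side = -1] treat the upper and the lower half plane together. *)
Definition germ (side : R) (Theta : C) (x : R) (k : C) : Prop :=
  exists r, 0 < r /\ forall z, Cmod (z - RtoC x) < r -> 0 < side * Im z ->
    prim_opp z = (Theta * prim_pos z + k)%C.

(** On a half disc, which is convex, [prim_opp - Theta * prim_pos] has derivative
    [branch_opp - Theta * branch_pos = 0]. *)
Lemma germ_exists (side : R) (Theta : C) (x : R) :
  (side = 1 \/ side = -1) ->
  (forall z, 0 < side * Im z -> branch_opp z = (Theta * branch_pos z)%C) ->
  0 < x -> exists k, germ side Theta x k.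
Proof.
  intros Hside HTheta Hx.
  destruct (cut_star_near_axis x) as [r1 [Hr1 H1]]; [lra|].
  destruct (right_star_open _ (right_star_axis x Hx)) as [r2 [Hr2 H2]].
  set (r := Rmin r1 r2). assert (Hr : 0 < r) by now apply Rmin_pos.
  assert (Hrr1 : r <= r1) by apply Rmin_l. assert (Hrr2 : r <= r2) by apply Rmin_r.
  destruct (half_disc_point side x r Hside Hr) as [z0 [Hz0 Him0]].
  exists (prim_opp z0 - Theta * prim_pos z0)%C, r. split; [easy|]. intros z Hz Him.
  enough (E : (prim_opp z - Theta * prim_pos z = prim_opp z0 - Theta * prim_pos z0)%C).
  { rewrite <- E. ring. }
  apply (segment_constant (fun w => prim_opp w - Theta * prim_pos w)%C). intros t Ht.
  assert (Hd : disc (RtoC x) r (seg z0 z t)) by now apply disc_convex.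
  assert (Hi : 0 < side * Im (seg z0 z t)).
  { unfold seg. rewrite im_plus, im_scal_l. unfold Cminus. rewrite im_plus, im_opp.
    replace (side * (Im z0 + t * (Im z + - Im z0)))
      with ((1 - t) * (side * Im z0) + t * (side * Im z)) by ring.
    destruct (Req_dec t 0) as [->|h]; [lra|].
    assert (0 < t * (side * Im z)) by (apply Rmult_lt_0_compat; lra).
    assert (0 <= (1 - t) * (side * Im z0)) by (apply Rmult_le_pos; lra). lra. }
  set (w := seg z0 z t) in *. unfold disc in Hd.
  replace (RtoC 0) with (branch_opp w - Theta * branch_pos w)%C
    by (rewrite HTheta by easy; ring).
  apply cderiv_minus.
  - apply prim_opp_cderiv, H1; [lra|]. intros [_ E]. rewrite E in Hi. lra.
  - apply cderiv_scal, prim_pos_cderiv, H2. lra.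
Qed.

Lemma germ_unique (side : R) (Theta : C) (x : R) (k k' : C) :
  (side = 1 \/ side = -1) -> germ side Theta x k -> germ side Theta x k' -> k = k'.
Proof.
  intros Hside [r1 [Hr1 H1]] [r2 [Hr2 H2]].
  set (r := Rmin r1 r2). assert (Hr : 0 < r) by now apply Rmin_pos.
  assert (Hrr1 : r <= r1) by apply Rmin_l. assert (Hrr2 : r <= r2) by apply Rmin_r.
  destruct (half_disc_point side x r Hside Hr) as [z0 [Hz0 Him0]].
  specialize (H1 z0 ltac:(lra) Him0). specialize (H2 z0 ltac:(lra) Him0).
  rewrite H1 in H2.
  replace k with ((Theta * prim_pos z0 + k) - Theta * prim_pos z0)%C by ring.
  rewrite H2. ring.
Qed.

(** Half discs about neighbouring points of the axis overlap, so the constant is locally constant in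
    x; having the same germ constants is an equivalence, which interval induction carries along the
    axis. *)
Lemma germ_constant (side : R) (Theta : C) :
  (side = 1 \/ side = -1) ->
  (forall z, 0 < side * Im z -> branch_opp z = (Theta * branch_pos z)%C) ->
  exists k, forall x, 0 < x -> germ side Theta x k.
Proof.
  intros Hside HTheta.
  assert (Hab : forall u v, 0 < u -> u <= v ->
    forall k, germ side Theta u k <-> germ side Theta v k).
  { intros u v Hu Huv.
    apply (interval_induction (fun u v =>
      forall k, germ side Theta u k <-> germ side Theta v k)); [easy| |].
    - intros x y z _ _ _ _ K1 K2 k. now rewrite K1.
    - intros t Ht. destruct (germ_exists side Theta t Hside HTheta) as [k0 Hk0]; [lra|].
      destruct Hk0 as [r [Hr Hw]].
      assert (Hnear : forall y, Rabs (y - t) < r -> germ side Theta y k0).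
      { intros y Hy. exists (r - Rabs (y - t)). split; [lra|]. intros z Hz.
        apply Hw. eapply Rle_lt_trans; [apply (Cmod_triangle3 z (RtoC y))|].
        rewrite <- RtoC_minus, Cmod_R. lra. }
      assert (Heq : forall y, Rabs (y - t) < r ->
        forall k, germ side Theta y k <-> germ side Theta t k).
      { intros y Hy k. pose proof (Hnear y Hy) as Gy.
        assert (Gt : germ side Theta t k0) by (apply Hnear; now rewrite Rminus_diag, Rabs_R0).
        split; intros G.
        - now rewrite (germ_unique side Theta y k k0).
        - now rewrite (germ_unique side Theta t k k0). }
      exists (r / 2). split; [lra|]. split; intros y Hy Hyt k.
      + apply Heq. rewrite Rabs_left1; lra.
      + symmetry. apply Heq. rewrite Rabs_pos_eq; lra. }
  destruct (germ_exists side Theta 1 Hside HTheta Rlt_0_1) as [k Hk].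
  exists k. intros x Hx. destruct (Rle_dec 1 x) as [h|h].
  - apply (Hab 1 x); trivial. lra.
  - apply (Hab x 1); trivial. lra.
Qed.

End Primitives.

(** * The jump across the cut at the origin *)

Lemma sum_n_C_mult_r (u : nat -> C) (k : C) (m : nat) :
  @eq C (sum_n (G := C_AbelianMonoid) (fun i => u i * k)%C m)
    (sum_n (G := C_AbelianMonoid) u m * k)%C.
Proof.
  induction m as [|m IH]; [now rewrite !sum_O|]. rewrite !sum_n_C_S, IH. ring.
Qed.

Lemma sum_n_C_minus (u v : nat -> C) (m : nat) :
  @eq C (sum_n (G := C_AbelianMonoid) (fun i => u i - v i)%C m)
    (sum_n (G := C_AbelianMonoid) u m - sum_n (G := C_AbelianMonoid) v m)%C.
Proof.
  induction m as [|m IH]; [now rewrite !sum_O|]. rewrite !sum_n_C_S, IH. ring.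
Qed.

Lemma sum_n_C_ext (u v : nat -> C) (m : nat) :
  (forall i, u i = v i) ->
  @eq C (sum_n (G := C_AbelianMonoid) u m) (sum_n (G := C_AbelianMonoid) v m).
Proof. intros H. now apply sum_n_ext. Qed.

Section Jump.
Variables (f : C -> C) (D : C -> Prop) (n : nat) (alpha c : R).
Hypothesis Halpha : 0 < alpha < 1.
Hypothesis HDopen : copen D.
Hypothesis HDaxis : forall z, nonneg_axis z -> D z.
Hypothesis Hf : analytic_on D f.
Hypothesis Hc : 0 < c.
Hypothesis HDc : forall x, - c <= x -> D (RtoC x).

Let b := alpha - 1 - INR n.
Let beta (k : nat) := alpha - INR n + INR k.
Let coeff (k : nat) : C := (C_derive_n f k (RtoC 0) / INR (fact k))%C.

(** The sign comes from differentiating - z, and (-1)^k from z^k = (-1)^k (-z)^k: with this factor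
    (-z)^(beta k) becomes a primitive of the degree k Taylor term times (-z)^b. *)
Definition power_coeff (k : nat) : C := (- (coeff k * RtoC ((-1) ^ k) / RtoC (beta k)))%C.

(** [alpha] is not an integer, so no logarithm occurs among the explicit primitives. *)
Lemma exponent_neq_0 (k : nat) : beta k <> 0.
Proof.
  unfold beta. intros H. destruct (Nat.le_gt_cases n k) as [Hk|Hk].
  - apply le_INR in Hk. lra.
  - apply le_INR in Hk. rewrite S_INR in Hk. lra.
Qed.

Lemma power_term_cderiv (k : nat) (z : C) : ~ nonneg_axis z ->
  cderiv (fun w => power_coeff k * Cpower (- w) (beta k))%C z
    (coeff k * z ^ k * Cpower (- z) b)%C.
Proof.
  intros Hz. apply slit_plane_opp in Hz.
  pose proof (exponent_neq_0 k) as Hb.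
  assert (Hb' : RtoC (beta k) <> 0) by (intros E; now apply RtoC_inj in E).
  replace (coeff k * z ^ k * Cpower (- z) b)%C
    with (power_coeff k * (RtoC (beta k) * Cpower (- z) (beta k - 1) * - (1)))%C.
  - apply cderiv_scal. apply (cderiv_comp (fun w => Cpower w (beta k)) Copp).
    + now apply Cpower_cderiv.
    + apply cderiv_opp.
  - replace (beta k - 1) with (b + INR k) by (unfold b, beta; ring).
    rewrite Cpower_plus_nat by now apply slit_plane_neq_0.
    replace (z ^ k)%C with (RtoC ((-1) ^ k) * (- z) ^ k)%C.
    + unfold power_coeff. field. easy.
    + rewrite RtoC_pow, <- Cpow_mult_l. f_equal.
      replace (RtoC (-1)) with (- (1))%C by (unfold RtoC, Copp; simpl; f_equal; ring). ring.
Qed.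

(** The sum goes one degree beyond that of the finite part: the remaining derivative is then
    O(|z|^alpha), whereas stopping at n - 1 would leave O(|z|^(alpha - 1)), unbounded at 0. *)
Let principal (z : C) : C :=
  sum_n (G := C_AbelianMonoid) (fun k => power_coeff k * Cpower (- z) (beta k))%C n.

(** The value of [principal] just below the cut minus its value just above. *)
Definition principal_jump (e : R) : C :=
  sum_n (G := C_AbelianMonoid) (fun k => power_coeff k
    * (cis (PI * beta k) - cis (- (PI * beta k))) * RtoC (Rpower e (beta k)))%C n.

Lemma remainder_derivative (z : C) : cut_star D c z ->
  cderiv (fun w => prim_opp f b c w - principal w)%C z
    (Cpower (- z) b * (f z - taylor f n z))%C.
Proof.
  intros Hz.
  replace (Cpower (- z) b * (f z - taylor f n z))%C
    with (branch_opp f b z - taylor f n z * Cpower (- z) b)%C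
    by (unfold branch_opp; ring).
  apply cderiv_minus; [now apply (prim_opp_cderiv f D b c)|].
  unfold taylor. rewrite <- sum_n_C_mult_r.
  apply (cderiv_sum_n (fun k w => power_coeff k * Cpower (- w) (beta k))%C
    (fun k w => coeff k * w ^ k * Cpower (- w) b)%C).
  intros k _. apply power_term_cderiv, Hz.
Qed.

Lemma remainder_derivative_bound : exists K r, 0 <= K /\ 0 < r /\
  forall z, Cmod z < r -> ~ nonneg_axis z -> cut_star D c z /\
    Cmod (Cpower (- z) b * (f z - taylor f n z)) <= K.
Proof.
  destruct (cut_star_near_axis D c HDopen Hc HDc 0 (Rle_refl 0)) as [r1 [Hr1 H1]].
  destruct (HDopen (RtoC 0)) as [r2 [Hr2 H2]]; [apply HDaxis, RtoC_axis, Rle_refl|].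
  assert (Hz0 : forall z : C, (z - 0)%C = z) by (intros; ring).
  destruct (taylor_bound n f r2 Hr2) as [K [r3 [HK [Hr3 H3]]]].
  { intros z Hz. apply Hf, H2. now rewrite Hz0. }
  (* The radius is kept below 1 so that |z|^alpha <= 1, where alpha = b + (n + 1). *)
  exists K, (Rmin (Rmin r1 r3) 1). split; [easy|]. split.
  { apply Rmin_pos; [apply Rmin_pos; easy|lra]. }
  intros z Hz Hn.
  pose proof (Rmin_l (Rmin r1 r3) 1). pose proof (Rmin_r (Rmin r1 r3) 1).
  pose proof (Rmin_l r1 r3). pose proof (Rmin_r r1 r3).
  split; [apply H1; [rewrite Hz0; lra|easy]|].
  assert (Hzp : 0 < Cmod z).
  { apply Cmod_gt_0. intros ->. apply Hn, RtoC_axis, Rle_refl. }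
  rewrite Cmod_mult, Cmod_Cpower, Cmod_opp. specialize (H3 z ltac:(lra)).
  rewrite <- Rpower_pow in H3 by easy.
  assert (Hp : 0 < Rpower (Cmod z) b) by apply exp_pos.
  apply Rle_trans with (Rpower (Cmod z) b * (K * Rpower (Cmod z) (INR (S n)))).
  { apply Rmult_le_compat_l; lra. }
  replace (Rpower (Cmod z) b * (K * Rpower (Cmod z) (INR (S n))))
    with (K * Rpower (Cmod z) alpha).
  2:{ replace alpha with (b + INR (S n)) by (unfold b; rewrite S_INR; ring).
      rewrite Rpower_plus. ring. }
  assert (Rpower (Cmod z) alpha <= 1).
  { rewrite <- (Rpower_1 1) by lra. unfold Rpower. rewrite ln_1, Rmult_0_r.
    destruct (Req_dec (Cmod z) 1) as [E|E]; [rewrite E, ln_1, Rmult_0_r; lra|].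
    left. apply exp_increasing.
    assert (ln (Cmod z) < 0) by (rewrite <- ln_1; apply ln_increasing; lra). nra. }
  rewrite <- (Rmult_1_r K) at 2. now apply Rmult_le_compat_l.
Qed.

Variables (kp km : C).
Hypothesis Hkp : forall x, 0 < x -> germ f b c 1 (cis (- (PI * b))) x kp.
Hypothesis Hkm : forall x, 0 < x -> germ f b c (-1) (cis (PI * b)) x km.

(** [prim_opp - principal] breaks at the cut. [upper] and [lower] continue its restrictions to the
    two sides across the positive axis, which gives meaning to its boundary values there. *)
Let upper (z : C) : C := (cis (- (PI * b)) * prim_pos f b z + kp
  - sum_n (G := C_AbelianMonoid) (fun k => power_coeff k * cis (- (PI * beta k))
      * Cpower z (beta k)) n)%C.
Let lower (z : C) : C := (cis (PI * b) * prim_pos f b z + km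
  - sum_n (G := C_AbelianMonoid) (fun k => power_coeff k * cis (PI * beta k)
      * Cpower z (beta k)) n)%C.

Lemma boundary_ccont (Theta k : C) (phase : nat -> C) (x : R) : 0 < x ->
  ccont (fun z => Theta * prim_pos f b z + k
    - sum_n (G := C_AbelianMonoid) (fun k => power_coeff k * phase k
      * Cpower z (beta k)) n)%C (RtoC x).
Proof.
  intros Hx. eapply cderiv_ccont. apply cderiv_minus.
  - apply cderiv_plus; [|apply cderiv_const]. apply cderiv_scal.
    apply (prim_pos_cderiv f D b); trivial. now apply right_star_axis.
  - apply (cderiv_sum_n (fun k z => power_coeff k * phase k * Cpower z (beta k))%C
      (fun k z => power_coeff k * phase k * (RtoC (beta k) * Cpower z (beta k - 1)))%C).
    intros i _. apply cderiv_scal, Cpower_cderiv. left. exact Hx.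
Qed.

(** Go from the upper to the lower edge of the cut at [e] around the origin, through - e: the
    derivative of [prim_opp - principal] is bounded by [K] and the path has length O(e). *)
Lemma jump_bound : exists K e0, 0 <= K /\ 0 < e0 /\ forall e, 0 < e < e0 ->
  Cmod ((cis (PI * b) * prim_pos f b (RtoC e) + km)
        - (cis (- (PI * b)) * prim_pos f b (RtoC e) + kp) - principal_jump e) <= K * e.
Proof.
  destruct remainder_derivative_bound as [K [r [HK [Hr HB]]]].
  (* Two straight legs of length at most [3 * e] each; their points have modulus below
     [2 * e < r]. *)
  exists (6 * K), (r / 2). split; [lra|]. split; [lra|]. intros e He.
  replace ((cis (PI * b) * prim_pos f b (RtoC e) + km)
        - (cis (- (PI * b)) * prim_pos f b (RtoC e) + kp) - principal_jump e)%C
    with (lower (RtoC e) - upper (RtoC e))%C.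
  2:{ unfold lower, upper, principal_jump.
      rewrite (sum_n_C_ext (fun k => power_coeff k * (cis (PI * beta k)
          - cis (- (PI * beta k))) * RtoC (Rpower e (beta k)))%C
        (fun k => power_coeff k * cis (PI * beta k) * Cpower (RtoC e) (beta k)
          - power_coeff k * cis (- (PI * beta k)) * Cpower (RtoC e) (beta k))%C).
      - rewrite sum_n_C_minus. ring.
      - intros k. rewrite Cpower_pos by lra. ring. }
  (* [upper] and [lower] describe [prim_opp - principal] only off the axis, so the path joins e + i
     eta to e - i eta; [e1] pays for letting these stand for [e]. *)
  apply Rle_plus_epsilon. intros e1 He1.
  destruct (boundary_ccont (cis (- (PI * b))) kp (fun k => cis (- (PI * beta k))) e
    ltac:(lra) (e1 / 2) ltac:(lra)) as [d1 [Hd1 H1]].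
  destruct (boundary_ccont (cis (PI * b)) km (fun k => cis (PI * beta k)) e
    ltac:(lra) (e1 / 2) ltac:(lra)) as [d2 [Hd2 H2]].
  destruct (Hkp e) as [d3 [Hd3 H3]]; [lra|].
  destruct (Hkm e) as [d4 [Hd4 H4]]; [lra|].
  set (eta := Rmin (Rmin (Rmin d1 d2) (Rmin d3 d4)) e / 2).
  pose proof (Rmin_l (Rmin (Rmin d1 d2) (Rmin d3 d4)) e).
  pose proof (Rmin_r (Rmin (Rmin d1 d2) (Rmin d3 d4)) e).
  pose proof (Rmin_l (Rmin d1 d2) (Rmin d3 d4)). pose proof (Rmin_r (Rmin d1 d2) (Rmin d3 d4)).
  pose proof (Rmin_l d1 d2). pose proof (Rmin_r d1 d2).
  pose proof (Rmin_l d3 d4). pose proof (Rmin_r d3 d4).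
  assert (Heta : 0 < eta).
  { assert (0 < Rmin (Rmin (Rmin d1 d2) (Rmin d3 d4)) e); [|unfold eta; lra].
    apply Rmin_pos; [apply Rmin_pos; apply Rmin_pos; easy|lra]. }
  assert (Hsmall : eta < d1 /\ eta < d2 /\ eta < d3 /\ eta < d4 /\ eta < e).
  { unfold eta in *. lra. }
  clearbody eta.
  set (zp := (e, eta) : C). set (zm := (e, - eta) : C).
  assert (Dp : Cmod (zp - RtoC e) = eta).
  { replace (zp - RtoC e)%C with (RtoC eta * Ci)%C.
    - rewrite Cmod_mult, Cmod_R, Cmod_Ci, Rabs_pos_eq; lra.
    - unfold zp, RtoC, Ci, Cminus, Cmult, Cplus, Copp; simpl. f_equal; ring. }
  assert (Dm : Cmod (zm - RtoC e) = eta).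
  { replace (zm - RtoC e)%C with (- (RtoC eta * Ci))%C.
    - rewrite Cmod_opp, Cmod_mult, Cmod_R, Cmod_Ci, Rabs_pos_eq; lra.
    - unfold zm, RtoC, Ci, Cminus, Cmult, Cplus, Copp; simpl. f_equal; ring. }
  assert (Ep : (prim_opp f b c zp - principal zp = upper zp)%C).
  { rewrite (H3 zp) by (simpl; lra). unfold upper, principal. f_equal.
    apply sum_n_C_ext. intros k. rewrite Cpower_opp_upper by (simpl; lra). ring. }
  assert (Em : (prim_opp f b c zm - principal zm = lower zm)%C).
  { rewrite (H4 zm) by (simpl; lra). unfold lower, principal. f_equal.
    apply sum_n_C_ext. intros k. rewrite Cpower_opp_lower by (simpl; lra). ring. }
  (* On a leg from (e, y) to - e the imaginary part (1 - t) y vanishes only at the end, where the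
     real part is negative: the cut is avoided. *)
  assert (Hleg : forall y, Rabs y = eta ->
     Cmod ((prim_opp f b c (RtoC (- e)) - principal (RtoC (- e)))
           - (prim_opp f b c (e, y) - principal (e, y))) <= K * (3 * e)).
  { intros y Hy.
    assert (Hlen : Cmod (RtoC (- e) - (e, y)) <= 3 * e).
    { eapply Rle_trans; [apply Cmod_le_sum|]. simpl.
      rewrite Rplus_0_l, Rabs_Ropp, Hy, Rabs_left by lra. lra. }
    assert (Hseg : forall t, 0 <= t <= 1 ->
      Cmod (seg (e, y) (RtoC (- e)) t) < r /\ ~ nonneg_axis (seg (e, y) (RtoC (- e)) t)).
    { intros t Ht.
      assert (ERe : Re (seg (e, y) (RtoC (- e)) t) = (1 - 2 * t) * e)
        by (unfold seg; simpl; ring).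
      assert (EIm : Im (seg (e, y) (RtoC (- e)) t) = (1 - t) * y)
        by (unfold seg; simpl; ring).
      split.
      - eapply Rle_lt_trans; [apply Cmod_le_sum|]. rewrite ERe, EIm, !Rabs_mult, Hy.
        rewrite (Rabs_pos_eq e), (Rabs_pos_eq (1 - t)) by lra.
        assert (Rabs (1 - 2 * t) <= 1) by (apply Rabs_le; lra). nra.
      - intros [K1 K2]. rewrite ERe in K1. rewrite EIm in K2.
        apply Rmult_integral in K2. destruct K2 as [K2|K2].
        + replace t with 1 in K1 by lra. lra.
        + rewrite K2, Rabs_R0 in Hy. lra. }
    pose proof (segment_mvt (fun w => prim_opp f b c w - principal w)%C
      (fun w => Cpower (- w) b * (f w - taylor f n w))%C 0 (e, y) (RtoC (- e)) K) as M.
    cbv beta in M.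
    replace (prim_opp f b c (- e)%R - principal (- e)%R
      - (prim_opp f b c (e, y) - principal (e, y)) - 0 * ((- e)%R - (e, y)))%C
      with ((prim_opp f b c (RtoC (- e)) - principal (RtoC (- e)))
           - (prim_opp f b c (e, y) - principal (e, y)))%C in M by ring.
    eapply Rle_trans; [apply M|].
    - intros t Ht. destruct (Hseg t Ht) as [K1 K2].
      apply remainder_derivative. now apply HB.
    - intros t Ht. destruct (Hseg t Ht) as [K1 K2].
      destruct (HB _ K1 K2) as [_ K3]. eapply Rle_trans; [|exact K3].
      right. f_equal. ring.
    - now apply Rmult_le_compat_l. }
  pose proof (Hleg eta ltac:(apply Rabs_pos_eq; lra)) as Lp.
  pose proof (Hleg (- eta) ltac:(rewrite Rabs_Ropp; apply Rabs_pos_eq; lra)) as Lm.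
  change (e, eta) with zp in Lp. change (e, - eta) with zm in Lm.
  rewrite Ep in Lp. rewrite Em in Lm.
  specialize (H1 zp ltac:(rewrite Dp; lra)). specialize (H2 zm ltac:(rewrite Dm; lra)).
  fold (upper zp) (upper (RtoC e)) in H1. fold (lower zm) (lower (RtoC e)) in H2.
  set (x := (prim_opp f b c (RtoC (- e)) - principal (RtoC (- e)))%C) in *.
  pose proof (Cmod_triangle3 (lower (RtoC e)) (lower zm) (upper (RtoC e))).
  pose proof (Cmod_triangle3 (lower zm) x (upper (RtoC e))).
  pose proof (Cmod_triangle3 x (upper zp) (upper (RtoC e))).
  rewrite (Cmod_minus_sym (lower zm) (lower (RtoC e))) in H2.
  rewrite (Cmod_minus_sym x (lower zm)) in Lm. lra.
Qed.

End Jump.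

(** * Convergence of the contour integral *)

Lemma open_copen (D : C -> Prop) : open D -> copen D.
Proof. intros HD z Hz. apply (locally_C_eps z). now apply HD. Qed.

Lemma deformation_strip_continuous (H : R -> R -> C) :
  (forall s t, 0 <= s <= 1 ->
     filterlim (fun p : R * R => H (fst p) (snd p))
       (within (fun p : R * R => 0 <= fst p <= 1) (locally (s, t)))
       (locally (H s t))) -> strip_continuous H.
Proof.
  intros Hlim s t e Hs He.
  destruct (Hlim s t Hs (fun y => Cmod (y - H s t) < e)) as [d Hd].
  { apply locally_C_eps. now exists e. }
  exists d. split; [apply cond_pos|]. intros s' t' Hs' K1 K2.
  apply (Hd (s', t')); [|exact Hs']. split; [exact K1|exact K2].
Qed.

Lemma path_first_order (h : R -> C) (t e : R) (v : C) :
  is_derive (V := C_R_NormedModule) h t v -> 0 < e ->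
  exists d, 0 < d /\ forall u, Rabs (u - t) < d ->
    Cmod (h u - h t - RtoC (u - t) * v) <= e * Rabs (u - t).
Proof.
  intros [_ Hh] He. specialize (Hh t (fun P HP => HP) (mkposreal e He)).
  apply locally_R_eps in Hh. destruct Hh as [d [Hd Hw]]. exists d. split; [easy|].
  intros u Hu. specialize (Hw u Hu). rewrite norm_C_R in Hw.
  change (minus (minus (h u) (h t)) (scal (minus u t) v))
    with (minus (minus (h u) (h t)) (@scal _ C_R_ModuleSpace (minus u t) v)) in Hw.
  rewrite scal_R_Cmult in Hw. exact Hw.
Qed.

Lemma increment_le_derive (P p : R -> C) (m dm : R -> R) (a b : R) :
  a <= b ->
  (forall t, a <= t <= b -> is_derive (V := C_R_NormedModule) P t (p t)) ->
  (forall t, a <= t <= b -> is_derive m t (dm t)) ->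
  (forall t, a <= t <= b -> Cmod (p t) <= dm t) ->
  Cmod (P b - P a) <= m b - m a.
Proof.
  intros Hab HP Hm Hle. apply increment_le; [easy|]. intros t e Ht He.
  destruct (path_first_order P t (e / 2) (p t) (HP t Ht)) as [d1 [Hd1 H1]]; [lra|].
  destruct (real_first_order m t (e / 2) (dm t) (Hm t Ht)) as [d2 [Hd2 H2]]; [lra|].
  specialize (Hle t Ht).
  pose proof (Rmin_l d1 d2). pose proof (Rmin_r d1 d2).
  assert (0 < Rmin d1 d2) by now apply Rmin_pos.
  assert (Hkey : forall u, Rabs (u - t) < Rmin d1 d2 ->
    Cmod (P u - P t) <= (dm t + e / 2) * Rabs (u - t)).
  { intros u Hu. specialize (H1 u ltac:(lra)).
    replace (P u - P t)%C with ((P u - P t - RtoC (u - t) * p t) + RtoC (u - t) * p t)%C by ring.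
    eapply Rle_trans; [apply Cmod_triangle|]. rewrite (Cmod_mult _ (p t)), Cmod_R.
    pose proof (Rabs_pos (u - t)).
    assert (Rabs (u - t) * Cmod (p t) <= Rabs (u - t) * dm t) by now apply Rmult_le_compat_l.
    lra. }
  exists (Rmin d1 d2 / 2). split; [lra|]. intros u v Hu Hv K1 K2 K3 [->| ->].
  - assert (E : Rabs (v - t) = v - t) by (apply Rabs_pos_eq; lra).
    specialize (Hkey v). specialize (H2 v). rewrite E in *.
    specialize (Hkey ltac:(lra)). specialize (H2 ltac:(lra)).
    apply Rabs_le_between in H2. lra.
  - assert (E : Rabs (u - t) = - (u - t)) by (apply Rabs_left1; lra).
    specialize (Hkey u). specialize (H2 u). rewrite E in *.
    specialize (Hkey ltac:(lra)). specialize (H2 ltac:(lra)).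
    apply Rabs_le_between in H2. rewrite Cmod_minus_sym. lra.
Qed.

Lemma Rpower_neg_small (a d : R) : 0 < a -> 0 < d ->
  exists A, 0 < A /\ forall x, A <= x -> Rpower x (- a) <= d.
Proof.
  intros Ha Hd. exists (Rpower d (- / a)). split; [apply exp_pos|]. intros x Hx.
  assert (HA : 0 < Rpower d (- / a)) by apply exp_pos.
  rewrite Rpower_Ropp.
  assert (H : Rpower (Rpower d (- / a)) a <= Rpower x a) by (apply Rle_Rpower_l; lra).
  rewrite Rpower_mult in H. replace (- / a * a) with (- (1)) in H by (field; lra).
  rewrite Rpower_Ropp, Rpower_1 in H by easy.
  rewrite <- (Rinv_inv d). apply Rinv_le_contravar; [now apply Rinv_0_lt_compat|easy].
Qed.

Lemma Rpower_small (a d : R) : 0 < a -> 0 < d ->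
  exists e0, 0 < e0 /\ forall x, 0 < x < e0 -> Rpower x a <= d.
Proof.
  intros Ha Hd. exists (Rpower d (/ a)). split; [apply exp_pos|]. intros x Hx.
  apply Rle_trans with (Rpower (Rpower d (/ a)) a).
  - apply Rle_Rpower_l; lra.
  - rewrite Rpower_mult, Rinv_l, Rpower_1; lra.
Qed.

(** The increments of [Q] are dominated by those of - (M / a) x^(-a), which tends to 0, so [Q] is
    Cauchy at infinity. *)
Lemma limit_of_power_decay (Q q : R -> C) (M A0 a : R) :
  0 < a -> 0 < A0 -> 0 <= M ->
  (forall x, 0 < x -> is_derive (V := C_R_NormedModule) Q x (q x)) ->
  (forall x, A0 <= x -> Cmod (q x) <= M * Rpower x (- a - 1)) ->
  exists L, forall e, 0 < e -> exists A, forall x, A <= x -> Cmod (Q x - L) <= e.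
Proof.
  intros Ha HA0 HM HQ Hq.
  assert (Hinc : forall x y, A0 <= x <= y -> Cmod (Q y - Q x) <= M / a * Rpower x (- a)).
  { intros x y Hxy.
    assert (Hm : forall t, x <= t <= y ->
      is_derive (fun t => - (M / a) * Rpower t (- a)) t (M * Rpower t (- a - 1))).
    { intros t Ht. replace (M * Rpower t (- a - 1))
        with (- (M / a) * (- a * Rpower t (- a - 1))) by (field; lra).
      apply (is_derive_scal (fun t => Rpower t (- a))).
      apply is_derive_Reals, derivable_pt_lim_power. lra. }
    pose proof (increment_le_derive Q q _ _ x y ltac:(lra)
      (fun t Ht => HQ t ltac:(lra)) Hm (fun t Ht => Hq t ltac:(lra))) as H.
    assert (0 <= M / a * Rpower y (- a)).
    { apply Rmult_le_pos; [|left; apply exp_pos].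
      apply Rmult_le_pos; [easy|]. left. now apply Rinv_0_lt_compat. }
    lra. }
  assert (Hsmall : forall e, 0 < e -> exists A, A0 <= A /\
    forall x y, A <= x -> A <= y -> Cmod (Q y - Q x) <= e).
  { intros e He. assert (Hd : 0 < e / (M / a + 1)).
    { apply Rdiv_lt_0_compat; [easy|].
      assert (0 <= M / a); [|lra]. apply Rmult_le_pos; [easy|].
      left. now apply Rinv_0_lt_compat. }
    assert (HMa : 0 <= M / a).
    { apply Rmult_le_pos; [easy|]. left. now apply Rinv_0_lt_compat. }
    destruct (Rpower_neg_small a (e / (M / a + 1)) Ha Hd) as [A1 [HA1 HA]].
    exists (Rmax A0 A1). split; [apply Rmax_l|].
    pose proof (Rmax_l A0 A1). pose proof (Rmax_r A0 A1).
    assert (Hb : forall x y, Rmax A0 A1 <= x -> x <= y -> Cmod (Q y - Q x) <= e).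
    { intros x y Hx Hxy. eapply Rle_trans; [apply Hinc; lra|].
      specialize (HA x ltac:(lra)).
      apply Rle_trans with ((M / a + 1) * (e / (M / a + 1))).
      - apply Rmult_le_compat; try lra. left. apply exp_pos.
      - right. field. split; lra. }
    intros x y Hx Hy. destruct (Rle_dec x y); [now apply Hb|].
    rewrite Cmod_minus_sym. apply Hb; lra. }
  assert (Hex : exists L : C, filterlim Q (Rbar_locally p_infty) (locally (T := C_UniformSpace) L)).
  { apply (filterlim_locally_cauchy (U := C_R_CompleteNormedModule)). intros e.
    destruct (Hsmall (e / 2)) as [A [_ HA]]; [pose proof (cond_pos e); lra|].
    exists (fun x => A < x). split; [now exists A|]. intros u v Hu Hv.
    apply C_NormedModule_mixin_compat1. specialize (HA u v ltac:(lra) ltac:(lra)).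
    pose proof (cond_pos e). change (Cmod (Q v - Q u) < e). lra. }
  destruct Hex as [L HL]. exists L. intros e He.
  destruct (HL (fun y => Cmod (y - L) < e)) as [A HA].
  { apply locally_C_eps. now exists e. }
  exists (A + 1). intros x Hx. left. apply HA. lra.
Qed.

Section Assembly.
Variables (f : C -> C) (D : C -> Prop) (H : R -> R -> C) (g : R -> C) (b c eps : R).
Hypothesis HDopen : copen D.
Hypothesis HDaxis : forall z, nonneg_axis z -> D z.
Hypothesis Hf : analytic_on D f.
Hypothesis Hc : 0 < c.
Hypothesis HDc : forall x, - c <= x -> D (RtoC x).
Hypothesis Heps : 0 < eps.
Hypothesis Hcont : strip_continuous H.
Hypothesis HH0 : forall t, nonneg_axis (H 0 t).
Hypothesis HH1 : forall t, H 1 t = g t.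
Hypothesis HHD : forall s t, 0 < s <= 1 -> D (H s t) /\ ~ nonneg_axis (H s t).
Hypothesis HHinf : forall A, exists T, forall s t,
  0 <= s <= 1 -> T <= Rabs t -> A <= Cmod (H s t).
Hypothesis HHhalf : exists T, forall s t, 0 < s <= 1 ->
  (t <= - T -> 0 < Re (H s t) /\ 0 < Im (H s t)) /\
  (T <= t -> 0 < Re (H s t) /\ Im (H s t) < 0).
Hypothesis HHlip : exists K T, forall s s' t,
  0 <= s <= 1 -> 0 <= s' <= 1 -> T <= Rabs t ->
  Cmod (H s t - H s' t)%C <= K * Rabs (s - s') * Cmod (H s t).
Hypothesis Hgrowth : exists M A, forall s t, 0 <= s <= 1 -> A <= Cmod (H s t) ->
  Cmod (f (H s t)) <= M * Rpower (Cmod (H s t)) (- eps - 1 - b).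
Hypothesis Hg : piecewise_C1 g.

Let F := branch_opp f b.
Let Q (x : R) : C := prim_pos f b (RtoC x).

(** Each [H 0 t] has a disc that belongs to [cut_star] off the axis; compactness of [t1, t2] yields
    one [s0], which therefore depends on the window. *)
Lemma start_in_cut_star (t1 t2 : R) : exists s0, 0 < s0 /\
  forall s t, 0 < s <= 1 -> s < s0 -> t1 <= t <= t2 -> cut_star D c (H s t).
Proof.
  destruct (lebesgue_number_1d t1 t2 (fun t d => forall s' t', 0 < s' <= 1 -> s' < d ->
    Rabs (t' - t) < d -> cut_star D c (H s' t'))) as [s0 [Hs0 Hleb]].
  { intros t Ht. destruct (axis_RtoC _ (HH0 t)) as [E _].
    destruct (cut_star_near_axis D c HDopen Hc HDc (Re (H 0 t))) as [r [Hr Hw]].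
    { apply HH0. }
    destruct (Hcont 0 t r) as [d [Hd Hd2]]; [lra|easy|].
    exists d. split; [easy|]. intros s' t' Hs' K1 K2. apply Hw; [|now apply HHD].
    rewrite <- E. apply Hd2; trivial; [lra|].
    rewrite Rminus_0_r, Rabs_pos_eq; lra. }
  exists s0. split; [easy|]. intros s t Hs Hss Ht.
  destruct (Hleb t Ht) as [t0 [d [Ht0 [HP [K1 K2]]]]]. apply HP; trivial. lra.
Qed.

(** As s tends to 0 the point [H s t] reaches the axis from one side only, where the germ expresses
    [prim_opp] through [prim_pos], which is continuous there. *)
Lemma end_limit (side : R) (Theta k : C) (t e : R) :
  (forall x, 0 < x -> germ f b c side Theta x k) ->
  Cmod Theta = 1 -> 0 < Cmod (H 0 t) -> 0 < e ->
  (forall s, 0 < s <= 1 -> 0 < side * Im (H s t)) ->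
  exists s0, 0 < s0 /\ forall s, 0 < s <= 1 -> s < s0 ->
    Cmod (prim_opp f b c (H s t) - (Theta * Q (Cmod (H 0 t)) + k)) <= e.
Proof.
  intros Hgerm HTheta Hpos He Hside.
  destruct (axis_RtoC _ (HH0 t)) as [E1 E2]. rewrite <- E2 in E1.
  set (x := Cmod (H 0 t)) in *.
  destruct (Hgerm x Hpos) as [r [Hr Hw]].
  assert (Hcc : ccont (prim_pos f b) (RtoC x)).
  { eapply cderiv_ccont. apply (prim_pos_cderiv f D b); trivial.
    now apply right_star_axis. }
  destruct (Hcc e He) as [d1 [Hd1 H1]].
  destruct (Hcont 0 t (Rmin r d1)) as [d2 [Hd2 H2]]; [lra|now apply Rmin_pos|].
  exists d2. split; [easy|]. intros s Hs Hss.
  assert (Hd : Cmod (H s t - RtoC x) < Rmin r d1).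
  { rewrite <- E1. apply H2; [lra|rewrite Rminus_0_r, Rabs_pos_eq; lra|].
    rewrite Rminus_diag, Rabs_R0. lra. }
  pose proof (Rmin_l r d1). pose proof (Rmin_r r d1).
  rewrite (Hw (H s t)); [|lra|now apply Hside].
  replace (Theta * prim_pos f b (H s t) + k - (Theta * Q x + k))%C
    with (Theta * (prim_pos f b (H s t) - prim_pos f b (RtoC x)))%C by (unfold Q; ring).
  rewrite Cmod_mult, HTheta, Rmult_1_l. apply H1. lra.
Qed.

(** At modulus h the bound is K M h^(b + (- eps - 1 - b) + 1) = K M h^(- eps): the growth of [f]
    beats the relative Lipschitz constant, which costs one factor h. *)
Lemma side_bound (B : R) : 0 < B -> exists K T, 0 <= K /\ forall t, T <= Rabs t ->
  (forall s s', 0 < s <= 1 -> 0 < s' <= 1 ->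
     Cmod (H s t - H s' t) <= K * Rabs (s - s') * Cmod (H s t)) /\
  (forall s, 0 < s <= 1 -> Cmod (F (H s t)) * (K * Cmod (H s t)) <= B).
Proof.
  intros HB. destruct HHlip as [K0 [T0 HK0]]. destruct Hgrowth as [M0 [A0 HM0]].
  set (K := Rabs K0). set (M := Rabs M0).
  assert (HK : 0 <= K) by apply Rabs_pos. assert (HM : 0 <= M) by apply Rabs_pos.
  assert (HKM : 0 <= K * M) by now apply Rmult_le_pos.
  destruct (Rpower_neg_small eps (B / (K * M + 1)) Heps) as [A1 [HA1 HA]].
  { apply Rdiv_lt_0_compat; lra. }
  destruct (HHinf (Rmax A0 A1)) as [T1 HT1].
  exists K, (Rmax T0 T1). split; [easy|]. intros t Ht.
  pose proof (Rmax_l T0 T1). pose proof (Rmax_r T0 T1).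
  pose proof (Rmax_l A0 A1). pose proof (Rmax_r A0 A1). split.
  - intros s s' Hs Hs'. eapply Rle_trans; [apply HK0; lra|].
    apply Rmult_le_compat_r; [apply Cmod_ge_0|].
    apply Rmult_le_compat_r; [apply Rabs_pos|apply Rle_abs].
  - intros s Hs. specialize (HT1 s t ltac:(lra) ltac:(lra)).
    specialize (HM0 s t ltac:(lra) ltac:(lra)). specialize (HA (Cmod (H s t)) ltac:(lra)).
    set (h := Cmod (H s t)) in *. assert (Hh : 0 < h) by lra.
    unfold F, branch_opp. rewrite Cmod_mult, Cmod_Cpower, Cmod_opp. fold h.
    apply Rle_trans with (Rpower h b * (M * Rpower h (- eps - 1 - b)) * (K * h)).
    { apply Rmult_le_compat_r; [apply Rmult_le_pos; lra|].
      apply Rmult_le_compat_l; [left; apply exp_pos|].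
      eapply Rle_trans; [exact HM0|]. apply Rmult_le_compat_r; [left; apply exp_pos|].
      apply Rle_abs. }
    replace (Rpower h b * (M * Rpower h (- eps - 1 - b)) * (K * h))
      with (K * M * Rpower h (- eps)).
    + apply Rle_trans with (K * M * (B / (K * M + 1))).
      * now apply Rmult_le_compat_l.
      * apply (Rmult_le_reg_r (K * M + 1)); [lra|].
        replace (K * M * (B / (K * M + 1)) * (K * M + 1)) with (K * M * B) by (field; lra).
        nra.
    + replace (- eps) with (b + (- eps - 1 - b) + 1) at 1 by ring.
      rewrite !Rpower_plus, Rpower_1 by easy. ring.
Qed.

Variables (Tp Tm kp km L : C).
Hypothesis HTp : Cmod Tp = 1.
Hypothesis HTm : Cmod Tm = 1.
Hypothesis Hkp : forall x, 0 < x -> germ f b c 1 Tp x kp.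
Hypothesis Hkm : forall x, 0 < x -> germ f b c (-1) Tm x km.
Hypothesis HL : forall e, 0 < e -> exists A, forall x, A <= x -> Cmod (Q x - L) <= e.

Lemma contour_integral_estimate (e : R) : 0 < e -> exists T, forall t1 t2,
  t1 <= - T -> T <= t2 -> exists I,
    is_RInt (V := C_R_NormedModule) (fun t => F (g t) * velocity g t)%C t1 t2 I /\
    Cmod (I - ((Tm * L + km) - (Tp * L + kp))) <= e.
Proof.
  intros He.
  (* Six errors of size e / 6: two side arcs, two boundary limits of Phi, two tails of Phi0. *)
  destruct (side_bound (e / 6)) as [K [T0 [HK HT0]]]; [lra|].
  destruct HHhalf as [T1 HT1]. destruct (HL (e / 6)) as [A HA]; [lra|].
  destruct (HHinf (Rmax A 1)) as [T2 HT2].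
  exists (Rmax (Rmax T0 T1) (Rmax T2 1)). intros t1 t2 Ht1 Ht2.
  pose proof (Rmax_l (Rmax T0 T1) (Rmax T2 1)). pose proof (Rmax_r (Rmax T0 T1) (Rmax T2 1)).
  pose proof (Rmax_l T0 T1). pose proof (Rmax_r T0 T1).
  pose proof (Rmax_l T2 1). pose proof (Rmax_r T2 1).
  pose proof (Rmax_l A 1). pose proof (Rmax_r A 1).
  assert (Ha1 : Rabs t1 = - t1) by (apply Rabs_left; lra).
  assert (Ha2 : Rabs t2 = t2) by (apply Rabs_pos_eq; lra).
  destruct (branch_opp_holomorphic f D b Hf) as [F' HF].
  pose proof (cut_domain_open D HDopen) as Hcd.
  assert (Hin : forall sigma, 0 < sigma -> forall s t,
    sigma <= s <= 1 -> t1 <= t <= t2 -> cut_domain D (H s t)).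
  { intros sigma Hsig s t Hs _. apply HHD. lra. }
  (* Any positive value would do for 1 / 2: this potential serves to evaluate the integral before
     sigma is known. *)
  destruct (potential_along_exists F F' (cut_domain D) H (1 / 2) t1 t2) as [P0 HP0];
    trivial; [lra|apply Hin; lra|].
  pose proof (potential_end F F' (cut_domain D) H (1 / 2) t1 t2 Hcd HF
    ltac:(lra) (Hin (1 / 2) ltac:(lra)) P0 g HP0 ltac:(lra) Hg HH1) as HI.
  exists (P0 1 t2 - P0 1 t1)%C. split; [exact HI|].
  set (I := (P0 1 t2 - P0 1 t1)%C) in *.
  pose proof (HT2 0 t1 ltac:(lra) ltac:(lra)) as HX1.
  pose proof (HT2 0 t2 ltac:(lra) ltac:(lra)) as HX2.
  destruct (end_limit 1 Tp kp t1 (e / 6)) as [s1 [Hs1 He1]]; trivial; try lra.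
  { intros s Hs. rewrite Rmult_1_l. apply HT1; lra. }
  destruct (end_limit (-1) Tm km t2 (e / 6)) as [s2 [Hs2 He2]]; trivial; try lra.
  { intros s Hs. assert (Im (H s t2) < 0) by (apply HT1; lra). lra. }
  destruct (start_in_cut_star t1 t2) as [s3 [Hs3 Hstar]].
  set (sigma := Rmin (Rmin s1 s2) (Rmin s3 1) / 2).
  pose proof (Rmin_l (Rmin s1 s2) (Rmin s3 1)). pose proof (Rmin_r (Rmin s1 s2) (Rmin s3 1)).
  pose proof (Rmin_l s1 s2). pose proof (Rmin_r s1 s2).
  pose proof (Rmin_l s3 1). pose proof (Rmin_r s3 1).
  assert (Hsig0 : 0 < Rmin (Rmin s1 s2) (Rmin s3 1)).
  { apply Rmin_pos; apply Rmin_pos; lra. }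
  assert (Hsig : 0 < sigma <= 1 /\ sigma < s1 /\ sigma < s2 /\ sigma < s3)
    by (unfold sigma; lra).
  clearbody sigma.
  destruct (potential_along_exists F F' (cut_domain D) H sigma t1 t2) as [P HP];
    trivial; [lra|apply Hin; lra|].
  pose proof (potential_end F F' (cut_domain D) H sigma t1 t2 Hcd HF
    ltac:(lra) (Hin sigma ltac:(lra)) P g HP ltac:(lra) Hg HH1) as HI2.
  (* Potentials for different sigma have the same increment along [g], by uniqueness of the
     integral. *)
  assert (EI : I = (P 1 t2 - P 1 t1)%C).
  { apply (is_RInt_unique (V := C_R_CompleteNormedModule)) in HI.
    apply (is_RInt_unique (V := C_R_CompleteNormedModule)) in HI2.
    rewrite <- HI. exact HI2. }
  assert (Hside : forall t, t1 <= t <= t2 -> T0 <= Rabs t ->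
    Cmod (P 1 t - P sigma t) <= e / 6).
  { intros t Ht HTt. destruct (HT0 t HTt) as [Hl Hb].
    apply (potential_side F F' (cut_domain D) H sigma t1 t2 Hcd HF Hcont
      ltac:(lra) (Hin sigma ltac:(lra)) P t K (e / 6) HP Ht HK).
    - intros s s' Hs Hs'. apply Hl; lra.
    - intros s Hs. apply Hb; lra. }
  pose proof (Hside t1 ltac:(lra) ltac:(lra)) as S1.
  pose proof (Hside t2 ltac:(lra) ltac:(lra)) as S2.
  assert (Estart : (P sigma t2 - P sigma t1
     = prim_opp f b c (H sigma t2) - prim_opp f b c (H sigma t1))%C).
  { apply (potential_start F (cut_domain D) H sigma t1 t2 ltac:(lra) P (cut_star D c));
      trivial; try lra.
    - now apply cut_star_open.
    - intros z [K1 K2]. split; [|easy]. now apply star_kernel_sub in K1.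
    - intros z Hz. now apply (prim_opp_cderiv f D b c).
    - intros t Ht. apply Hstar; lra. }
  specialize (He1 sigma ltac:(lra) ltac:(lra)). specialize (He2 sigma ltac:(lra) ltac:(lra)).
  pose proof (HA (Cmod (H 0 t1)) ltac:(lra)) as L1.
  pose proof (HA (Cmod (H 0 t2)) ltac:(lra)) as L2.
  set (X1 := Cmod (H 0 t1)) in *. set (X2 := Cmod (H 0 t2)) in *.
  set (u1 := (P 1 t1 - P sigma t1)%C) in *. set (u2 := (P 1 t2 - P sigma t2)%C) in *.
  set (v1 := (prim_opp f b c (H sigma t1) - (Tp * Q X1 + kp))%C) in *.
  set (v2 := (prim_opp f b c (H sigma t2) - (Tm * Q X2 + km))%C) in *.
  (* The path ends below the axis and starts above it, so [t2] brings [Tm] and [km], and [t1] brings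
     [Tp] and [kp] with a minus sign. *)
  assert (E : (I - ((Tm * L + km) - (Tp * L + kp))
    = (u2 + - u1) + (v2 + - v1) + (Tm * (Q X2 - L) + - (Tp * (Q X1 - L))))%C).
  { rewrite EI. unfold v1, v2.
    replace (P 1 t2 - P 1 t1)%C with (u2 - u1 + (P sigma t2 - P sigma t1))%C
      by (unfold u1, u2; ring).
    rewrite Estart. ring. }
  rewrite E.
  assert (M1 : Cmod (Tm * (Q X2 - L)) <= e / 6) by (rewrite Cmod_mult, HTm; lra).
  assert (M2 : Cmod (- (Tp * (Q X1 - L))) <= e / 6)
    by (rewrite Cmod_opp, Cmod_mult, HTp; lra).
  assert (N1 : Cmod (- u1) <= e / 6) by now rewrite Cmod_opp.
  assert (N2 : Cmod (- v1) <= e / 6) by now rewrite Cmod_opp.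
  set (w1 := (Tm * (Q X2 - L))%C) in *. set (w2 := (- (Tp * (Q X1 - L)))%C) in *.
  pose proof (Cmod_triangle u2 (- u1)). pose proof (Cmod_triangle v2 (- v1)).
  pose proof (Cmod_triangle w1 w2).
  pose proof (Cmod_triangle (u2 + - u1) (v2 + - v1)).
  pose proof (Cmod_triangle (u2 + - u1 + (v2 + - v1)) (w1 + w2)). lra.
Qed.

End Assembly.

(** * The finite part *)

Lemma is_derive_axis (f : C -> C) (D : C -> Prop) (b x : R) :
  copen D -> (forall z, nonneg_axis z -> D z) -> analytic_on D f -> 0 < x ->
  is_derive (V := C_R_NormedModule) (fun u => prim_pos f b (RtoC u)) x
    (RtoC (Rpower x b) * f (RtoC x))%C.
Proof.
  intros HDopen HDaxis Hf Hx.
  replace (RtoC (Rpower x b) * f (RtoC x))%C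
    with (RtoC (Rpower x b) * f (RtoC x) * RtoC 1)%C by ring.
  apply cderiv_path; [now apply (prim_pos_cderiv_axis f D)|apply is_derive_RtoC].
Qed.

Lemma is_RInt_axis (f : C -> C) (D : C -> Prop) (b x y : R) :
  copen D -> (forall z, nonneg_axis z -> D z) -> analytic_on D f -> 0 < x -> 0 < y ->
  is_RInt (V := C_R_NormedModule) (fun u => RtoC (Rpower u b) * f (RtoC u))%C x y
    (prim_pos f b (RtoC y) - prim_pos f b (RtoC x))%C.
Proof.
  intros HDopen HDaxis Hf Hx Hy.
  assert (Hpos : forall t, Rmin x y <= t -> 0 < t).
  { intros t Ht. assert (0 < Rmin x y) by now apply Rmin_pos. lra. }
  apply (is_RInt_derive (V := C_R_CompleteNormedModule) (fun u => prim_pos f b (RtoC u)));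
    intros t Ht; specialize (Hpos t (proj1 Ht)).
  - now apply (is_derive_axis f D).
  - apply continuous_Cmult.
    + eapply continuous_derive.
      apply (is_derive_ext_loc (V := C_R_NormedModule) (fun u => Cpower (RtoC u) b)).
      * apply locally_R_eps. exists t. split; [easy|]. intros u Hu.
        apply Rabs_def2 in Hu. apply Cpower_pos. lra.
      * apply (cderiv_path (fun z => Cpower z b) RtoC t (RtoC b * Cpower (RtoC t) (b - 1))%C 1);
          [|apply is_derive_RtoC].
        apply Cpower_cderiv. left. exact Hpos.
    + apply ccont_path; [|eapply continuous_derive, is_derive_RtoC].
      eapply cderiv_ccont. apply analytic_at_derive, Hf, HDaxis, RtoC_axis. lra.
Qed.

Lemma cis_opp_nPI (k : nat) : cis (- (INR k * PI)) = RtoC ((-1) ^ k).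
Proof.
  pose proof (cis_nPI k) as H. unfold cis, RtoC in *. rewrite cos_neg, sin_neg.
  injection H as H1 H2. rewrite H1, H2. f_equal. ring.
Qed.

Lemma pow_m1_sqr (k : nat) : (-1) ^ k * (-1) ^ k = 1.
Proof. rewrite <- Rpow_mult_distr. replace (-1 * -1) with 1 by ring. apply pow1. Qed.

(** The difference is 2 i sin (pi b), and b differs from alpha by the integer n + 1, so that sin (pi
    b) = (-1)^(n+1) sin (pi alpha). *)
Lemma jump_constant (alpha : R) (n : nat) : 0 < alpha < 1 ->
  (RtoC ((-1) ^ (n + 1)) / (RtoC 2 * Ci * RtoC (sin (PI * alpha)))
   * (cis (PI * (alpha - 1 - INR n)) - cis (- (PI * (alpha - 1 - INR n)))) = 1)%C.
Proof.
  intros Ha. set (b := alpha - 1 - INR n).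
  assert (Hsin : 0 < sin (PI * alpha)).
  { pose proof PI_RGT_0. apply sin_gt_0; nra. }
  assert (E : cis (PI * b) = (cis (PI * alpha) * RtoC ((-1) ^ (n + 1)))%C).
  { rewrite <- cis_opp_nPI, <- cis_plus. f_equal. unfold b. rewrite plus_INR. simpl. ring. }
  assert (Es : sin (PI * b) = (-1) ^ (n + 1) * sin (PI * alpha)).
  { apply (f_equal Im) in E. rewrite im_scal_r in E. simpl in E. rewrite E. ring. }
  assert (Ed : (cis (PI * b) - cis (- (PI * b)) = RtoC 2 * Ci * RtoC (sin (PI * b)))%C).
  { unfold cis. rewrite cos_neg, sin_neg.
    unfold RtoC, Ci, Cminus, Cmult, Cplus, Copp; simpl. f_equal; ring. }
  rewrite Ed, Es, RtoC_mult.
  assert (Hn : RtoC (sin (PI * alpha)) <> 0) by (intros K; apply RtoC_inj in K; lra).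
  assert (H2 : RtoC 2 <> 0) by (intros K; apply RtoC_inj in K; lra).
  transitivity (RtoC ((-1) ^ (n + 1)) * RtoC ((-1) ^ (n + 1)))%C.
  - field. repeat split; trivial. apply Ci_nz.
  - rewrite <- RtoC_mult, pow_m1_sqr. reflexivity.
Qed.

Definition finite_part_term (f : C -> C) (n : nat) (alpha e : R) (k : nat) : C :=
  (RtoC (Rpower e (alpha - INR n + INR k) / (INR (fact k) * (INR n - alpha - INR k)))
   * C_derive_n f k (RtoC 0))%C.

(** Since beta k = b + (k + 1), every phase is that of b times (-1)^(k+1), and this sign cancels the
    (-1)^k of [power_coeff] up to a minus: all terms share one factor, the one inverted by
    [jump_constant]. *)
Lemma principal_jump_terms (f : C -> C) (n : nat) (alpha e : R) : 0 < alpha < 1 ->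
  principal_jump f n alpha e
  = (sum_n (G := C_AbelianMonoid) (finite_part_term f n alpha e) n
     * - (cis (PI * (alpha - 1 - INR n)) - cis (- (PI * (alpha - 1 - INR n)))))%C.
Proof.
  intros Ha. unfold principal_jump. rewrite <- sum_n_C_mult_r. apply sum_n_C_ext.
  intros k. pose proof (exponent_neq_0 n alpha Ha k) as Hb. cbv beta in Hb.
  set (beta := alpha - INR n + INR k) in *. set (b := alpha - 1 - INR n).
  assert (E1 : cis (PI * beta) = (cis (PI * b) * RtoC ((-1) ^ (S k)))%C).
  { rewrite <- cis_nPI, <- cis_plus. f_equal. unfold beta, b. rewrite S_INR. ring. }
  assert (E2 : cis (- (PI * beta)) = (cis (- (PI * b)) * RtoC ((-1) ^ (S k)))%C).
  { rewrite <- cis_opp_nPI, <- cis_plus. f_equal. unfold beta, b. rewrite S_INR. ring. }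
  rewrite E1, E2. unfold finite_part_term, power_coeff. fold beta.
  replace (INR n - alpha - INR k) with (- beta) by (unfold beta; ring).
  assert (Hf : INR (fact k) <> 0) by apply INR_fact_neq_0.
  assert (Hfc : RtoC (INR (fact k)) <> 0) by (intros K; now apply RtoC_inj in K).
  assert (Hbc : RtoC beta <> 0) by (intros K; now apply RtoC_inj in K).
  rewrite RtoC_div by nra. rewrite RtoC_mult, RtoC_opp.
  replace (RtoC ((-1) ^ S k)) with (- RtoC ((-1) ^ k))%C.
  2:{ rewrite <- RtoC_opp. f_equal. simpl. ring. }
  transitivity (RtoC ((-1) ^ k) * RtoC ((-1) ^ k) *
    (C_derive_n f k 0 / INR (fact k) / beta
      * (cis (PI * b) - cis (- (PI * b))) * Rpower e beta))%C.
  - field. auto.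
  - rewrite <- RtoC_mult, pow_m1_sqr. field. auto.
Qed.

Theorem theorem1
  (n : nat) (alpha eps : R) (f : C -> C) (D : C -> Prop)
  (g : R -> C) (H : R -> R -> C)
  (Hn : (1 <= n)%nat)
  (Halpha : 0 < alpha < 1)
  (Heps : 0 < eps < 1)
  (HD : domain D)
  (HDaxis : forall z, nonneg_axis z -> D z)
  (Hf : analytic_on D f)
  (Hf0 : f (RtoC 0) <> RtoC 0)
  (Hgrowth : exists M, Rbar_locally p_infty (fun x =>
     Cmod (f (RtoC x)) <= M * Rpower x (INR n - alpha - eps)))
  (Hg : contour_in D g)
  (HH : deforms_onto_axis D g H)
  (HfH : growth_in_swept_region f H (INR n - alpha - eps)) :
  exists l : C,
    is_contour_integral
      (fun z => (Cpower (- z) (alpha - 1 - INR n) * f z)%C) g l /\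
    is_finite_part n alpha f
      (RtoC ((-1) ^ (n + 1)) / (RtoC 2 * Ci * RtoC (sin (PI * alpha))) * l)%C.
Proof.
  destruct HD as [HDopen _]. apply open_copen in HDopen.
  destruct Hg as [Hg _].
  destruct HH as [Hlim [HH1 [HH0 [HHD [HHinf [HHhalf HHlip]]]]]].
  apply deformation_strip_continuous in Hlim.
  set (b := alpha - 1 - INR n).
  (* Written so that the exponent b of the power cancels: the integrand is O(|z|^(- eps - 1)). *)
  assert (Eexp : INR n - alpha - eps = - eps - 1 - b) by (unfold b; ring).
  rewrite Eexp in *.
  assert (Hc : exists c, 0 < c /\ forall x, - c <= x -> D (RtoC x)).
  { destruct (HDopen (RtoC 0)) as [r [Hr Hw]]; [apply HDaxis, RtoC_axis, Rle_refl|].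
    exists (r / 2). split; [lra|]. intros x Hx. destruct (Rle_dec 0 x) as [h|h].
    - now apply HDaxis, RtoC_axis.
    - apply Hw. rewrite <- RtoC_minus, Cmod_R, Rminus_0_r, Rabs_left; lra. }
  destruct Hc as [c [Hc HDc]].
  destruct (germ_constant f D b c HDopen HDaxis Hf Hc HDc 1 (cis (- (PI * b))))
    as [kp Hkp]; [now left| |].
  { intros z Hz. unfold branch_opp, branch_pos. rewrite Cpower_opp_upper by lra. ring. }
  destruct (germ_constant f D b c HDopen HDaxis Hf Hc HDc (-1) (cis (PI * b)))
    as [km Hkm]; [now right| |].
  { intros z Hz. unfold branch_opp, branch_pos. rewrite Cpower_opp_lower by lra. ring. }
  set (Q := fun x => prim_pos f b (RtoC x)).
  assert (HL : exists L, forall e, 0 < e -> exists A, forall x, A <= x -> Cmod (Q x - L) <= e).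
  { destruct Hgrowth as [M [A HM]].
    (* [A] is a strict threshold in [Rbar_locally p_infty], hence [A + 1]; the maximum with 1 keeps
       the threshold positive. *)
    apply (limit_of_power_decay Q (fun x => RtoC (Rpower x b) * f (RtoC x))%C
      (Rabs M) (Rmax (A + 1) 1) eps); try lra.
    - pose proof (Rmax_r (A + 1) 1). lra.
    - apply Rabs_pos.
    - intros x Hx. now apply (is_derive_axis f D).
    - intros x Hx. pose proof (Rmax_l (A + 1) 1). pose proof (Rmax_r (A + 1) 1).
      specialize (HM x ltac:(lra)).
      replace (- eps - 1) with (b + (- eps - 1 - b)) by ring.
      assert (Hp : 0 < Rpower x b) by apply exp_pos.
      assert (Hp2 : 0 < Rpower x (- eps - 1 - b)) by apply exp_pos.
      rewrite Rpower_plus, Cmod_mult, Cmod_R, Rabs_pos_eq by lra.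
      replace (Rabs M * (Rpower x b * Rpower x (- eps - 1 - b)))
        with (Rpower x b * (Rabs M * Rpower x (- eps - 1 - b))) by ring.
      apply Rmult_le_compat_l; [lra|]. eapply Rle_trans; [exact HM|].
      apply Rmult_le_compat_r; [lra|apply Rle_abs]. }
  destruct HL as [L HL].
  exists ((cis (PI * b) * L + km) - (cis (- (PI * b)) * L + kp))%C. split.
  - intros P HP. apply locally_C_eps in HP. destruct HP as [e [He HP]].
    destruct (contour_integral_estimate f D H g b c eps HDopen HDaxis Hf Hc HDc
      (proj1 Heps) Hlim HH0 HH1 HHD HHinf HHhalf HHlip HfH Hg
      (cis (- (PI * b))) (cis (PI * b)) kp km L (Cmod_cis _) (Cmod_cis _) Hkp Hkm HL
      (e / 2)) as [T HT]; [lra|].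
    apply (Filter_prod _ _ _ (fun x => x < - T) (fun x => T < x)).
    + now exists (- T).
    + now exists T.
    + intros t1 t2 Ht1 Ht2. destruct (HT t1 t2) as [I [HI HI2]]; [lra|lra|].
      exists I. split; [exact HI|]. apply HP. lra.
  (* [Q] is Phi0 on the positive axis and [L] its limit, so this is the integral from [e] to
     infinity. *)
  - exists (fun e => (L - Q e)%C). split.
    + intros e He P HP. apply locally_C_eps in HP. destruct HP as [d [Hd HP]].
      destruct (HL (d / 2)) as [A HA]; [lra|].
      apply (Filter_prod _ _ _ (fun x => x = e) (fun x => Rmax A 0 < x)).
      * reflexivity.
      * now exists (Rmax A 0).
      * intros x y -> Hy. pose proof (Rmax_l A 0). pose proof (Rmax_r A 0).
        exists (Q y - Q e)%C. split.
        -- simpl. apply (is_RInt_axis f D); trivial. lra.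
        -- apply HP. specialize (HA y ltac:(lra)).
           replace (Q y - Q e - (L - Q e))%C with (Q y - L)%C by ring. lra.
    + pose proof (jump_constant alpha n Halpha) as Hkappa. fold b in Hkappa.
      set (kappa := (RtoC ((-1) ^ (n + 1)) / (RtoC 2 * Ci * RtoC (sin (PI * alpha))))%C) in *.
      set (dT := (cis (PI * b) - cis (- (PI * b)))%C) in *.
      destruct (jump_bound f D n alpha c Halpha HDopen HDaxis Hf Hc HDc kp km Hkp Hkm)
        as [K [e0 [HK [He0 Hjump]]]].
      intros P HP. apply locally_C_eps in HP. destruct HP as [d [Hd HP]].
      (* [N * e] bounds the error of [jump_bound] and [An * e ^ alpha] the term of degree n; each is
         made at most d / 4. *)
      set (N := Cmod kappa * K). set (An := Cmod (C_derive_n f n (RtoC 0)) / (INR (fact n) * alpha)).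
      assert (HN : 0 <= N) by (apply Rmult_le_pos; [apply Cmod_ge_0|easy]).
      assert (Hfact : 0 < INR (fact n)) by apply INR_fact_lt_0.
      assert (HAn : 0 <= An).
      { apply Rmult_le_pos; [apply Cmod_ge_0|]. left. apply Rinv_0_lt_compat.
        apply Rmult_lt_0_compat; lra. }
      destruct (Rpower_small alpha (d / 4 / (An + 1))) as [e1 [He1 Hsmall]]; [lra| |].
      { apply Rdiv_lt_0_compat; lra. }
      set (e2 := Rmin (Rmin e0 e1) (d / 4 / (N + 1))).
      assert (He2 : 0 < e2).
      { apply Rmin_pos; [now apply Rmin_pos|]. apply Rdiv_lt_0_compat; lra. }
      exists (mkposreal e2 He2). intros e Hee Hepos.
      assert (Hlt : e < e2).
      { change (Rabs (e - 0) < e2) in Hee. rewrite Rminus_0_r, Rabs_pos_eq in Hee; lra. }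
      assert (He02 : e2 <= Rmin e0 e1) by apply Rmin_l.
      assert (He03 : e2 <= d / 4 / (N + 1)) by apply Rmin_r.
      pose proof (Rmin_l e0 e1). pose proof (Rmin_r e0 e1).
      specialize (Hjump e ltac:(lra)). specialize (Hsmall e ltac:(lra)).
      fold b in Hjump. fold (Q e) in Hjump.
      rewrite (principal_jump_terms f n alpha e Halpha) in Hjump. fold b dT in Hjump.
      apply HP.
      change (Cmod ((L - Q e)
        - sum_n (G := C_AbelianMonoid) (finite_part_term f n alpha e) (n - 1)
        - kappa * (cis (PI * b) * L + km - (cis (- (PI * b)) * L + kp))) < d).
      (* Here [n >= 1] matters: the sum up to n is the finite-part sum up to n - 1 plus the single
         term [S1]. *)
      destruct n as [|m]; [lia|].
      replace (S m - 1)%nat with m by lia.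
      rewrite sum_n_C_S in Hjump.
      set (S0 := sum_n (G := C_AbelianMonoid) (finite_part_term f (S m) alpha e) m : C) in *.
      set (S1 := finite_part_term f (S m) alpha e (S m)) in *.
      set (X := (cis (PI * b) * Q e + km - (cis (- (PI * b)) * Q e + kp)
          - (S0 + S1) * - dT)%C) in *.
      (* As [kappa * dT = 1], both [L] and the constants [kp], [km] cancel; what survives is the
         defect [X] of the jump and the term [S1], which the finite part does not subtract. *)
      replace (L - Q e - S0 - kappa * (cis (PI * b) * L + km - (cis (- (PI * b)) * L + kp)))%C
        with (- (kappa * X) + S1)%C.
      2:{ unfold X.
          transitivity ((kappa * dT) * (- Q e - S0 - S1) + S1 - kappa * (km - kp)
            + (1 - kappa * dT) * L + (kappa * dT - 1) * L)%C.
          - unfold dT. ring.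
          - transitivity ((kappa * dT) * (L - Q e - S0 - S1) + S1 - kappa * (km - kp)
              - (kappa * dT) * L)%C; [ring|].
            (* Only the first [kappa * dT] becomes 1; the other one is the product hidden in [kappa]
               times the contour value. *)
            rewrite Hkappa at 1. unfold dT. ring. }
      assert (HX : Cmod (kappa * X) <= d / 4).
      { rewrite Cmod_mult. apply Rle_trans with (N * e).
        - unfold N. rewrite Rmult_assoc. apply Rmult_le_compat_l; [apply Cmod_ge_0|easy].
        - apply Rle_trans with ((N + 1) * (d / 4 / (N + 1))).
          + apply Rmult_le_compat; lra.
          + right. field. lra. }
      assert (HS1 : Cmod S1 <= d / 4).
      { unfold S1, finite_part_term.
        replace (alpha - INR (S m) + INR (S m)) with alpha by ring.
        replace (INR (S m) - alpha - INR (S m)) with (- alpha) by ring.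
        rewrite Cmod_mult, Cmod_R.
        replace (Rpower e alpha / (INR (fact (S m)) * - alpha))
          with (- (Rpower e alpha / (INR (fact (S m)) * alpha))) by (field; lra).
        assert (Hp : 0 < Rpower e alpha) by apply exp_pos.
        rewrite Rabs_Ropp, Rabs_pos_eq.
        2:{ left. apply Rdiv_lt_0_compat; [easy|]. apply Rmult_lt_0_compat; lra. }
        replace (Rpower e alpha / (INR (fact (S m)) * alpha)
            * Cmod (C_derive_n f (S m) 0)) with (An * Rpower e alpha)
          by (unfold An; field; lra).
        apply Rle_trans with ((An + 1) * (d / 4 / (An + 1))).
        - apply Rmult_le_compat; lra.
        - right. field. lra. }
      eapply Rle_lt_trans; [apply Cmod_triangle|]. rewrite Cmod_opp. lra.
Qed.
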